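(* Let $m\ge2$. For all $n,k\ge0$, the eigenvalue $\lambda_{n,m}^{k,c}$ of $QP_c$ is a continuous function of $c\in(0,\infty)$.
   Context: $\mathbb{R}_m$ (resp. $\mathbb{C}_m$) is the real (resp. complex) Clifford algebra generated by $e_1,\dots,e_m$ with $e_j^2=-1$, $e_ie_j=-e_je_i$ ($i\ne j$). A point $x\in\mathbb{R}^m$ is identified with $\sum_j e_jx_j$, so $x^2=-|x|^2$; $\langle x,y\rangle=\sum_j x_jy_j$ for vectors. Clifford conjugation $\lambda\mapsto\bar\lambda$ is the conjugate-linear anti-automorphism of $\mathbb{C}_m$ with $\overline{e_j}=-e_j$. The Dirac operator is $\partial_x=\sum_j e_j\partial_{x_j}$ (acting from the left). $B(r)$ is the closed ball of radius $r$ centred at $0$ in $\mathbb{R}^m$. For $c\ge0$, $L_cf(x)=\partial_x\big((1-|x|^2)\partial_xf(x)\big)+4\pi^2c^2|x|^2f(x)$ on $B(1)$. $M_l^+(k)$ is the right $\mathbb{R}_m$-module of $\mathbb{R}_m$-valued polynomials on $\mathbb{R}^m$ that are homogeneous of degree $k$ and left monogenic ($\partial_xY=0$); it has rank $d_k=\frac{(m+k-2)!}{(m-2)!\,k!}$. Fix a basis $\{Y_k^i\}_{i=1}^{d_k}$ of it with $\int_{S^{m-1}}\overline{Y_k^i(\omega)}Y_k^j(\omega)\,d\omega=\delta_{ij}$. Clifford prolate spheroidal wave functions (CPSWFs). Even: the real $\chi$ for which there is a nonzero $P\in C^\infty([0,1],\mathbb{R})$ with $L_c[P(|x|^2)Y_k^i(x)]=\chi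 P(|x|^2)Y_k^i(x)$ on $B(1)$ do not depend on $i$ and form a strictly increasing sequence $\chi_{0,m}^{k,c}<\chi_{2,m}^{k,c}<\cdots$; for $\chi=\chi_{2N,m}^{k,c}$, $P=P_{N,m}^{k,c}$ is unique up to a real factor, and $\psi_{2N,m}^{k,c,i}(x)=P_{N,m}^{k,c}(|x|^2)Y_k^i(x)$. Odd: likewise with $xQ(|x|^2)Y_k^i(x)$ in place of $P(|x|^2)Y_k^i(x)$, giving $\chi_{1,m}^{k,c}<\chi_{3,m}^{k,c}<\cdots$, functions $Q_{N,m}^{k,c}$, and $\psi_{2N+1,m}^{k,c,i}(x)=xQ_{N,m}^{k,c}(|x|^2)Y_k^i(x)$. All are normalised in $L^2(B(1))$ and extended by $0$ outside $B(1)$. Operators: $\mathcal{F}f(\xi)=\int_{\mathbb{R}^m}e^{-2\pi i\langle x,\xi\rangle}f(x)\,dx$; $Qf=\chi_{B(1)}f$ (indicator of $B(1)$); $P_cf(x)=\int_{B(c)}\mathcal{F}f(\xi)e^{2\pi i\langle\xi,x\rangle}\,d\xi$. For each $c>0$ and $n,k,i$ one has $QP_c\psi_{n,m}^{k,c,i}=\lambda_{n,m}^{k,c}\psi_{n,m}^{k,c,i}$ with $\lambda_{n,m}^{k,c}>0$ independent of $i$. *)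

(* Defs.v *)
From HB Require Import structures.
From mathcomp Require Import all_boot all_order all_algebra.
From mathcomp Require Import all_classical all_reals all_analysis.
From mathcomp Require Import complex.

Set Implicit Arguments.
Unset Strict Implicit.
Unset Printing Implicit Defensive.

Import Order.TTheory GRing.Theory Num.Theory.
Import numFieldNormedType.Exports.

Local Open Scope classical_set_scope.
Local Open Scope ring_scope.

Section Clifford.
Variables (K : comNzRingType) (m : nat).
Implicit Types A B C : {set 'I_m}.

(* An element is the family of its coordinates in the basis
   e_A = e_(i1) ... e_(ir), for A = {i1 < ... < ir}. The alias hides the
   pointwise product that {ffun _ -> K} may carry. *)
Definition cliff : Type := {ffun {set 'I_m} -> K}.
HB.instance Definition _ := GRing.Lmodule.copy cliff {ffun {set 'I_m} -> K^o}.

Definition symdiff A B : {set 'I_m} := (A :\: B) :|: (B :\: A).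

(* e_A * e_B = cl_sign A B *: e_(symdiff A B): sorting the word e_A e_B moves
   each e_j (j in B) to the left past every e_i (i in A) with j < i, and then
   e_j meets e_j when j is also in A, contributing e_j ^+ 2 = -1. *)
Definition cl_sign A B : K :=
  \prod_(i in A) \prod_(j in B) (if (j <= i)%N then -1 else 1).

Definition cl_one : cliff := [ffun A => (A == finset.set0)%:R].

Definition cl_mul (a b : cliff) : cliff :=
  [ffun C => \sum_A \sum_(B | symdiff A B == C) cl_sign A B * a A * b B].

Lemma in_symdiff i A B : (i \in symdiff A B) = (i \in A) (+) (i \in B).
Proof. by rewrite !inE; case: (i \in A); case: (i \in B). Qed.

Lemma symdiffA : associative symdiff.
Proof. by move=> A B C; apply/setP => i; rewrite !in_symdiff addbA. Qed.

Lemma symdiffC : commutative symdiff.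
Proof. by move=> A B; apply/setP => i; rewrite !in_symdiff addbC. Qed.

Lemma symdiff0 A : symdiff A finset.set0 = A.
Proof. by apply/setP => i; rewrite in_symdiff inE addbF. Qed.

Lemma symdiffK A B : symdiff A (symdiff A B) = B.
Proof. by apply/setP => i; rewrite !in_symdiff addKb. Qed.

Lemma symdiff_eq A B C : (symdiff A B == C) = (B == symdiff A C).
Proof. by apply/eqP/eqP => [<-|->]; rewrite symdiffK. Qed.

Lemma prod_symdiff (g : 'I_m -> K) A B : (forall i, g i * g i = 1) ->
  \prod_(i in symdiff A B) g i = \prod_(i in A) g i * \prod_(i in B) g i.
Proof.
move=> g2; rewrite !(big_mkcond (fun i => i \in _)) -big_split /=.
apply: eq_bigr => i _; rewrite in_symdiff.
by case: (i \in A); case: (i \in B); rewrite /= ?g2 ?mulr1 ?mul1r.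
Qed.

Let s (i j : 'I_m) : K := if (j <= i)%N then -1 else 1.

Let s2 i j : s i j * s i j = 1.
Proof. by rewrite /s; case: ifP; rewrite ?mulrNN mulr1. Qed.

Lemma cl_signDl A B C : cl_sign (symdiff A B) C = cl_sign A C * cl_sign B C.
Proof.
apply: prod_symdiff => i.
by rewrite -big_split big1 //= => j _; exact: s2.
Qed.

Lemma cl_signDr A B C : cl_sign A (symdiff B C) = cl_sign A B * cl_sign A C.
Proof.
rewrite /cl_sign -big_split; apply: eq_bigr => i _.
by apply: prod_symdiff => j; exact: s2.
Qed.

Lemma cl_sign0l A : cl_sign finset.set0 A = 1.
Proof. by rewrite /cl_sign big_set0. Qed.

Lemma cl_sign0r A : cl_sign A finset.set0 = 1.
Proof. by rewrite /cl_sign big1 // => i _; rewrite big_set0. Qed.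

Lemma cl_mulE (a b : cliff) C :
  cl_mul a b C = \sum_A cl_sign A (symdiff A C) * a A * b (symdiff A C).
Proof.
rewrite ffunE; apply: eq_bigr => A _.
by rewrite (eq_bigl (pred1 (symdiff A C))) ?big_pred1_eq // => B;
   rewrite symdiff_eq.
Qed.

Lemma cl_mulA : associative cl_mul.
Proof.
move=> a b c; apply/ffunP => D; rewrite !cl_mulE.
transitivity (\sum_A \sum_B cl_sign A (symdiff A D) *
    cl_sign B (symdiff B (symdiff A D)) * a A * b B *
    c (symdiff B (symdiff A D))).
  apply: eq_bigr => A _; rewrite cl_mulE big_distrr /=.
  apply: eq_bigr => B _; rewrite -!mulrA; congr (_ * _).
  by rewrite mulrCA.
rewrite [LHS](eq_bigr (fun A => \sum_E cl_sign A (symdiff A D) *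
    cl_sign (symdiff A E) (symdiff E D) * a A * b (symdiff A E) *
    c (symdiff E D))); last first.
  move=> A _; rewrite (reindex_inj (can_inj (symdiffK A))) /=.
  apply: eq_bigr => E _.
  suff -> : symdiff (symdiff A E) (symdiff A D) = symdiff E D by [].
  by rewrite -symdiffA (symdiffC E) -!symdiffA symdiffK symdiffC.
rewrite exchange_big; apply: eq_bigr => E _ /=.
rewrite cl_mulE mulr_sumr mulr_suml; apply: eq_bigr => A _.
have -> : cl_sign A (symdiff A D) * cl_sign (symdiff A E) (symdiff E D) =
    cl_sign E (symdiff E D) * cl_sign A (symdiff A E).
  have -> : symdiff A D = symdiff (symdiff A E) (symdiff E D).
    by rewrite -symdiffA symdiffK.
  rewrite cl_signDr cl_signDl.
  have sq : cl_sign A (symdiff E D) * cl_sign A (symdiff E D) = 1.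
    rewrite -cl_signDr (_ : symdiff _ _ = finset.set0) ?cl_sign0r //.
    by apply/setP => i; rewrite in_symdiff addbb inE.
  by rewrite -mulrA [X in _ * X]mulrA sq mul1r mulrC.
by rewrite -!mulrA; congr (_ * _); rewrite !mulrA.
Qed.

Lemma cl_mul1l : left_id cl_one cl_mul.
Proof.
move=> a; apply/ffunP => C; rewrite cl_mulE (bigD1 finset.set0) //= big1.
  by rewrite symdiffC symdiff0 cl_sign0l ffunE eqxx !mul1r addr0.
by move=> A /negPf A0; rewrite ffunE A0 mulr0 mul0r.
Qed.

Lemma cl_mul1r : right_id cl_one cl_mul.
Proof.
move=> a; apply/ffunP => C; rewrite cl_mulE (bigD1 C) //= big1.
  have -> : symdiff C C = finset.set0.
    by apply/setP => i; rewrite in_symdiff addbb inE.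
  by rewrite cl_sign0r ffunE eqxx mul1r mulr1 addr0.
move=> A AC; rewrite ffunE (_ : (_ == _) = false) ?mulr0 //.
by apply/negbTE; apply: contra AC; rewrite symdiff_eq symdiff0 eq_sym.
Qed.

Lemma cl_mulDl : left_distributive cl_mul +%R.
Proof.
move=> a b c; apply/ffunP => C; rewrite [RHS]ffunE !cl_mulE -big_split /=.
by apply: eq_bigr => A _; rewrite ffunE mulrDr mulrDl.
Qed.

Lemma cl_mulDr : right_distributive cl_mul +%R.
Proof.
move=> a b c; apply/ffunP => C; rewrite [RHS]ffunE !cl_mulE -big_split /=.
by apply: eq_bigr => A _; rewrite ffunE mulrDr.
Qed.

Lemma cl_one_neq0 : cl_one != 0.
Proof.
apply/eqP => /ffunP/(_ finset.set0); rewrite !ffunE eqxx => /eqP.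
by rewrite oner_eq0.
Qed.

HB.instance Definition _ := GRing.Zmodule_isNzRing.Build cliff
  cl_mulA cl_mul1l cl_mul1r cl_mulDl cl_mulDr cl_one_neq0.

Lemma cl_scaleE (k : K) (a : cliff) A : (k *: a) A = k * a A.
Proof. by rewrite ffunE. Qed.

Lemma cl_scaleAl (k : K) (a b : cliff) : k *: (a * b) = (k *: a) * b.
Proof.
apply/ffunP => C; rewrite cl_scaleE [in LHS]cl_mulE [in RHS]cl_mulE mulr_sumr.
by apply: eq_bigr => A _; rewrite cl_scaleE /= !mulrA (mulrC k).
Qed.

Lemma cl_scaleAr (k : K) (a b : cliff) : k *: (a * b) = a * (k *: b).
Proof.
apply/ffunP => C; rewrite cl_scaleE [in LHS]cl_mulE [in RHS]cl_mulE mulr_sumr.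
by apply: eq_bigr => A _; rewrite cl_scaleE /= [in RHS]mulrCA.
Qed.

HB.instance Definition _ := GRing.Lmodule_isLalgebra.Build K cliff cl_scaleAl.
HB.instance Definition _ := GRing.Lalgebra_isAlgebra.Build K cliff cl_scaleAr.

Definition cl_gen (j : 'I_m) : cliff :=
  [ffun A => (A == finset.set1 j)%:R].

Lemma cl_genM i j : cl_gen i * cl_gen j =
  [ffun C => (if (j <= i)%N then -1 else 1) *
             (C == symdiff (finset.set1 i) (finset.set1 j))%:R].
Proof.
apply/ffunP => C; rewrite [LHS]cl_mulE ffunE (bigD1 (finset.set1 i)) //= big1.
  rewrite !ffunE eqxx mulr1 addr0 symdiff_eq; case: eqP => [->|]; last by rewrite !mulr0.
  by rewrite /cl_sign symdiffK !big_set1.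
by move=> A /negPf Ai; rewrite ffunE Ai mulr0 mul0r.
Qed.

Lemma cl_gen_sqr j : cl_gen j * cl_gen j = -1.
Proof.
rewrite cl_genM leqnn; apply/ffunP => C; rewrite !ffunE mulN1r.
congr (- (_ == _)%:R).
by apply/setP => i; rewrite in_symdiff addbb inE.
Qed.

Lemma cl_gen_anticomm i j : i != j ->
  cl_gen i * cl_gen j = - (cl_gen j * cl_gen i).
Proof.
move=> ij; rewrite !cl_genM; apply/ffunP => C; rewrite !ffunE symdiffC.
have : (i != j :> nat)%N by [].
by case: ltngtP => //= _ _; rewrite mulN1r mul1r ?opprK.
Qed.

End Clifford.

Section Lebesgue.
Variable R : realType.

(* Lebesgue measure on R^n, built as the n-fold product of the one on R. *)
Section Step.
Variables (n : nat) (mu : {sigma_finite_measure set (n.-tuple R) -> \bar R}).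

Definition cons_tuple_pair (p : R * n.-tuple R) : n.+1.-tuple R :=
  [tuple of p.1 :: p.2].

Lemma measurable_cons_tuple_pair : measurable_fun [set: _] cons_tuple_pair.
Proof. exact: (measurable_cons measurable_fst measurable_snd). Qed.

Definition lebesgue_step : set (n.+1.-tuple R) -> \bar R :=
  pushforward (lebesgue_measure \x mu)%E cons_tuple_pair.

Let preimage_measurable (A : set (n.+1.-tuple R)) :
  measurable A -> measurable (cons_tuple_pair @^-1` A).
Proof.
by move=> mA; rewrite -[X in measurable X]setTI;
   exact: measurable_cons_tuple_pair.
Qed.

Let lebesgue_step0 : lebesgue_step set0 = 0%E.
Proof. by rewrite /lebesgue_step /pushforward preimage_set0 measure0. Qed.

Let lebesgue_step_ge0 A : (0 <= lebesgue_step A)%E.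
Proof. by rewrite /lebesgue_step /pushforward measure_ge0. Qed.

Let lebesgue_step_sigma_additive : semi_sigma_additive lebesgue_step.
Proof.
move=> F mF tF mUF; rewrite /lebesgue_step /pushforward preimage_bigcup.
apply: measure_semi_sigma_additive.
- by move=> k; exact: preimage_measurable.
- apply/trivIsetP => /= i j _ _ ij; rewrite -preimage_setI.
  by move/trivIsetP : tF => /(_ _ _ _ _ ij) ->//; rewrite preimage_set0.
- by rewrite -preimage_bigcup; exact: preimage_measurable.
Qed.

HB.instance Definition _ := isMeasure.Build _ _ _ lebesgue_step
  lebesgue_step0 lebesgue_step_ge0 lebesgue_step_sigma_additive.

Lemma lebesgue_stepE (A : set R) (B : set (n.-tuple R)) :
  measurable A -> measurable B ->
  lebesgue_step [set t | A (thead t) /\ B [tuple of behead t]] =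
  (lebesgue_measure A * mu B)%E.
Proof.
move=> mA mB; rewrite -product_measure1E // /lebesgue_step /pushforward.
congr (product_measure1 _ _ _).
apply/funext => -[x t]; rewrite /preimage /mkset /=.
have -> : [tuple of behead (cons_tuple_pair (x, t))] = t by exact: val_inj.
by rewrite theadE.
Qed.

Lemma sigma_finite_lebesgue_step : sigma_finite [set: _] lebesgue_step.
Proof.
have /sigma_finiteP[F [FT ndF mF]] := sigma_finiteT (@lebesgue_measure R).
have /sigma_finiteP[G [GT ndG mG]] := sigma_finiteT mu.
exists (fun k => [set t | F k (thead t) /\ G k [tuple of behead t]]).
  apply/seteqP; split=> // t _.
  have : [set: R] (thead t) by []. rewrite FT => -[i _ Fi].
  have : [set: n.-tuple R] [tuple of behead t] by []. rewrite GT => -[j _ Gj].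
  exists (maxn i j) => //; split.
    by have /subsetPset := ndF _ _ (leq_maxl i j); exact.
  by have /subsetPset := ndG _ _ (leq_maxr i j); exact.
move=> k; have [mFk Fk] := mF k; have [mGk Gk] := mG k; split.
  apply: measurableI.
    by rewrite -[X in measurable X]setTI; apply: measurable_tnth.
  by rewrite -[X in measurable X]setTI; apply: measurable_behead.
by rewrite lebesgue_stepE // lte_mul_pinfty // ge0_fin_numE.
Qed.

HB.instance Definition _ :=
  Measure_isSigmaFinite.Build _ _ _ lebesgue_step sigma_finite_lebesgue_step.

End Step.

Fixpoint lebesgue_tuple n :
    {sigma_finite_measure set (n.-tuple R) -> \bar R} :=
  if n is n'.+1 then lebesgue_step (lebesgue_tuple n')
  else \d_([tuple] : 0.-tuple R).

Variable m : nat.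
Implicit Types (x y : 'rV[R]_m) (D : set 'rV[R]_m).

(* The library equips tuples, but not row vectors, with a sigma-algebra. *)
Definition rint D (f : 'rV[R]_m -> R) : R :=
  let v (t : m.-tuple R) : 'rV[R]_m := \row_j tnth t j in
  Rintegral (lebesgue_tuple m) (v @^-1` D) (f \o v).

Definition cint D (f : 'rV[R]_m -> R[i]) : R[i] :=
  (rint D (fun x => complex.Re (f x)) +i* rint D (fun x => complex.Im (f x)))%C.

(* The norm `|x| of a row vector is the sup norm in the library, whence this
   Euclidean inner product. *)
Definition dotp x y : R := \sum_j x 0 j * y 0 j.
Definition sqnorm x : R := dotp x x.
Definition cball (r : R) : set 'rV[R]_m := [set x | sqnorm x <= r ^+ 2].

(* Surface integral over the unit sphere, the surface measure of S being m
   times the volume of the cone {r w | 0 < r <= 1, w in S}. *)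
Definition sphere_int (f : 'rV[R]_m -> R) : R :=
  m%:R * rint (cball 1) (fun x => f ((Num.sqrt (sqnorm x))^-1 *: x)).

End Lebesgue.

Section CliffordAnalysis.
Variables (R : realType) (m : nat).
Local Notation Rm := 'rV[R]_m.
Local Notation Cl := (cliff R m).
Implicit Types (x : Rm) (f : Rm -> Cl).

Definition cl_vec x : Cl := \sum_j x 0 j *: cl_gen R j.

(* conj(e_A) = (-1)^|A| e_(ir) ... e_(i1) = (-1)^(|A| + 'C(|A|, 2)) e_A. *)
Definition cl_conj (a : Cl) : Cl :=
  [ffun A : {set 'I_m} => (-1) ^+ (#|A| + 'C(#|A|, 2)) * a A].

Definition cl_partial (j : 'I_m) f x : Cl :=
  [ffun A => 'D_(delta_mx 0 j : Rm) (fun y => f y A) x].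

Definition dirac_op f x : Cl := \sum_j cl_gen R j * cl_partial j f x.

Definition Lc (c : R) f x : Cl :=
  dirac_op (fun y => (1 - sqnorm y) *: dirac_op f y) x
  + (4 * pi ^+ 2 * c ^+ 2 * sqnorm x) *: f x.

Definition homog_poly (k : nat) f : Prop :=
  exists a : {ffun 'I_m -> 'I_k.+1} -> Cl, forall x,
    f x = \sum_(al : {ffun 'I_m -> 'I_k.+1} | (\sum_j al j)%N == k)
      (\prod_j x 0 j ^+ al j) *: a al.

Definition monogenic_poly (k : nat) f : Prop :=
  homog_poly k f /\ forall x, dirac_op f x = 0.

Definition monogenic_dim (k : nat) : nat :=
  ((m + k - 2)`! %/ ((m - 2)`! * k`!))%N.

Definition orthonormal_basis (k : nat)
    (Y : 'I_(monogenic_dim k) -> Rm -> Cl) : Prop :=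
  [/\ forall i, monogenic_poly k (Y i),
      forall f, monogenic_poly k f ->
        exists! a : {ffun 'I_(monogenic_dim k) -> Cl},
          forall x, f x = \sum_i Y i x * a i
    & forall i j,
        [ffun A => sphere_int (fun w => (cl_conj (Y i w) * Y j w) A)]
        = (i == j)%:R :> Cl].

(* C^oo([0, 1], R) is taken as the restrictions to [0, 1] of the functions in
   C^oo(R, R); P stands for its restriction. *)
Definition smooth (P : R -> R) : Prop :=
  forall n t, derivable (derive1n n P) t 1.

Definition nonzero01 (P : R -> R) : Prop := exists2 t, 0 <= t <= 1 & P t != 0.

(* P(|x|^2) Y(x) if b = false, and x P(|x|^2) Y(x) if b = true. *)
Definition radial_form (b : bool) (P : R -> R) f x : Cl :=
  (if b then cl_vec x else 1) * (P (sqnorm x) *: f x).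

Definition Lc_eigen (b : bool) (c : R) f (z : R) (P : R -> R) : Prop :=
  [/\ smooth P, nonzero01 P &
      forall x, cball 1 x ->
        Lc c (radial_form b P f) x = z *: radial_form b P f x].

(* chi enumerates increasingly the eigenvalues of L_c of parity b; chi N is
   chi_(2N) if b = false, and chi_(2N + 1) if b = true. *)
Definition Lc_spectrum (b : bool) (c : R) (d : nat) (Y : 'I_d -> Rm -> Cl)
    (chi : nat -> R) : Prop :=
  {homo chi : M N / (M < N)%N >-> M < N} /\
  forall i z, (exists P, Lc_eigen b c (Y i) z P) <-> exists N, z = chi N.

(* psi is the function psi_n^i. The scalar part of conj(psi) psi is the squared
   Euclidean norm of psi. *)
Definition is_cpswf (c : R) (d : nat) (Y : 'I_d -> Rm -> Cl) (n : nat)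
    (i : 'I_d) (psi : Rm -> Cl) : Prop :=
  exists (chi : nat -> R) (P : R -> R),
  [/\ Lc_spectrum (odd n) c Y chi,
      Lc_eigen (odd n) c (Y i) (chi n./2) P,
      forall x, cball 1 x -> psi x = radial_form (odd n) P (Y i) x,
      forall x, ~ cball 1 x -> psi x = 0
    & rint (cball 1) (fun x => (cl_conj (psi x) * psi x) finset.set0) = 1].

Local Notation CCl := (cliff R[i] m).
Implicit Types g : Rm -> CCl.

Definition cl_complex (a : Cl) : CCl := [ffun A => (a A)%:C%C].

Definition cis (t : R) : R[i] := (cos t +i* sin t)%C.

Definition fourier g (xi : Rm) : CCl :=
  [ffun A => cint setT (fun x => cis (- (2 * pi * dotp x xi)) * g x A)].

Definition Pc (c : R) g x : CCl :=
  [ffun A => cint (cball c)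
    (fun xi => fourier g xi A * cis (2 * pi * dotp xi x))].

Definition Qop g x : CCl := if x \in cball 1 then g x else 0.

End CliffordAnalysis.

(* Main.v *)
(** In the variable t = |x|^2 the eigenvalue equation of L_c on functions
    P(|x|^2) Y or x P(|x|^2) Y is the singular Sturm-Liouville equation
      -4t(1-t)P'' + (4t - 2d(1-t))P' + gam t P = mu P,  gam = 4 pi^2 c^2,
    with d = m + 2k or m + 2k + 2. It has exactly one solution u = sum a_n t^n
    that is smooth at 0 with u(0) = 1, and u is smooth at 1 iff the limit
    W(mu, gam) of n a_n vanishes, in which case u is entire.
    Hence the eigenvalues are the zeros of W(., gam), up to a shift.
    Lagrange's identity turns W(mu2) u1(1) into (mu1 - mu2) times a weighted
    integral of u1 u2, which is positive when both parameters are close to a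
    zero; thus zeros persist, and do not merge, as gam moves. With a lower bound
    on the zeros this makes the N-th zero continuous, by induction on N.
    The unnormalised eigenfunctions therefore converge boundedly when c does,
    and lambda, being (P_c psi)(x) / psi(x) at a point where the limit
    eigenfunction does not vanish, is continuous by dominated convergence. *)

Require Import Defs.
From HB Require Import structures.
From mathcomp Require Import all_boot all_order all_algebra.
From mathcomp Require Import all_classical all_reals all_analysis measurable_realfun.
From mathcomp Require Import complex ring lra.

Set Implicit Arguments.
Unset Strict Implicit.
Unset Printing Implicit Defensive.

Import Order.TTheory GRing.Theory Num.Theory.
Import numFieldNormedType.Exports.

Local Open Scope classical_set_scope.
Local Open Scope ring_scope.

(** * Frobenius coefficients *)

(** The hypotheses speak of each c separately: an enumeration of eigenvalues, and functions
    [psi c i] determined only up to a sign, which may jump with c. The dependence on c therefore has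
    to be recovered from the equation itself, and the arbitrary factor drops out because P_c is
    linear. The obstacle is the endpoint t = 1. Where W does not vanish the solution is
    logarithmically singular there, so solutions with nearby parameters need not be uniformly close
    on [0, 1). Their distance is measured against -log(1 - t) instead; its antiderivative is bounded
    by 1, so the error it causes in Lagrange's identity stays small. W is used only as a locally
    Lipschitz function. The sign of the overlap integral of u1 and u2 does the work that simplicity
    of the zeros, expressed by a derivative in mu, would otherwise do. *)

Section Frobenius.
Variables (R : realType) (d : nat).
Hypothesis d_ge2 : (2 <= d)%N.
Implicit Types (mu gam M eps : R) (j n : nat).

(** The recurrence has three terms, so two consecutive coefficients are carried; the initial 0
    stands for the coefficient of index -1. *)
Fixpoint frob_pair mu gam n : R * R :=
  if n is j.+1 then
    let: (p, q) := frob_pair mu gam j in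
    (q, ((2 * j%:R * (2 * j%:R + d%:R) - mu) * q + gam * p) /
        (2 * j.+1%:R * (2 * j%:R + d%:R)))
  else (0, 1).

(* Coefficients of the solution, analytic at 0 with value 1 there, of
   -4t(1-t)P'' + (4t - 2d(1-t))P' + gam t P = mu P. *)
Definition frob mu gam n : R := (frob_pair mu gam n).2.

(* The solution is, up to a bounded function, -W log(1-t) with W = lim n a_n. *)
Definition nfrob mu gam n : R := n%:R * frob mu gam n.

Definition frobW mu gam : R := limn (nfrob mu gam).

Lemma frob0 mu gam : frob mu gam 0 = 1. Proof. by []. Qed.

Let dR : @GRing.natmul R 1 2 <= d%:R. Proof. by rewrite ler_nat. Qed.

Lemma frob1 mu gam : frob mu gam 1 = - mu / (2 * d%:R).
Proof. by rewrite /frob /= mulr0 mul0r sub0r !mulr1 mulr0 addr0 add0r. Qed.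

Lemma frobSS mu gam j :
  2 * j.+2%:R * (2 * j.+1%:R + d%:R) * frob mu gam j.+2 =
  (2 * j.+1%:R * (2 * j.+1%:R + d%:R) - mu) * frob mu gam j.+1
  + gam * frob mu gam j.
Proof.
rewrite /frob /=; case: (frob_pair mu gam j) => p q /=.
by rewrite mulrC divfK // gt_eqF // !mulr_gt0 ?ltr0n // ltr_wpDr ?ler0n // mulr_gt0 ?ltr0n.
Qed.

Lemma nfrob0 mu gam : nfrob mu gam 0 = 0. Proof. exact: mul0r. Qed.

Lemma nfrob1 mu gam : nfrob mu gam 1 = - mu / (2 * d%:R).
Proof. by rewrite /nfrob mul1r frob1. Qed.

(** The quadratic terms of the recurrence form a first difference of n a_n. What remains is O(a_j /
    j), so once n a_n is bounded its increments are O(1 / j^2) and summable. *)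
Lemma nfrobSS mu gam j :
  nfrob mu gam j.+2 - nfrob mu gam j.+1 =
  (gam * frob mu gam j - mu * frob mu gam j.+1) / (2 * (2 * j.+1%:R + d%:R)).
Proof.
have D : 2 * j.+1%:R + d%:R != 0 :> R.
  by rewrite gt_eqF // ltr_wpDr ?ler0n // mulr_gt0 ?ltr0n.
apply: (mulIf (_ : 2 * (2 * j.+1%:R + d%:R) != 0)).
  by rewrite mulf_neq0 ?pnatr_eq0.
rewrite divfK ?mulf_neq0 ?pnatr_eq0 //.
have := frobSS mu gam j; rewrite /nfrob; nra.
Qed.

Lemma telescope_inv j : ((j.+1)%:R * (j.+2)%:R)^-1 = j.+1%:R^-1 - j.+2%:R^-1 :> R.
Proof. by field; rewrite ?natr1 ?nat1r ?pnatr_eq0 ?andbT. Qed.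

(* The product of the factors 1 + M / (j (j + 1)) is at most exp M. *)
Lemma discrete_gronwall (M K : R) (x : nat -> R) : 0 <= M -> 0 <= K -> x 1%N <= K ->
  (forall j (k : R), K <= k -> (forall i, (i <= j)%N -> x i.+1 <= k) ->
    x j.+2 <= k + M * k / (j.+1%:R * j.+2%:R)) ->
  forall j, x j.+1 <= K * expR M.
Proof.
move=> M0 K0 x1 xS.
have E j : 0 <= M * (1 - j.+1%:R^-1).
  by rewrite mulr_ge0 // subr_ge0 invf_le1 ?ltr0n // ler1n.
have mono i j : (i <= j)%N ->
    K * expR (M * (1 - i.+1%:R^-1)) <= K * expR (M * (1 - j.+1%:R^-1)).
  move=> ij; rewrite ler_wpM2l // ler_expR ler_wpM2l // lerD2l lerN2.
  by rewrite lef_pV2 ?posrE ?ltr0n // ler_nat.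
(* The exponent is the partial sum of M / (l (l + 1)) in telescoped form. *)
have H j : forall i, (i <= j)%N -> x i.+1 <= K * expR (M * (1 - i.+1%:R^-1)).
  elim: j => [|j IH] i; first by rewrite leqn0 => /eqP ->; rewrite invr1 subrr mulr0 expR0 mulr1.
  rewrite leq_eqVlt => /predU1P[->|]; last exact: IH.
  set k := K * expR (M * (1 - j.+1%:R^-1)).
  have Kk : K <= k by rewrite /k ler_peMr // -[leLHS]expR0 ler_expR.
  apply: (le_trans (xS j k Kk _)).
    by move=> l lj; apply: le_trans (IH l lj) (mono _ _ lj).
  have -> : M * (1 - j.+2%:R^-1) =
     M * (1 - j.+1%:R^-1) + M / (j.+1%:R * j.+2%:R) by rewrite telescope_inv; ring.
  rewrite expRD mulrA -/k.
  have := expR_ge1Dx (M / (j.+1%:R * j.+2%:R)).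
  have k0 : 0 <= k by apply: le_trans Kk.
  clearbody k => /(ler_wpM2l k0) h; apply: le_trans (_ : _ <= k * (1 + M / (j.+1%:R * j.+2%:R))) h.
  rewrite (mulrDr k) mulr1 lerD2l.
  by rewrite (_ : M * k / _ = k * (M / (j.+1%:R * j.+2%:R))) // -mulrA mulrCA.
move=> j; apply: le_trans (H j j (leqnn _)) _.
by rewrite ler_wpM2l // ler_expR ler_piMr // gerBl invr_ge0 ler0n.
Qed.

(** [1 + M] dominates both a_0 = 1 and the first term of n a_n; [expR M] is the Gronwall factor. *)
Definition frob_bound M : R := (1 + M) * expR M.

Lemma frob_bound_ge1 M : 0 <= M -> 1 <= frob_bound M.
Proof.
move=> M0; rewrite -[leLHS]mulr1 ler_pM // ?ler01 // ?lerDl //.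
by rewrite -expR0 ler_expR.
Qed.

Section Bounded.
Variables (M mu gam : R).
Hypothesis muM : `|mu| + `|gam| <= M.

Let M0 : 0 <= M. Proof. by apply: le_trans muM; rewrite addr_ge0. Qed.

Lemma frob_of_nfrob j : frob mu gam j.+1 = nfrob mu gam j.+1 / j.+1%:R.
Proof. by rewrite /nfrob mulrC mulKf // pnatr_eq0. Qed.

Lemma frob_le_nfrob j (k : R) : `|nfrob mu gam j.+1| <= k ->
  `|frob mu gam j.+1| <= k / j.+1%:R.
Proof.
move=> H; rewrite frob_of_nfrob normrM normfV normr_nat.
by rewrite ler_wpM2r // invr_ge0 ler0n.
Qed.

(** The factor 2 is the price for writing the bound k / j on a_j with [j.+1], a form that also
    covers j = 0. The assumption 2 <= d bounds the denominator of [nfrobSS] below by 4 (j + 2). *)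
Lemma nfrob_step j (k : R) : `|frob mu gam j| <= 2 * k / j.+1%:R ->
  `|nfrob mu gam j.+1| <= k ->
  `|nfrob mu gam j.+2 - nfrob mu gam j.+1| <= M * k / (j.+1%:R * j.+2%:R).
Proof.
move=> H1 H2; have k0 : 0 <= k by apply: le_trans H2.
rewrite nfrobSS normrM normfV.
have D : 4 * j.+2%:R <= 2 * (2 * j.+1%:R + d%:R) :> R by have := dR; rewrite -[j.+2%:R]natr1; lra.
have j1 : 0 < j.+1%:R :> R by rewrite ltr0n.
have j2 : 0 < j.+2%:R :> R by rewrite ltr0n.
have N : `|gam * frob mu gam j - mu * frob mu gam j.+1| <= 2 * M * k / j.+1%:R.
  apply: (le_trans (ler_normB _ _)); rewrite !normrM.
  have H3 := frob_le_nfrob H2.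
  have : `|gam| * `|frob mu gam j| <= `|gam| * (2 * k / j.+1%:R) by rewrite ler_wpM2l.
  have : `|mu| * `|frob mu gam j.+1| <= `|mu| * (2 * k / j.+1%:R).
    rewrite ler_wpM2l //; apply: le_trans H3 _; rewrite -mulrA ler_peMl ?ler1n //.
    by rewrite divr_ge0 // ler0n.
  move=> h1 h2; apply: le_trans (lerD h2 h1) _; rewrite -mulrDl addrC.
  apply: le_trans (_ : M * (2 * k / j.+1%:R) <= _); last by rewrite !mulrA (mulrC M).
  by rewrite ler_wpM2r // divr_ge0 ?ler0n // mulr_ge0 // ler0n.
rewrite (@ger0_norm _ (2 * _)); last by apply: le_trans D; rewrite mulr_ge0 ?ler0n.
rewrite ler_pdivrMr; last by apply: lt_le_trans D; rewrite mulr_gt0 ?ltr0n.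
apply: le_trans N _.
have -> : 2 * M * k / j.+1%:R = M * k / (j.+1%:R * j.+2%:R) * (2 * j.+2%:R).
  by move: j.+1%:R j.+2%:R j1 j2 => p q p0 q0; field; rewrite !gt_eqF.
rewrite ler_wpM2l //; first by rewrite divr_ge0 ?mulr_ge0 ?ler0n.
by apply: le_trans D; rewrite ler_wpM2r ?ler0n // ler_nat.
Qed.

Lemma frob_prev_le j (k : R) : 1 <= k ->
  (forall i, (i < j)%N -> `|nfrob mu gam i.+1| <= k) ->
  `|frob mu gam j| <= 2 * k / j.+1%:R.
Proof.
case: j => [|j] k1 H; first by rewrite frob0 normr1 divr1; lra.
apply: le_trans (frob_le_nfrob (H j (ltnSn j))) _.
have k0 : 0 <= k by lra.
rewrite mulrC ler_pdivrMl ?ltr0n //.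
have -> : j.+1%:R * (2 * k / j.+2%:R) = k * (2 * j.+1%:R / j.+2%:R) :> R by ring.
rewrite ler_peMr // ler_pdivlMr ?ltr0n // mul1r -natrM ler_nat.
by rewrite mul2n -addnn addSn ltnS addnS ltnS leq_addl.
Qed.

Lemma nfrob_le j : `|nfrob mu gam j| <= frob_bound M.
Proof.
case: j => [|j].
  by rewrite nfrob0 normr0 (le_trans _ (frob_bound_ge1 M0)).
apply: (@discrete_gronwall M (1 + M) (fun i => `|nfrob mu gam i|)) => //.
- by rewrite addr_ge0.
- rewrite nfrob1 mulNr normrN normrM normfV.
  rewrite ler_pdivrMr ?normr_gt0 ?mulf_neq0 ?pnatr_eq0 //; last by case: (d) d_ge2.
  rewrite normrM !normr_nat.
  have := normr_ge0 gam; have := dR.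
  have : (1 + M) * 4 <= (1 + M) * (2 * d%:R) by rewrite ler_wpM2l ?addr_ge0 //; have := dR; lra.
  by move: muM M0; lra.
- move=> {}j k Kk H.
  have k1 : 1 <= k by apply: le_trans Kk; rewrite lerDl.
  have := nfrob_step (frob_prev_le k1 (fun i ij => H i (ltnW ij))) (H j (leqnn _)).
  have := ler_normD (nfrob mu gam j.+2 - nfrob mu gam j.+1) (nfrob mu gam j.+1).
  rewrite subrK => h1 h2; apply: le_trans h1 _.
  by rewrite addrC lerD // H.
Qed.

Lemma frob_le j : `|frob mu gam j| <= frob_bound M.
Proof.
have B1 := frob_bound_ge1 M0.
case: j => [|j]; first by rewrite frob0 normr1.
apply: le_trans (frob_le_nfrob (nfrob_le _)) _.
by rewrite ler_pdivrMr ?ltr0n // ler_peMr ?ler1n //; lra.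
Qed.

(** Bounds are assumed from rank j on only: this serves the Cauchy property with a global k, and
    again the factorial decay, where k shrinks with the rank. *)
Lemma nfrob_tail j (k : R) n : 0 <= k ->
  (forall i, (j <= i)%N -> `|frob mu gam i| <= 2 * k / i.+1%:R) ->
  (forall i, (j <= i)%N -> `|nfrob mu gam i.+1| <= k) ->
  `|nfrob mu gam (j + n).+1 - nfrob mu gam j.+1|
     <= M * k * (j.+1%:R^-1 - (j + n).+1%:R^-1).
Proof.
move=> k0 H1 H2; elim: n => [|n IH]; first by rewrite addn0 !subrr normr0 mulr0.
have := nfrob_step (H1 (j + n)%N (leq_addr _ _)) (H2 _ (leq_addr _ _)).
rewrite telescope_inv addnS => H.
have -> : nfrob mu gam (j + n).+2 - nfrob mu gam j.+1 =
  nfrob mu gam (j + n).+2 - nfrob mu gam (j + n).+1 +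
  (nfrob mu gam (j + n).+1 - nfrob mu gam j.+1) by ring.
apply: le_trans (ler_normD _ _) _.
apply: le_trans (lerD H IH) _; rewrite -mulrDr.
by rewrite le_eqVlt; apply/orP; left; apply/eqP; congr (_ * _); ring.
Qed.

Lemma nfrob_cauchy j n :
  `|nfrob mu gam (j + n).+1 - nfrob mu gam j.+1| <= M * frob_bound M / j.+1%:R.
Proof.
have B1 := frob_bound_ge1 M0.
apply: le_trans (_ : M * frob_bound M * (j.+1%:R^-1 - (j + n).+1%:R^-1) <= _).
  apply: nfrob_tail; first by apply: le_trans B1.
    by move=> i _; apply: frob_prev_le B1 (fun _ _ => nfrob_le _).
  by move=> i _; exact: nfrob_le.
have B0 : 0 <= frob_bound M by apply: le_trans B1.
by rewrite (ler_wpM2l (mulr_ge0 M0 B0)) // gerBl invr_ge0 ler0n.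
Qed.

Lemma cvg_nfrob : nfrob mu gam @ \oo --> frobW mu gam.
Proof.
apply/cauchy_cvgP/cauchy_exP => e e0.
have [j jP] : exists j, M * frob_bound M / j.+1%:R < e.
  have B0 : 0 <= M * frob_bound M by rewrite mulr_ge0 // (le_trans _ (frob_bound_ge1 M0)).
  exists (Num.truncn (M * frob_bound M / e)).
  rewrite ltr_pdivrMr ?ltr0n // [ltRHS]mulrC -ltr_pdivrMr //.
  exact: truncnS_gt.
exists (nfrob mu gam j.+1); exists j.+1 => // n /= jn.
rewrite -(subnKC jn) addSn /ball /= distrC.
exact: le_lt_trans (nfrob_cauchy _ _) jP.
Qed.

(* W = 0 lets one sum the increments from infinity, gaining a factor M / j at
   each rank. *)
Lemma nfrob_fact_le j : frobW mu gam = 0 -> 1 <= M ->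
  `|nfrob mu gam j| <= frob_bound M * M ^+ j / j`!%:R.
Proof.
move=> W0 M1; have B1 := frob_bound_ge1 M0.
have B0 : 0 <= frob_bound M by apply: le_trans B1.
case: j => [|j].
  by rewrite nfrob0 normr0 mulr1 divr1 (le_trans _ B1).
(* The bound of stage j must hold at all later ranks, because the next stage sums the increments out
   to infinity. *)
suff H : forall i, (j <= i)%N ->
    `|nfrob mu gam i.+1| <= frob_bound M * M ^+ j / j.+1`!%:R.
  apply: le_trans (H j (leqnn _)) _.
  rewrite ler_wpM2r ?invr_ge0 ?ler0n // ler_wpM2l ?(le_trans _ B1) //.
  by rewrite exprS ler_peMl // exprn_ge0.
elim: j => [|j IH] i ji; first by rewrite mulr1 divr1; exact: nfrob_le.
set k := frob_bound M * M ^+ j / j.+1`!%:R in IH.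
have k0 : 0 <= k by rewrite /k divr_ge0 ?ler0n // mulr_ge0 ?exprn_ge0.
have -> : frob_bound M * M ^+ j.+1 / j.+2`!%:R = M * k / j.+2%:R.
  by rewrite /k exprS (factS j.+1) natrM invfM; ring.
apply: le_trans (_ : M * k / i.+1%:R <= _); last first.
  by rewrite (ler_wpM2l (mulr_ge0 M0 k0)) // lef_pV2 ?posrE ?ltr0n // ler_nat.
have prev i' : (j.+1 <= i')%N -> `|frob mu gam i'| <= 2 * k / i'.+1%:R.
  case: i' => // i' ii.
  apply: le_trans (frob_le_nfrob (IH _ ii)) _.
  rewrite ler_pdivrMr ?ltr0n // mulrAC ler_pdivlMr ?ltr0n //.
  by rewrite (mulrC 2) -(mulrA k 2) (ler_wpM2l k0) // -natrM ler_nat mul2n -addnn addSn ltnS addnS ltnS leq_addl.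
have H n : `|nfrob mu gam (i + n).+1 - nfrob mu gam i.+1| <= M * k / i.+1%:R.
  apply: le_trans (_ : M * k * (i.+1%:R^-1 - (i + n).+1%:R^-1) <= _).
    apply: nfrob_tail => // l il; first by apply: prev; apply: leq_trans il.
    by apply: IH; apply: leq_trans il; exact: ltnW.
  by rewrite (ler_wpM2l (mulr_ge0 M0 k0)) // gerBl invr_ge0 ler0n.
have C : `|nfrob mu gam n - nfrob mu gam i.+1| @[n --> \oo]
   --> `|frobW mu gam - nfrob mu gam i.+1|.
  by apply: cvg_norm; apply: cvgB cvg_nfrob _; exact: cvg_cst.
have : `|frobW mu gam - nfrob mu gam i.+1| <= M * k / i.+1%:R.
  rewrite -(cvg_lim _ C) //; apply: limr_le; first by apply: cvgP C.
  by exists i.+1 => // n /= jn; rewrite -(subnKC jn) addSn.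
by rewrite W0 sub0r normrN.
Qed.

Lemma frob_fact_le j : frobW mu gam = 0 -> 1 <= M ->
  `|frob mu gam j| <= frob_bound M * M ^+ j / j`!%:R.
Proof.
move=> W0 M1; have B1 := frob_bound_ge1 M0.
have B0 : 0 <= frob_bound M by apply: le_trans B1.
case: j => [|j]; first by rewrite frob0 normr1 mulr1 divr1.
apply: le_trans (frob_le_nfrob (nfrob_fact_le _ W0 M1)) _.
rewrite ler_pdivrMr ?ltr0n // ler_peMr ?ler1n //.
by rewrite divr_ge0 ?ler0n // mulr_ge0 ?exprn_ge0.
Qed.

End Bounded.

(** With these signs every increment of n a_n is nonnegative, and the term gam a_0 makes 2 a_2
    positive. Hence all zeros of W are positive, the lower bound on which the compactness argument
    for the zeros rests. *)
Lemma frobW_gt0 mu gam : mu <= 0 -> 0 < gam -> 0 < frobW mu gam.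
Proof.
move=> mu0 gam0.
have muM : `|mu| + `|gam| <= `|mu| + `|gam| by [].
have D j : 0 < 2 * (2 * j.+1%:R + d%:R) :> R.
  by rewrite mulr_gt0 // ltr_wpDr ?ler0n // mulr_gt0 ?ltr0n.
have b1 : 0 <= nfrob mu gam 1.
  by rewrite nfrob1 divr_ge0 ?oppr_ge0 // mulr_ge0 ?ler0n.
have pos j : 0 <= nfrob mu gam j /\ 0 <= nfrob mu gam j.+1 <= nfrob mu gam j.+2.
  elim: j => [|j [IH0 /andP[IH1 IH2]]].
    rewrite nfrob0 b1 -(subr_ge0 (nfrob _ _ 1)) nfrobSS; split => //=.
    rewrite divr_ge0 ?(ltW (D _)) // frob0 mulr1 frob_of_nfrob // divr1.
    by rewrite addr_ge0 ?(ltW gam0) // -mulNr mulr_ge0 // oppr_ge0.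
  have IH3 := le_trans IH1 IH2; split=> //; rewrite IH3 /=.
  rewrite -(subr_ge0 (nfrob _ _ j.+2)) nfrobSS divr_ge0 ?(ltW (D _)) //.
  rewrite addr_ge0 ?mulr_ge0 ?(ltW gam0) //.
    by rewrite frob_of_nfrob divr_ge0.
  by rewrite -mulNr mulr_ge0 ?oppr_ge0 // frob_of_nfrob divr_ge0.
have b2 : 0 < nfrob mu gam 2.
  rewrite -(subrK (nfrob mu gam 1) (nfrob mu gam 2)) ltr_wpDr //.
  rewrite nfrobSS divr_gt0 // frob0 mulr1 ltr_wpDr // -mulNr mulr_ge0 ?oppr_ge0 //.
  by rewrite frob_of_nfrob divr_ge0.
apply: lt_le_trans b2 _.
have H := cvg_nfrob muM.
rewrite -(cvg_lim _ H) //; apply: limr_ge; first by apply: cvgP H.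
exists 2%N => // n /= n2; rewrite -(subnKC n2) addnC addn2.
elim: (n - 2)%N => // j; have [_ /andP[_]] := pos j.+1.
by move=> h1 h2; apply: le_trans h2 h1.
Qed.

Section Lipschitz.
Variables (M mu gam mu' gam' : R).
Hypotheses (muM : `|mu| + `|gam| <= M) (muM' : `|mu'| + `|gam'| <= M).

Let eps : R := `|mu - mu'| + `|gam - gam'|.
Let M0 : 0 <= M. Proof. by apply: le_trans muM; rewrite addr_ge0. Qed.

Definition frob_lip : R := frob_bound M * expR (M + 1).

(** The difference of two solutions satisfies the same recurrence with a source of size
    [eps * frob_bound M / j]. Gronwall applies with rate M + 1: M for the homogeneous part, and 1
    for the source, which the running bound k >= [frob_bound M * eps] absorbs. *)
Lemma nfrob_lip j : `|nfrob mu gam j - nfrob mu' gam' j| <= frob_lip * eps.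
Proof.
have B1 := frob_bound_ge1 M0.
have B0 : 0 <= frob_bound M by apply: le_trans B1.
have e0 : 0 <= eps by rewrite addr_ge0.
rewrite /frob_lip mulrAC.
case: j => [|j].
  by rewrite !nfrob0 subrr normr0 !mulr_ge0 ?expR_ge0 ?addr_ge0.
apply: (@discrete_gronwall (M + 1) (frob_bound M * eps)
  (fun i => `|nfrob mu gam i - nfrob mu' gam' i|)) => //.
- by rewrite addr_ge0.
- by rewrite mulr_ge0.
- rewrite !nfrob1 -mulrBl normrM opprK normfV normrM !normr_nat.
  rewrite ler_pdivrMr; last by rewrite mulr_gt0 ?ltr0n //; case: (d) d_ge2.
  have h1 : eps * 1 <= eps * frob_bound M by rewrite ler_wpM2l.
  have h2 : eps * frob_bound M * 1 <= eps * frob_bound M * (2 * d%:R).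
    have d1 : 1 <= 2 * d%:R :> R by have := dR; lra.
    by rewrite ler_wpM2l // mulr_ge0.
  rewrite (mulrC _ eps); apply: le_trans h2; rewrite mulr1; apply: le_trans h1.
  by rewrite mulr1 /eps addrC distrC lerDl.
move=> {}j k Kk H.
have k0 : 0 <= k by apply: le_trans Kk; rewrite mulr_ge0.
have j1 : 0 < j.+1%:R :> R by rewrite ltr0n.
have j2 : 0 < j.+2%:R :> R by rewrite ltr0n.
pose del i := frob mu gam i - frob mu' gam' i.
have dnow : `|del j.+1| <= k / j.+1%:R.
  rewrite /del !frob_of_nfrob -mulrBl normrM normfV normr_nat.
  by rewrite ler_wpM2r ?invr_ge0 ?ler0n // H.
have dprev : `|del j| <= 2 * k / j.+1%:R.
  case: j H j1 {j2 dnow} => [|j] H j1.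
    by rewrite /del !frob0 subrr normr0 divr1 mulr_ge0.
  rewrite /del !frob_of_nfrob -mulrBl normrM normfV normr_nat.
  apply: le_trans (_ : k / j.+1%:R <= _).
    by rewrite ler_wpM2r ?invr_ge0 ?ler0n // H.
  rewrite ler_pdivrMr ?ltr0n // mulrAC ler_pdivlMr ?ltr0n //.
  by rewrite (mulrC 2) -(mulrA k 2) (ler_wpM2l k0) // -natrM ler_nat mul2n -addnn addSn ltnS addnS ltnS leq_addl.
have anow : `|frob mu' gam' j.+1| <= frob_bound M / j.+1%:R.
  exact: frob_le_nfrob (nfrob_le muM' _).
have aprev : `|frob mu' gam' j| <= 2 * frob_bound M / j.+1%:R.
  exact: frob_prev_le B1 (fun _ _ => nfrob_le muM' _).
have -> : nfrob mu gam j.+2 - nfrob mu' gam' j.+2 =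
   (nfrob mu gam j.+1 - nfrob mu' gam' j.+1) +
   (gam * del j - mu * del j.+1 + (gam - gam') * frob mu' gam' j -
    (mu - mu') * frob mu' gam' j.+1) / (2 * (2 * j.+1%:R + d%:R)).
  have := nfrobSS mu gam j; have := nfrobSS mu' gam' j.
  move: (nfrob mu gam j.+2) (nfrob mu' gam' j.+2) => x x' E' E.
  have -> : x = nfrob mu gam j.+1 + (x - nfrob mu gam j.+1) by ring.
  have -> : x' = nfrob mu' gam' j.+1 + (x' - nfrob mu' gam' j.+1) by ring.
  by rewrite E E' /del; ring.
apply: le_trans (ler_normD _ _) _; apply: lerD; first exact: H.
rewrite normrM normfV.
have D : 4 * j.+2%:R <= 2 * (2 * j.+1%:R + d%:R) :> R by have := dR; rewrite -[j.+2%:R]natr1; lra.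
rewrite (ger0_norm (_ : 0 <= 2 * (2 * j.+1%:R + d%:R))); last first.
  by apply: le_trans D; rewrite mulr_ge0 ?ler0n.
rewrite ler_pdivrMr; last by apply: lt_le_trans D; rewrite mulr_gt0 ?ltr0n.
apply: le_trans (_ : (M + 1) * k / (j.+1%:R * j.+2%:R) * (4 * j.+2%:R) <= _); last first.
  by rewrite ler_wpM2l // divr_ge0 ?mulr_ge0 ?ler0n ?addr_ge0.
have -> : (M + 1) * k / (j.+1%:R * j.+2%:R) * (4 * j.+2%:R) = 4 * (M + 1) * k / j.+1%:R.
  by move: j.+1%:R j.+2%:R j1 j2 => p q p0 q0; field; rewrite !gt_eqF.
apply: le_trans (ler_normB _ _) _.
apply: le_trans (lerD (le_trans (ler_normD _ _) (lerD (ler_normB _ _) (lexx _))) (lexx _)) _.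
rewrite !normrM.
have h1 : `|gam| * `|del j| + `|mu| * `|del j.+1| <= M * (2 * k / j.+1%:R).
  apply: le_trans (_ : (`|mu| + `|gam|) * (2 * k / j.+1%:R) <= _).
    rewrite mulrDl addrC lerD ?ler_wpM2l //; apply: le_trans dnow _.
    by rewrite -mulrA ler_peMl ?ler1n // divr_ge0 ?ler0n.
  by rewrite ler_wpM2r // divr_ge0 ?mulr_ge0 ?ler0n.
have h2 : `|gam - gam'| * `|frob mu' gam' j| + `|mu - mu'| * `|frob mu' gam' j.+1|
   <= 2 * k / j.+1%:R.
  apply: le_trans (_ : eps * (2 * frob_bound M / j.+1%:R) <= _).
    rewrite mulrDl addrC lerD ?ler_wpM2l //; apply: le_trans anow _.
    by rewrite -mulrA ler_peMl ?ler1n // divr_ge0 ?ler0n.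
  have -> : eps * (2 * frob_bound M / j.+1%:R) = 2 * (frob_bound M * eps) / j.+1%:R by ring.
  by rewrite ler_wpM2r ?invr_ge0 ?ler0n // ler_wpM2l.
have h3 : 2 * (M + 1) * k / j.+1%:R <= 4 * (M + 1) * k / j.+1%:R.
  by rewrite ler_wpM2r ?invr_ge0 ?ler0n // ler_wpM2r // ler_wpM2r ?addr_ge0 // ler_nat.
have h4 : 2 * (M + 1) * k / j.+1%:R = M * (2 * k / j.+1%:R) + 2 * k / j.+1%:R by ring.
by rewrite -addrA; apply: le_trans (lerD h1 h2) _; rewrite -h4.
Qed.

Lemma frobW_lip : `|frobW mu gam - frobW mu' gam'| <= frob_lip * eps.
Proof.
have C : `|nfrob mu gam n - nfrob mu' gam' n| @[n --> \oo]
   --> `|frobW mu gam - frobW mu' gam'|.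
  by apply: cvg_norm; apply: cvgB (cvg_nfrob muM) (cvg_nfrob muM').
rewrite -(cvg_lim _ C) //; apply: limr_le; first by apply: cvgP C.
by exists 0%N => // n _; exact: nfrob_lip.
Qed.

Lemma frob_lip_ge0 : 0 <= frob_lip.
Proof. by rewrite mulr_ge0 ?expR_ge0 // (le_trans _ (frob_bound_ge1 M0)). Qed.

End Lipschitz.

End Frobenius.

(** * Power series *)

Section PowerSeries.
Variable R : realType.
Implicit Types (f g : nat -> R) (r t x K : R).

Definition psum f t : R := limn (pseries f t).

(** Radius of convergence at least [r], in a form that passes easily to derivatives, shifts and
    linear combinations. *)
Definition pbounded r f :=
  forall x, 0 <= x -> x < r -> exists B, forall n, `|f n| * x ^+ n <= B.

Lemma pbounded_cvg_norm r f t : pbounded r f -> `|t| < r ->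
  cvgn (pseries (fun n => `|f n|) `|t|).
Proof.
move=> fr tr.
have x0 : 0 <= (`|t| + r) / 2 by have := normr_ge0 t; lra.
have tx : `|t| < (`|t| + r) / 2 by lra.
have {}HB : exists B, forall n, `|f n| * ((`|t| + r) / 2) ^+ n <= B.
  by apply: fr => //; lra.
case: HB => B HB.
have xp : 0 < (`|t| + r) / 2 by apply: le_lt_trans tx.
set x := (`|t| + r) / 2 in x0 tx HB xp *.
have B0 : 0 <= B by apply: le_trans (HB 0%N); rewrite mulr_ge0.
apply: (@series_le_cvg _ _ (geometric B (`|t| / x))) => [n|n|n|].
- by rewrite mulr_ge0 ?exprn_ge0.
- by rewrite /geometric mulr_ge0 // exprn_ge0 // divr_ge0.
- have -> : geometric B (`|t| / x) n = B * `|t| ^+ n / x ^+ n.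
    by rewrite /geometric /= expr_div_n mulrA.
  by rewrite ler_pdivlMr ?exprn_gt0 // mulrAC ler_wpM2r ?exprn_ge0.
- apply: is_cvg_geometric_series.
  by rewrite normrM normr_id normfV (gtr0_norm xp) ltr_pdivrMr ?mul1r.
Qed.

Lemma pbounded_cvg r f t : pbounded r f -> `|t| < r -> cvgn (pseries f t).
Proof.
move=> fr tr; apply: normed_cvg.
rewrite (_ : [normed _] = pseries (fun n => `|f n|) `|t|).
  exact: pbounded_cvg_norm fr tr.
by apply/funext => n /=; apply: eq_bigr => i _; rewrite normrM normrX.
Qed.

Lemma psum_cvg r f t : pbounded r f -> `|t| < r ->
  pseries f t @ \oo --> psum f t.
Proof. exact: pbounded_cvg. Qed.

(** The factor n + 1 is absorbed by a midpoint y between x and r: with q = x / y, (n + 1) q^n <= 1 +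
    q + ... + q^n <= 1 / (1 - q). *)
Lemma pbounded_diffs r f : pbounded r f -> pbounded r (pseries_diffs f).
Proof.
move=> fr x x0 xr.
have [B HB] : exists B, forall n, `|f n| * ((x + r) / 2) ^+ n <= B by apply: fr; lra.
have y0 : 0 < (x + r) / 2 by lra.
have xy : x < (x + r) / 2 by lra.
set y := (x + r) / 2 in HB y0 xy; clearbody y.
have B0 : 0 <= B by apply: le_trans (HB 0%N); rewrite mulr_ge0.
pose q := x / y.
have q0 : 0 <= q by rewrite divr_ge0 // ltW.
have q1 : q < 1 by rewrite /q ltr_pdivrMr ?mul1r.
have q1' : 0 < 1 - q by rewrite subr_gt0.
have nq n : n.+1%:R * q ^+ n <= (1 - q)^-1.
  apply: le_trans (_ : \sum_(i < n.+1) q ^+ i <= _).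
    rewrite mulr_natl -[X in _ *+ X]card_ord -sumr_const; apply: ler_sum => i _.
    by rewrite ler_wiXn2l // ?(ltW q1) // -ltnS.
  rewrite -[leRHS]mulr1 ler_pdivlMl //.
  have -> : (1 - q) * \sum_(i < n.+1) q ^+ i = 1 - q ^+ n.+1.
    by rewrite -opprB mulNr -subrX1 opprB.
  by rewrite gerBl exprn_ge0.
exists (B / y * (1 - q)^-1) => n; rewrite /pseries_diffs normrM normr_nat.
have -> : n.+1%:R * `|f n.+1| * x ^+ n =
   (`|f n.+1| * y ^+ n.+1) / y * (n.+1%:R * q ^+ n).
  rewrite /q expr_div_n exprS.
  have := exprn_gt0 n y0; move: (y ^+ n) (x ^+ n) => Y X Y0.
  by field; rewrite !gt_eqF.
rewrite ler_pM ?mulr_ge0 ?invr_ge0 ?exprn_ge0 ?ler0n ?(ltW y0) //.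
by rewrite ler_wpM2r // invr_ge0 ltW.
Qed.

Lemma psum_is_derive r f t : pbounded r f -> `|t| < r ->
  is_derive t 1 (psum f) (psum (pseries_diffs f) t).
Proof.
move=> fr tr.
have K0 : 0 <= (`|t| + r) / 2 by have := normr_ge0 t; lra.
have Kr : `|(`|t| + r) / 2| < r by rewrite ger0_norm; lra.
apply: (@pseries_snd_diffs _ f ((`|t| + r) / 2)).
- exact: pbounded_cvg fr Kr.
- exact: pbounded_cvg (pbounded_diffs fr) Kr.
- exact: pbounded_cvg (pbounded_diffs (pbounded_diffs fr)) Kr.
- by rewrite [ltRHS]ger0_norm //; lra.
Qed.

Lemma psum0 f : psum f 0 = f 0%N.
Proof.
apply: cvg_lim => //; rewrite -(cvg_shiftn 1) /=.
rewrite (_ : (fun _ => _) = cst (f 0%N)); first exact: cvg_cst.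
apply/funext => n; rewrite /pseries /series /= addn1 big_nat_recl //= expr0 mulr1.
by rewrite big1 ?addr0 // => i _; rewrite expr0n mulr0.
Qed.

Lemma pboundedD r f g : pbounded r f -> pbounded r g ->
  pbounded r (fun n => f n + g n).
Proof.
move=> fr gr x x0 xr; have [B HB] := fr x x0 xr; have [C HC] := gr x x0 xr.
exists (B + C) => n; apply: le_trans (lerD (HB n) (HC n)).
by rewrite -mulrDl ler_wpM2r ?exprn_ge0 // ler_normD.
Qed.

Lemma pboundedZ r f K : pbounded r f -> pbounded r (fun n => K * f n).
Proof.
move=> fr x x0 xr; have [B HB] := fr x x0 xr.
by exists (`|K| * B) => n; rewrite normrM -mulrA ler_wpM2l.
Qed.

Definition pshift f n : R := if n is j.+1 then f j else 0.

Lemma pbounded_shift r f : pbounded r f -> pbounded r (pshift f).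
Proof.
move=> fr x x0 xr; have [B HB] := fr x x0 xr.
have B0 : 0 <= B by apply: le_trans (HB 0%N); rewrite mulr_ge0.
exists (x * B) => -[|n] /=; first by rewrite normr0 mul0r mulr_ge0.
by rewrite exprS mulrCA ler_wpM2l.
Qed.

Lemma psumD r f g t : pbounded r f -> pbounded r g -> `|t| < r ->
  psum (fun n => f n + g n) t = psum f t + psum g t.
Proof.
move=> fr gr tr; apply: cvg_lim => //.
rewrite (_ : pseries _ _ = pseries f t \+ pseries g t).
  by apply: cvgD; [apply: psum_cvg fr tr | apply: psum_cvg gr tr].
apply/funext => n; rewrite /pseries /series /= -big_split /=.
by apply: eq_bigr => i _; rewrite mulrDl.
Qed.

Lemma psumZ r f K t : pbounded r f -> `|t| < r ->
  psum (fun n => K * f n) t = K * psum f t.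
Proof.
move=> fr tr; apply: cvg_lim => //.
rewrite (_ : pseries _ _ = (fun n => K * pseries f t n)).
  by apply: cvgZr; apply: psum_cvg fr tr.
apply/funext => n; rewrite /pseries /series /= mulr_sumr.
by apply: eq_bigr => i _; rewrite mulrA.
Qed.

Lemma psum_shift r f t : pbounded r f -> `|t| < r ->
  psum (pshift f) t = t * psum f t.
Proof.
move=> fr tr; apply: cvg_lim => //; rewrite -(cvg_shiftn 1) /=.
rewrite (_ : (fun _ => _) = (fun n => t * pseries f t n)).
  by apply: cvgZr; apply: psum_cvg fr tr.
apply/funext => n; rewrite /pseries /series /= addn1 big_nat_recl //= mul0r add0r.
by rewrite mulr_sumr; apply: eq_bigr => i _; rewrite exprS mulrCA.
Qed.

Lemma psum_norm_le r f t K : pbounded r f -> `|t| < r ->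
  (forall n, \sum_(0 <= i < n) `|f i| * `|t| ^+ i <= K) -> `|psum f t| <= K.
Proof.
move=> fr tr H; have C : `|pseries f t n| @[n --> \oo] --> `|psum f t|.
  exact: cvg_norm (psum_cvg fr tr).
rewrite -(cvg_lim _ C) //; apply: limr_le; first by apply: cvgP C.
exists 0%N => // n _ /=; apply: le_trans (H n); rewrite /pseries /series /=.
apply: le_trans (ler_norm_sum _ _ _) _.
by apply: ler_sum => i _; rewrite normrM normrX.
Qed.

Lemma psum_partial_le r f t n : pbounded r f -> `|t| < r -> 0 <= t ->
  (forall i, 0 <= f i) -> \sum_(0 <= i < n) f i * t ^+ i <= psum f t.
Proof.
move=> fr tr t0 f0; apply: limr_ge; first exact: pbounded_cvg fr tr.
exists n => // m /= nm; rewrite /pseries /series /= (@big_cat_nat _ _ _ n 0 m) //=.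
by rewrite lerDl sumr_ge0 // => i _; rewrite mulr_ge0 ?exprn_ge0.
Qed.

Lemma psum_le_psum r f g t K : pbounded r f -> pbounded r g -> `|t| < r ->
  0 <= K -> (forall n, `|f n| <= K * g n) -> (forall n, 0 <= g n) ->
  `|psum f t| <= K * psum g `|t|.
Proof.
move=> fr gr tr K0 fg g0; apply: (psum_norm_le fr tr) => n.
have := psum_partial_le n gr (_ : `|(`|t|)| < r) (normr_ge0 t) g0.
rewrite normr_id => /(_ tr) /(ler_wpM2l K0); apply: le_trans.
rewrite mulr_sumr; apply: ler_sum => i _.
by rewrite mulrA ler_wpM2r ?exprn_ge0.
Qed.

Lemma pbounded1_bounded f B : (forall n, `|f n| <= B) -> pbounded 1 f.
Proof.
move=> H x x0 x1; exists B => n; apply: le_trans (H n).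
by rewrite ler_piMr // exprn_ile1 // ltW.
Qed.

Lemma psum_cst K t : `|t| < 1 -> (1 - t) * psum (fun=> K) t = K.
Proof.
move=> t1; have t1' : 1 - t != 0.
  by rewrite subr_eq0 eq_sym lt_eqF // (le_lt_trans (ler_norm _) t1).
rewrite (_ : psum _ t = K * (1 - t)^-1); last first.
  by apply: cvg_lim => //; exact: cvg_geometric_series.
by rewrite mulrCA divff // mulr1.
Qed.

(** (1 - t) sum f_n t^n is the mean of the f_n with weights (1 - t) t^n of total mass 1, and any
    finite set of indices loses its mass as t tends to 1. *)
Lemma abel_limit f (l : R) : f @ \oo --> l ->
  (fun t : R => (1 - t) * psum f t) @ 1^'- --> l.
Proof.
move=> fl.
have fl0 : (fun n => f n + - l) @ \oo --> 0.
  by rewrite -(subrr l); apply: cvgB fl _; exact: cvg_cst.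
have [B HB] : exists B : R, forall n, `|f n + - l| <= B.
  have := cvg_seq_bounded (cvgP _ fl0); rewrite /bounded_fun => -[B [_ HB]].
  by exists (B + 1) => n; apply: (HB (B + 1)) => //; rewrite ltrDl.
have g1 : pbounded 1 (fun n => f n + - l) := pbounded1_bounded HB.
have l1 : pbounded 1 (fun=> - l) by apply: (@pbounded1_bounded _ `|- l|).
have f1 : pbounded 1 f.
  apply: (@pbounded1_bounded _ (B + `|l|)) => n.
  rewrite -(subrK l (f n)); apply: le_trans (ler_normD _ _) _.
  by rewrite lerD2r.
have E t : `|t| < 1 -> l - (1 - t) * psum f t = - ((1 - t) * psum (fun n => f n + - l) t).
  by move=> t1; rewrite (psumD f1 l1 t1) mulrDr (psum_cst (- l) t1); ring.
apply/cvgrPdist_le => e e0.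
have [N _ HN] : \forall n \near \oo, `|0 - (f n + - l)| <= e / 2.
  by move/cvgrPdist_le: fl0; apply; rewrite divr_gt0.
pose A := \sum_(0 <= i < N) `|f i + - l|.
have A0 : 0 <= A by rewrite sumr_ge0.
have P t : 0 <= t -> t < 1 -> `|(1 - t) * psum (fun n => f n + - l) t| <= (1 - t) * A + e / 2.
  move=> t0 t1; have t1' : 0 < 1 - t by rewrite subr_gt0.
  have nt : `|t| < 1 by rewrite ger0_norm.
  rewrite normrM (gtr0_norm t1') -[e / 2](psum_cst _ nt) -mulrDr ler_pM2l //.
  apply: (psum_norm_le g1 nt) => n; rewrite ger0_norm //.
  have C1 : pbounded 1 (fun=> e / 2) by apply: (@pbounded1_bounded _ (e / 2)) => _; rewrite ger0_norm // ltW ?divr_gt0.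
  apply: le_trans (_ : \sum_(0 <= i < n) ((if (i < N)%N then `|f i + - l| else 0) + e / 2 * t ^+ i) <= _).
    apply: ler_sum => i _; case: ltnP => iN.
      rewrite ler_wpDr ?mulr_ge0 ?exprn_ge0 // ?divr_ge0 ?(ltW e0) //.
      by rewrite ler_piMr // exprn_ile1 // ltW.
    rewrite add0r ler_wpM2r ?exprn_ge0 //.
    by have := HN i iN; rewrite /= sub0r normrN.
  rewrite big_split /= lerD //; last first.
    by apply: (psum_partial_le n C1 nt t0) => _; rewrite divr_ge0 // ltW.
  rewrite -big_mkcond /= /A; case: (leqP n N) => nN.
    rewrite (@big_cat_nat _ _ _ n 0 N) //= big_mkcond.
    apply: le_trans (_ : \sum_(0 <= i < n) `|f i + - l| <= _).
      by apply: ler_sum => i _; case: ifP.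
    by rewrite lerDl sumr_ge0.
  rewrite (@big_cat_nat _ _ _ N 0 n) ?(ltnW nN) //= [X in _ + X]big1_seq ?addr0.
    by rewrite big_mkcond; apply: ler_sum => i _; case: ifP.
  by move=> i /andP[iN]; rewrite mem_index_iota => /andP[]; rewrite leqNgt iN.
near=> t.
have t0 : 0 <= t by near: t; exact: nbhs_left_ge.
have t1 : t < 1 by near: t; exact: nbhs_left_lt.
rewrite E ?(ger0_norm t0) // normrN; apply: le_trans (P t t0 t1) _.
suff : (1 - t) * (A + 1) <= e / 2.
  by rewrite mulrDr mulr1 => h; move: (1 - t) (subr_gt0 t 1) h => w; rewrite t1 => w0; lra.
rewrite -ler_pdivlMr ?ltr_wpDl // lerBlDr -lerBlDl.
near: t; apply: nbhs_left_ge; rewrite gtrBl divr_gt0 ?ltr_wpDl //.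
by rewrite divr_gt0.
Unshelve. all: by end_near. Qed.

(* The coefficients of - log (1 - t) and of its antiderivative. *)
Definition ell_coef n : R := n%:R^-1.
Definition Ell_coef n : R := (n%:R * n.-1%:R)^-1.
Definition ell := psum ell_coef.
Definition Ell := psum Ell_coef.

Lemma ell_coef_ge0 n : 0 <= ell_coef n. Proof. by rewrite invr_ge0 ler0n. Qed.

Lemma pbounded_ell : pbounded 1 ell_coef.
Proof.
apply: (@pbounded1_bounded _ 1) => -[|n]; rewrite ger0_norm ?ell_coef_ge0 //.
  by rewrite /ell_coef invr0.
by rewrite /ell_coef invf_le1 ?ltr0n // ler1n.
Qed.

Lemma Ell_coef_ge0 n : 0 <= Ell_coef n.
Proof. by rewrite /Ell_coef -natrM invr_ge0 ler0n. Qed.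

Lemma pbounded_Ell : pbounded 1 Ell_coef.
Proof.
apply: (@pbounded1_bounded _ 1) => n; rewrite ger0_norm ?Ell_coef_ge0 //.
rewrite /Ell_coef -natrM; case: (n * n.-1)%N => [|k]; first by rewrite invr0.
by rewrite invf_le1 ?ltr0n // ler1n.
Qed.

Lemma ell_ge0 t : 0 <= t < 1 -> 0 <= ell t.
Proof.
move=> /andP[t0 t1].
have nt : `|t| < 1 by rewrite ger0_norm.
by have := psum_partial_le 0 pbounded_ell nt t0 ell_coef_ge0; rewrite big_nil.
Qed.

(** The coefficients 1 / (n (n - 1)) sum to 1. Thus an error proportional to -log(1 - t) has a
    bounded integral up to the singular endpoint. *)
Lemma Ell_le1 t : 0 <= t < 1 -> Ell t <= 1.
Proof.
move=> /andP[t0 t1]; have nt : `|t| < 1 by rewrite ger0_norm.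
apply: le_trans (ler_norm _) _; apply: (psum_norm_le pbounded_Ell nt) => n.
apply: le_trans (_ : \sum_(0 <= i < n.+2) Ell_coef i <= _).
  apply: le_trans (_ : \sum_(0 <= i < n) Ell_coef i <= _).
    apply: ler_sum => i _; rewrite !ger0_norm ?Ell_coef_ge0 //.
    by rewrite ler_piMr ?Ell_coef_ge0 // exprn_ile1 // ltW.
  rewrite [leRHS](@big_cat_nat _ _ _ n) //=; last by rewrite -addn2 leq_addr.
  by rewrite lerDl sumr_ge0 // => i _; exact: Ell_coef_ge0.
(* The terms of index 0 and 1 vanish by the convention 0^-1 = 0; the others telescope. *)
rewrite 2?big_nat_recl // /Ell_coef mul0r mulr0 invr0 !add0r.
suff -> : \sum_(0 <= i < n) (i.+2%:R * i.+2.-1%:R)^-1 = 1 - n.+1%:R^-1 :> R.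
  by rewrite gerBl invr_ge0 ler0n.
elim: n => [|n IH]; first by rewrite big_nil invr1 subrr.
by rewrite big_nat_recr //= IH mulrC telescope_inv; ring.
Qed.

Lemma Ell0 : Ell 0 = 0.
Proof. by rewrite /Ell psum0 /Ell_coef mul0r invr0. Qed.

Lemma Ell_is_derive t : 0 <= t < 1 -> is_derive t 1 Ell (ell t).
Proof.
move=> /andP[t0 t1]; have nt : `|t| < 1 by rewrite ger0_norm.
have -> : ell = psum (pseries_diffs Ell_coef).
  congr psum; apply/funext => n.
  by rewrite /pseries_diffs /Ell_coef /ell_coef invfM mulVKf // pnatr_eq0.
exact: psum_is_derive pbounded_Ell nt.
Qed.

Lemma psum_ell_le f t K : (forall n, `|n%:R * f n| <= K) -> f 0%N = 0 ->
  0 <= t < 1 -> `|psum f t| <= K * ell t.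
Proof.
move=> H f0 /andP[t0 t1]; have nt : `|t| < 1 by rewrite ger0_norm.
have K0 : 0 <= K by apply: le_trans (H 0%N).
have B n : `|f n| <= K * ell_coef n.
  case: n => [|n]; first by rewrite f0 normr0 mulr_ge0 ?ell_coef_ge0.
  by rewrite /ell_coef ler_pdivlMr ?ltr0n // mulrC -[n.+1%:R]normr_nat -normrM.
have fr : pbounded 1 f.
  apply: (@pbounded1_bounded _ K) => n; apply: le_trans (B n) _.
  case: n => [|n]; first by rewrite /ell_coef invr0 mulr0.
  by rewrite ler_pdivrMr ?ltr0n // ler_peMr // ler1n.
have := psum_le_psum fr pbounded_ell nt K0 B ell_coef_ge0.
by rewrite (ger0_norm t0).
Qed.

Definition pentire f := forall r, pbounded r f.

Lemma pentire_fact f B M : 0 <= M -> (forall n, `|f n| <= B * M ^+ n / n`!%:R) -> pentire f.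
Proof.
move=> M0 H r x x0 _.
have B0 : 0 <= B by have := H 0%N; rewrite expr0 mulr1 divr1; exact: le_trans.
have := cvg_seq_bounded (cvgP _ (cvg_exp_coeff (M * x))).
rewrite /bounded_fun => -[C [_ /(_ (C + 1))]]; rewrite ltrDl => /(_ ltr01) HC.
exists (B * (C + 1)) => n.
apply: le_trans (ler_wpM2r (exprn_ge0 n x0) (H n)) _.
rewrite (_ : _ * x ^+ n = B * exp_coeff (M * x) n).
  by rewrite ler_wpM2l //; apply: le_trans (ler_norm _) (HC n _).
by rewrite /exp_coeff /= exprMn; ring.
Qed.

Lemma psum_smooth f : pentire f -> smooth (psum f).
Proof.
move=> fE n t.
have H k : pentire (iter k (@pseries_diffs R) f) /\
    derive1n k (psum f) = psum (iter k (@pseries_diffs R) f).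
  elim: k => [|k [IH1 IH2]]; first by split.
  split; first by move=> r; rewrite iterS; apply: pbounded_diffs.
  rewrite derive1nS IH2; apply/funext => x; rewrite derive1E.
  have xr : `|x| < `|x| + 1 by rewrite ltrDl.
  by have [_ ->] := psum_is_derive (IH1 _) xr.
have [fk ->] := H n.
have tr : `|t| < `|t| + 1 by rewrite ltrDl.
by have [] := psum_is_derive (fk _) tr.
Qed.

End PowerSeries.

(** * Derivatives on the line and comparison by the mean value theorem *)

Section DerivativeTools.
Variable R : realType.
Implicit Types (f g h : R -> R) (x y r t : R).

Lemma is_deriveM1 f g x (df dg : R) : is_derive x 1 f df -> is_derive x 1 g dg ->
  is_derive x 1 (fun y => f y * g y) (f x * dg + g x * df).
Proof. exact: is_deriveM. Qed.

Lemma is_deriveD1 f g x (df dg : R) : is_derive x 1 f df -> is_derive x 1 g dg ->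
  is_derive x 1 (fun y => f y + g y) (df + dg).
Proof. exact: is_deriveD. Qed.

Lemma is_deriveB1 f g x (df dg : R) : is_derive x 1 f df -> is_derive x 1 g dg ->
  is_derive x 1 (fun y => f y - g y) (df - dg).
Proof. exact: is_deriveB. Qed.

Lemma is_deriveZ1 f x (df k : R) : is_derive x 1 f df ->
  is_derive x 1 (fun y => k * f y) (k * df).
Proof. exact: is_deriveZ. Qed.

Lemma is_derive_pow x n : is_derive x 1 (fun y : R => y ^+ n) (n%:R * x ^+ n.-1).
Proof.
have h := @is_deriveX _ _ id n x 1 1 (is_derive_id x 1).
by rewrite exprfctE in h; apply: is_derive_eq h _; rewrite /GRing.scale /= mulr1.
Qed.

Lemma is_derive_comp_sq f x (df : R) : is_derive (x ^+ 2) 1 f df ->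
  is_derive x 1 (fun y => f (y ^+ 2)) (2 * x * df).
Proof.
by move=> H; have := @is_derive1_comp _ f (fun y => y ^+ 2) x _ _ H (is_derive_pow x 2); rewrite expr1 mulrC.
Qed.

Lemma is_derive_continuous f x (df : R) : is_derive x 1 f df ->
  {for x, continuous f}.
Proof. by move=> H; apply/differentiable_continuous/derivable1_diffP; case: H. Qed.

Lemma derive_le f h (df dh : R -> R) a b : a <= b ->
  (forall x, a <= x <= b -> is_derive x 1 f (df x)) ->
  (forall x, a <= x <= b -> is_derive x 1 h (dh x)) ->
  (forall x, a < x < b -> df x <= dh x) -> f b - f a <= h b - h a.
Proof.
rewrite le_eqVlt => /predU1P[<-|ab] Hf Hh H; first by rewrite !subrr.
have D x : a <= x <= b -> is_derive x 1 (fun y => h y - f y) (dh x - df x).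
  by move=> xab; apply: is_deriveB1; [exact: Hh|exact: Hf].
have [x|c|c] := @MVT _ (fun y => h y - f y) (fun x => dh x - df x) a b ab.
- by rewrite in_itv => /andP[ax xb]; apply: D; rewrite !ltW.
- apply: continuous_in_subspaceT => x; rewrite inE /= in_itv /= => xab.
  exact: is_derive_continuous (D x xab).
rewrite in_itv /= => cab E.
have : 0 <= h b - f b - (h a - f a).
  by rewrite E mulr_ge0 ?subr_ge0 ?(ltW ab) // H.
lra.
Qed.

Lemma derive_norm_le f h (df dh : R -> R) a b : a <= b ->
  (forall x, a <= x <= b -> is_derive x 1 f (df x)) ->
  (forall x, a <= x <= b -> is_derive x 1 h (dh x)) ->
  (forall x, a < x < b -> `|df x| <= dh x) -> `|f b - f a| <= h b - h a.
Proof.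
move=> ab Hf Hh H; rewrite ler_norml; apply/andP; split.
  rewrite lerNl; have -> : - (f b - f a) = (- 1 * f b) - (- 1 * f a) by ring.
  apply: (@derive_le (fun x => - 1 * f x) h (fun x => - 1 * df x) dh) => // x xab.
    by apply: is_deriveZ1; exact: Hf.
  by rewrite mulN1r; have := H x xab; rewrite ler_norml lerNl => /andP[].
apply: (derive_le ab Hf Hh) => x xab.
by apply: le_trans (H x xab); exact: ler_norm.
Qed.

(** Carries left limits at 1 from the variable t to r, where t = r^2. *)
Lemma sqr_cvg_at_left : (fun r : R => r ^+ 2) @ 1^'- --> (1 : R)^'-.
Proof.
move=> P [e /= e0 HP].
exists (Num.min (e / 2) 1); first by rewrite /= lt_min divr_gt0 ?ltr01.
move=> r /=; rewrite lt_min => /andP[r1 r2] r3.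
have r4 : 0 < 1 - r by rewrite subr_gt0.
rewrite (gtr0_norm r4) in r1 r2.
have r5 : 0 < 1 - r ^+ 2.
  by rewrite -[1](expr1n _ 2) subr_sqr mulr_gt0 // addr_gt0 //; lra.
apply: HP; last by rewrite -subr_gt0.
rewrite /= gtr0_norm // -[1](expr1n _ 2) subr_sqr.
apply: le_lt_trans (_ : (1 - r) * 2 < _); last by lra.
by rewrite ler_pM2l //; lra.
Qed.

End DerivativeTools.

(** * The radial equation *)

Section SturmLiouville.
Variables (R : realType) (d : nat).
Hypothesis d_ge2 : (2 <= d)%N.
Implicit Types (mu gam r : R) (P : R -> R).

(* The radial equation of L_c, the p_i standing for the derivatives at t. *)
Definition sl_ode (mu gam t p0 p1 p2 : R) :=
  - 4 * t * (1 - t) * p2 + (4 * t - 2 * d%:R * (1 - t)) * p1 + gam * t * p0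
  = mu * p0.

(* In the variable r = sqrt t the weight t^(d/2) becomes polynomial. *)
Lemma flux_derive P (P1 : R -> R) mu gam r (p2 : R) : is_derive (r ^+ 2) 1 P1 p2 ->
  sl_ode mu gam (r ^+ 2) (P (r ^+ 2)) (P1 (r ^+ 2)) p2 ->
  is_derive r 1 (fun y => y ^+ d * (1 - y ^+ 2) * P1 (y ^+ 2))
    (2^-1 * r ^+ d.-1 * (gam * r ^+ 2 - mu) * P (r ^+ 2)).
Proof.
move=> H ode.
have D1 : is_derive r 1 (fun y : R => 1 - y ^+ 2) (0 - 2%:R * r ^+ 1).
  by apply: (@is_deriveB1 _ (fun=> 1)); exact: is_derive_pow.
have := is_deriveM1 (is_deriveM1 (is_derive_pow r d) D1) (is_derive_comp_sq H).
move/is_derive_eq; apply.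
move: ode; rewrite /sl_ode.
have -> : r ^+ d = r ^+ d.-1 * r by rewrite -exprSr prednK //; case: (d) d_ge2.
move: (P _) (P1 _) => p0 p1; rewrite expr1 => ode.
have -> : 2^-1 * r ^+ d.-1 * (gam * r ^+ 2 - mu) * p0 =
    2^-1 * r ^+ d.-1 * (gam * r ^+ 2 * p0 - mu * p0) by ring.
by rewrite -ode; field.
Qed.

Section Uniqueness.
Variables (mu gam : R) (P P1 P2 : R -> R).
Hypothesis dP : forall t : R, 0 <= t < 1 -> is_derive t 1 P (P1 t).
Hypothesis dP1 : forall t : R, 0 <= t < 1 -> is_derive t 1 P1 (P2 t).
Hypothesis odeP : forall t : R, 0 < t < 1 -> sl_ode mu gam t (P t) (P1 t) (P2 t).
Hypothesis P0 : P 0 = 0.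

Let C : R := `|gam| + `|mu|.

(* Integrating the flux improves a bound on P to one on P'. *)
Lemma sl_flux_bound (t K : R) : 0 < t < 1 -> (forall s : R, 0 < s < t -> `|P s| <= K) ->
  `|P1 t| <= C / (2 * d%:R * (1 - t)) * K.
Proof.
move=> /andP[t0 t1] H.
have t1' : 0 < 1 - t by rewrite subr_gt0.
have d0 : 0 < d%:R :> R by rewrite ltr0n; case: (d) d_ge2.
pose r := Num.sqrt t.
have r0 : 0 < r by rewrite sqrtr_gt0.
have rt : r ^+ 2 = t by rewrite sqr_sqrtr // ltW.
pose F y := y ^+ d * (1 - y ^+ 2) * P1 (y ^+ 2).
have sqle s : 0 <= s <= r -> 0 <= s ^+ 2 <= t.
  by move=> /andP[s0 sr]; rewrite exprn_ge0 //= -rt ler_sqr // nnegrE // ltW.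
have sqlt s : 0 < s < r -> 0 < s ^+ 2 < t.
  by move=> /andP[s0 sr]; rewrite exprn_gt0 //= -rt ltr_sqr // nnegrE ltW.
have dpred : d.-1.+1 = d by rewrite prednK //; case: (d) d_ge2.
(* The equation is assumed for t > 0 only, so the derivative of the flux at s = 0 is computed
   directly; it vanishes since d >= 2. *)
have HF s : 0 <= s <= r -> is_derive s 1 F
   (if s == 0 then 0 else 2^-1 * s ^+ d.-1 * (gam * s ^+ 2 - mu) * P (s ^+ 2)).
  move=> sr; have /andP[s20 s2t] := sqle s sr.
  have I : 0 <= s ^+ 2 < 1 by rewrite s20 (le_lt_trans s2t t1).
  case: eqP => [s0|/eqP s0].
    have D1 : is_derive s 1 (fun y : R => 1 - y ^+ 2) (0 - 2%:R * s ^+ 1).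
      by apply: (@is_deriveB1 _ (fun=> 1)); exact: is_derive_pow.
    have := is_deriveM1 (is_deriveM1 (is_derive_pow s d) D1) (is_derive_comp_sq (dP1 I)).
    move/is_derive_eq; apply.
    rewrite s0 -dpred !expr0n /= -[d.-1]prednK ?exprS ?expr1; last by case: (d) d_ge2 => [|[]].
    have -> : (d.-2.+1 == 0%N)%:R = 0 :> R by [].
    by ring.
  apply: flux_derive (dP1 I) _; apply: odeP.
  by rewrite (le_lt_trans s2t t1) andbT lt_neqAle s20 eq_sym expf_neq0.
have HH s : 0 <= s <= r -> is_derive s 1 (fun y => C / (2 * d%:R) * K * y ^+ d)
    (C / (2 * d%:R) * K * (d%:R * s ^+ d.-1)).
  by move=> _; apply: is_deriveZ1; exact: is_derive_pow.
have := derive_norm_le (ltW r0) HF HH; rewrite /F /= rt !expr0n /=.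
rewrite (_ : d == 0%N = false) ?mul0r ?subr0 ?mulr0 ?subr0; last by case: (d) d_ge2.
have -> : C / (2 * d%:R * (1 - t)) * K = C / (2 * d%:R) * K / (1 - t).
  by field; rewrite !gt_eqF.
move=> /(_ _)H2; have {H2} : `|r ^+ d * (1 - t) * P1 t| <= C / (2 * d%:R) * K * r ^+ d.
  apply: H2 => s /[dup] s_in /andP[s0 sr].
  have /andP[s20 s2t] := sqlt s s_in.
  rewrite gt_eqF // !normrM gtr0_norm ?invr_gt0 // (gtr0_norm (exprn_gt0 _ s0)).
  have h1 : `|gam * s ^+ 2 - mu| <= C.
    apply: le_trans (ler_normB _ _) _; rewrite lerD2r normrM (gtr0_norm s20).
    by rewrite ler_piMr // ltW // (lt_trans s2t t1).
  have -> : C / (2 * d%:R) * K * (d%:R * s ^+ d.-1) = 2^-1 * s ^+ d.-1 * (C * K).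
    by field; rewrite gt_eqF.
  rewrite -mulrA ler_wpM2l //; first by rewrite mulr_ge0 ?invr_ge0 ?exprn_ge0 ?(ltW s0).
  by rewrite ler_pM // H // s20.
rewrite !normrM (gtr0_norm (exprn_gt0 _ r0)) (gtr0_norm t1') -mulrA mulrC.
by rewrite ler_pM2r ?exprn_gt0 // mulrC -ler_pdivlMr.
Qed.

(** Volterra iteration, as 0 is a singular point: a bound B s^n on P passes to P' with a factor L by
    the flux, then integration from P(0) = 0 gives L B s^(n+1) / (n + 1). Hence |P| <= K (L s)^n /
    n! for all n. *)
Lemma sl_unique (t : R) : 0 <= t < 1 -> P t = 0 /\ (0 < t -> P1 t = 0).
Proof.
move=> /andP[t0 t1].
have t1' : 0 < 1 - t by rewrite subr_gt0.
have d0 : 0 < d%:R :> R by rewrite ltr0n; case: (d) d_ge2.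
have [K HK] : exists K : R, forall s : R, 0 <= s <= t -> `|P s| <= K.
  have [|c _ Hc] := @EVT_max _ (fun s => `|P s|) 0 t t0.
    apply: continuous_in_subspaceT => s; rewrite inE /= in_itv /= => /andP[s0 st].
    apply: (@continuous_comp _ _ _ P (fun x => `|x|)); last exact: norm_continuous.
    by apply: is_derive_continuous (dP _); rewrite s0 (le_lt_trans st).
  by exists `|P c| => s st; apply: Hc; rewrite in_itv.
pose L := C / (2 * d%:R * (1 - t)).
have C0 : 0 <= C by rewrite addr_ge0.
have L0 : 0 <= L by rewrite divr_ge0 ?mulr_ge0 ?ler0n ?(ltW t1').
have K0 : 0 <= K by apply: le_trans (HK 0 _); rewrite ?lexx.
have H1 n (B : R) : (forall s, 0 <= s <= t -> `|P s| <= B * s ^+ n) ->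
    forall s, 0 < s <= t -> `|P1 s| <= L * (B * s ^+ n).
  move=> HB s /andP[s0 st].
  have B0 : 0 <= B * s ^+ n by apply: le_trans (HB s _); rewrite ?(ltW s0).
  have s1 : s < 1 by apply: le_lt_trans t1.
  have B0' : 0 <= B by rewrite pmulr_lge0 ?exprn_gt0 // in B0.
  apply: le_trans (sl_flux_bound (K := B * s ^+ n) _ _) _.
  - by rewrite s0.
  - move=> y /andP[y0 ys]; apply: le_trans (HB y _) _.
      by rewrite (ltW y0) (le_trans (ltW ys)).
    by rewrite ler_wpM2l // lerXn2r ?nnegrE ?(ltW y0) ?(ltW s0) // ltW.
  rewrite ler_wpM2r // ler_wpM2l // lef_pV2 ?posrE ?mulr_gt0 ?subr_gt0 //.
  by rewrite ler_wpM2l ?mulr_ge0 ?ler0n // lerD2l lerN2.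
have H2 n s : 0 <= s <= t -> `|P s| <= K * L ^+ n / n`!%:R * s ^+ n.
  elim: n s => [|n IH] s st.
    by rewrite !expr0 !mulr1 divr1 HK.
  have /andP[s0 st'] := st.
  rewrite -[P s]subr0 -P0.
  have -> : K * L ^+ n.+1 / n.+1`!%:R * s ^+ n.+1 =
     K * L ^+ n.+1 / n.+1`!%:R * s ^+ n.+1 - K * L ^+ n.+1 / n.+1`!%:R * 0 ^+ n.+1.
    by rewrite [0 ^+ _]expr0n mulr0 subr0.
  apply: (@derive_norm_le _ P (fun y => K * L ^+ n.+1 / n.+1`!%:R * y ^+ n.+1) P1
    (fun y => K * L ^+ n.+1 / n.+1`!%:R * (n.+1%:R * y ^+ n)) _ _ s0).
  - move=> y /andP[y0 ys]; apply: dP.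
    by rewrite y0 (le_lt_trans ys) // (le_lt_trans st').
  - by move=> y _; apply: is_deriveZ1; exact: is_derive_pow.
  - move=> y /andP[y0 ys].
    apply: le_trans (H1 n _ IH y _) _; first by rewrite y0 (le_trans (ltW ys)).
    rewrite factS natrM exprS le_eqVlt; apply/orP; left; apply/eqP.
    have : n`!%:R != 0 :> R by rewrite pnatr_eq0 -lt0n fact_gt0.
    have : n.+1%:R != 0 :> R by rewrite pnatr_eq0.
    move: (n.+1%:R) (n`!%:R) (L ^+ n) (y ^+ n) => a b l z a0 b0.
    by field; rewrite a0 b0.
clearbody L.
have cvg0 : (fun n => K * exp_coeff (L * t) n) @ \oo --> 0.
  by rewrite -(mulr0 K); apply: cvgZr; exact: cvg_exp_coeff.
have E n : K * L ^+ n / n`!%:R * t ^+ n = K * exp_coeff (L * t) n.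
  by rewrite /exp_coeff /= exprMn; ring.
have lim0 (x B : R) : 0 <= B -> (forall n, `|x| <= B * (K * exp_coeff (L * t) n)) -> x = 0.
  move=> B0 Hx; apply/eqP; rewrite -normr_le0.
  have c : (fun n => B * (K * exp_coeff (L * t) n)) @ \oo --> 0.
    by rewrite -(mulr0 B); apply: cvgZr.
  rewrite -(cvg_lim _ c) //; apply: limr_ge; first by apply: cvgP c.
  by exists 0%N => // n _; exact: Hx.
split.
  apply: (lim0 _ 1) => // n; rewrite mul1r -(E n); apply: H2.
  by rewrite t0 lexx.
move=> tp; apply: (lim0 _ L) => // n; rewrite -(E n).
by apply: H1 => [s st|]; [apply: H2|rewrite tp lexx].
Qed.

End Uniqueness.
End SturmLiouville.

(** * The solution analytic at 0 and its behaviour at 1 *)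

Section FrobeniusSolution.
Variables (R : realType) (d : nat).
Hypothesis d_ge2 : (2 <= d)%N.
Implicit Types (mu gam : R).

Local Notation a := (frob d).
Local Notation W := (frobW d).

Definition frobu mu gam := psum (a mu gam).
Definition frobdu mu gam := psum (pseries_diffs (a mu gam)).
Definition frobddu mu gam := psum (pseries_diffs (pseries_diffs (a mu gam))).

Lemma pbounded_frob mu gam : pbounded 1 (a mu gam).
Proof. exact: pbounded1_bounded (frob_le d_ge2 (lexx _)). Qed.

Lemma pentire_frob mu gam : W mu gam = 0 -> pentire (a mu gam).
Proof.
move=> W0; have M1 : 1 <= `|mu| + `|gam| + 1 by rewrite lerDr addr_ge0.
have muM : `|mu| + `|gam| <= `|mu| + `|gam| + 1 by rewrite lerDl.
apply: (@pentire_fact _ _ (frob_bound (`|mu| + `|gam| + 1)) (`|mu| + `|gam| + 1)).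
  by apply: le_trans M1.
by move=> n; exact: (frob_fact_le d_ge2 muM n W0 M1).
Qed.

Lemma frobu0 mu gam : frobu mu gam 0 = 1. Proof. by rewrite /frobu psum0. Qed.

Lemma frobu_derive r mu gam (t : R) : pbounded r (a mu gam) -> `|t| < r ->
  is_derive t 1 (frobu mu gam) (frobdu mu gam t).
Proof. exact: psum_is_derive. Qed.

Lemma frobdu_derive r mu gam (t : R) : pbounded r (a mu gam) -> `|t| < r ->
  is_derive t 1 (frobdu mu gam) (frobddu mu gam t).
Proof. by move=> /pbounded_diffs; exact: psum_is_derive. Qed.

Lemma frobu_ode r mu gam (t : R) : pbounded r (a mu gam) -> `|t| < r ->
  sl_ode d mu gam t (frobu mu gam t) (frobdu mu gam t) (frobddu mu gam t).
Proof.
move=> ar tr; rewrite /sl_ode /frobu /frobdu /frobddu.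
set f := a mu gam in ar *; set f1 := pseries_diffs f; set f2 := pseries_diffs f1.
have b1 : pbounded r f1 := pbounded_diffs ar.
have b2 : pbounded r f2 := pbounded_diffs b1.
have s1 := pbounded_shift b1; have s2 := pbounded_shift b2.
have s2' := pbounded_shift s2; have s0 := pbounded_shift ar.
(* Multiplication by t is [pshift] on coefficients. The sequence [z = z0 + z1 + z2] collects the
   coefficients of the left side of the equation minus the right side, and the recurrence makes it
   zero. *)
pose z0 n := -4 * pshift f2 n + 4 * pshift (pshift f2) n.
pose z1 n := (4 + 2 * d%:R) * pshift f1 n + (- 2 * d%:R) * f1 n.
pose z2 n := gam * pshift f n + (- mu) * f n.
pose z n := z0 n + (z1 n + z2 n).
have c0 : pbounded r z0 by apply: pboundedD; apply: pboundedZ.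
have c1 : pbounded r z1 by apply: pboundedD; apply: pboundedZ.
have c2 : pbounded r z2 by apply: pboundedD; apply: pboundedZ.
have d0 : d%:R != 0 :> R by rewrite pnatr_eq0; case: (d) d_ge2.
have zE : z = (fun n => 0 * f n).
  apply/funext => n; rewrite mul0r /z /z0 /z1 /z2 /f2 /f1 /pseries_diffs /pshift.
  case: n => [|[|n]].
  - by rewrite /f frob0 frob1; field.
  - have := frobSS d mu gam 0; rewrite -/f /f frob0.
    move: (a mu gam 1) (a mu gam 2) => x y E.
    have -> : gam = gam * 1 by ring.
    by rewrite -[gam * 1](addKr ((2 * 1%:R * (2 * 1%:R + d%:R) - mu) * x)) -E; ring.
  - have := frobSS d mu gam n.+1; rewrite -/f.
    move: (f n.+3) (f n.+2) (f n.+1) => x y w E.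
    rewrite -[gam * w](addKr ((2 * n.+2%:R * (2 * n.+2%:R + d%:R) - mu) * y)) -E.
    by ring.
have : psum z t = 0 by rewrite zE (psumZ 0 ar tr) mul0r.
rewrite /z (psumD c0 (pboundedD c1 c2) tr) (psumD c1 c2 tr).
rewrite /z0 (psumD (pboundedZ _ s2) (pboundedZ _ s2') tr).
rewrite /z1 (psumD (pboundedZ _ s1) (pboundedZ _ b1) tr).
rewrite /z2 (psumD (pboundedZ _ s0) (pboundedZ _ ar) tr).
rewrite (psumZ _ s2 tr) (psumZ _ s2' tr) (psumZ _ s1 tr) (psumZ _ b1 tr).
rewrite (psumZ _ s0 tr) (psumZ _ ar tr) (psum_shift s2 tr) (psum_shift b2 tr).
rewrite (psum_shift b1 tr) (psum_shift ar tr) => E.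
by apply/eqP; rewrite -subr_eq0 -E; apply/eqP; ring.
Qed.

(** The value at t = 1 of the exponential majorant available when W = 0: one bound for all
    eigenfunctions with parameters of size at most M. *)
Definition frob_sup (M : R) := psum (fun j => frob_bound M * M ^+ j / j`!%:R) 1.

Lemma frobu_eig_le M mu gam (t : R) : `|mu| + `|gam| <= M -> 1 <= M ->
  W mu gam = 0 -> 0 <= t <= 1 -> `|frobu mu gam t| <= frob_sup M.
Proof.
move=> muM M1 W0 /andP[t0 t1].
have M0 : 0 <= M by apply: le_trans M1.
have B1 := frob_bound_ge1 M0; have B0 : 0 <= frob_bound M by apply: le_trans B1.
pose g j := frob_bound M * M ^+ j / j`!%:R.
have g0 j : 0 <= g j by rewrite divr_ge0 ?ler0n // mulr_ge0 ?exprn_ge0.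
have gE : pbounded 2 g.
  by apply: (@pentire_fact _ _ (frob_bound M) M) => // n; rewrite ger0_norm //; exact: g0.
have t2 : `|t| < 2 by rewrite ger0_norm //; apply: le_lt_trans t1 _; rewrite ltr1n.
have o2 : `|1 : R| < 2 by rewrite normr1 ltr1n.
apply: (psum_norm_le (pentire_frob W0 (r := 2)) t2) => n.
apply: le_trans (psum_partial_le n gE o2 ler01 g0).
apply: ler_sum => i _; rewrite ler_pM ?exprn_ge0 //.
  exact: (frob_fact_le d_ge2 muM i W0 M1).
by rewrite expr1n ger0_norm // exprn_ile1.
Qed.

Lemma frob_sup_ge0 M : 1 <= M -> 0 <= frob_sup M.
Proof.
move=> M1; have M0 : 0 <= M by apply: le_trans M1.
have B1 := frob_bound_ge1 M0; have B0 : 0 <= frob_bound M by apply: le_trans B1.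
have g0 j : 0 <= frob_bound M * M ^+ j / j`!%:R.
  by rewrite divr_ge0 ?ler0n // mulr_ge0 ?exprn_ge0.
have gE : pbounded 2 (fun j => frob_bound M * M ^+ j / j`!%:R).
  by apply: (@pentire_fact _ _ (frob_bound M) M) => // n; rewrite ger0_norm //; exact: g0.
have o2 : `|1 : R| < 2 by rewrite normr1 ltr1n.
by have := psum_partial_le 0 gE o2 ler01 g0; rewrite big_nil.
Qed.

(** By [nfrob_lip] the n-th coefficients differ by O(1 / n), and those of index 0 agree, so the
    difference is dominated by a multiple of -log(1 - t). This needs no vanishing of W, so it also
    compares an eigenfunction with a singular solution. *)
Lemma frobu_dist M mu gam mu' gam' (t : R) :
  `|mu| + `|gam| <= M -> `|mu'| + `|gam'| <= M -> 0 <= t < 1 ->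
  `|frobu mu gam t - frobu mu' gam' t| <=
    frob_lip M * (`|mu - mu'| + `|gam - gam'|) * ell t.
Proof.
move=> muM muM' /[dup] t01 /andP[t0 t1]; have nt : `|t| < 1 by rewrite ger0_norm.
have p := pbounded_frob mu gam; have p' := pbounded_frob mu' gam'.
have -> : frobu mu gam t - frobu mu' gam' t =
    psum (fun n => a mu gam n + - 1 * a mu' gam' n) t.
  by rewrite (psumD p (pboundedZ _ p') nt) (psumZ _ p' nt) mulN1r.
apply: psum_ell_le => // [n|]; last by rewrite !frob0; ring.
rewrite mulrDr mulN1r mulrN; exact: (nfrob_lip d_ge2 muM muM' n).
Qed.

(** The coefficients of u' are (n + 1) a_(n+1), which tend to W; Abel's theorem reads W off as the
    strength of the singularity. *)
Lemma frobdu_left1 mu gam : (fun t : R => (1 - t) * frobdu mu gam t) @ 1^'- --> W mu gam.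
Proof.
apply: abel_limit; have := cvg_nfrob d_ge2 (lexx (`|mu| + `|gam|)).
by rewrite -cvg_shiftS.
Qed.

Lemma frobu_left1 mu gam : (fun t : R => (1 - t) * frobu mu gam t) @ 1^'- --> 0.
Proof.
apply: abel_limit; rewrite -cvg_shiftS.
pose B := frob_bound (`|mu| + `|gam|).
have c : (fun n => B * harmonic n) @ \oo --> 0.
  by rewrite -(mulr0 B); apply: cvgZr; exact: cvg_harmonic.
apply/cvgr0Pnorm_le => e e0; move/cvgr0Pnorm_le: c => /(_ e e0).
apply: filterS => n /= H; apply: le_trans H; rewrite [leRHS]ger0_norm.
  exact: frob_le_nfrob (nfrob_le d_ge2 (lexx _) _).
by rewrite mulr_ge0 ?invr_ge0 ?ler0n // (le_trans _ (frob_bound_ge1 _)) ?addr_ge0.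
Qed.

(** The weighted Wronskian of Lagrange's identity, in the variable r = sqrt t but with derivatives
    taken in t. *)
Definition wronsk mu1 mu2 gam (r : R) :=
  r ^+ d * (1 - r ^+ 2) * frobdu mu1 gam (r ^+ 2) * frobu mu2 gam (r ^+ 2) -
  r ^+ d * (1 - r ^+ 2) * frobdu mu2 gam (r ^+ 2) * frobu mu1 gam (r ^+ 2).

Lemma wronsk_derive mu1 mu2 gam (r : R) : 0 <= r < 1 ->
  is_derive r 1 (wronsk mu1 mu2 gam) (2^-1 * (mu2 - mu1) *
    (r ^+ d.-1 * (frobu mu1 gam (r ^+ 2) * frobu mu2 gam (r ^+ 2)))).
Proof.
move=> /andP[r0 r1].
have s1 : `|r ^+ 2| < 1 by rewrite ger0_norm ?exprn_ge0 // exprn_ilt1.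
have p1 := pbounded_frob mu1 gam; have p2 := pbounded_frob mu2 gam.
have D mu := is_derive_comp_sq (frobu_derive (pbounded_frob mu gam) s1).
have F mu := flux_derive d_ge2 (frobdu_derive (pbounded_frob mu gam) s1)
  (frobu_ode (pbounded_frob mu gam) s1).
have := is_deriveB1 (is_deriveM1 (F mu1) (D mu2)) (is_deriveM1 (F mu2) (D mu1)).
by move/is_derive_eq; apply; ring.
Qed.

(** Since u1 is entire, u1 and u1' have finite limits at 1. The factor 1 - r^2 then kills the term
    in u2, and turns u2' into W(mu2). *)
Lemma wronsk_left1 mu1 mu2 gam : W mu1 gam = 0 ->
  wronsk mu1 mu2 gam @ 1^'- --> - (frobu mu1 gam 1 * W mu2 gam).
Proof.
move=> W1; have e1 := pentire_frob W1 (r := 2).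
have o2 : `|1 ^+ 2 : R| < 2 by rewrite expr1n normr1 ltr1n.
have cu : (fun r : R => frobu mu1 gam (r ^+ 2)) @ 1^'- --> frobu mu1 gam 1.
  apply: cvg_at_left_filter; rewrite -{2}(expr1n _ 2).
  exact: is_derive_continuous (is_derive_comp_sq (frobu_derive e1 o2)).
have cdu : (fun r : R => frobdu mu1 gam (r ^+ 2)) @ 1^'- --> frobdu mu1 gam 1.
  apply: cvg_at_left_filter; rewrite -{2}(expr1n _ 2).
  exact: is_derive_continuous (is_derive_comp_sq (frobdu_derive e1 o2)).
have cd : (fun r : R => r ^+ d) @ 1^'- --> (1 : R).
  apply: cvg_at_left_filter; rewrite -{2}(expr1n R d).
  exact: is_derive_continuous (is_derive_pow 1 d).
have A : (fun r : R => (1 - r ^+ 2) * frobdu mu2 gam (r ^+ 2)) @ 1^'- --> W mu2 gam.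
  by move=> X /(@frobdu_left1 mu2 gam) HX; exact: (@sqr_cvg_at_left R _ HX).
have B : (fun r : R => (1 - r ^+ 2) * frobu mu2 gam (r ^+ 2)) @ 1^'- --> 0.
  by move=> X /(@frobu_left1 mu2 gam) HX; exact: (@sqr_cvg_at_left R _ HX).
have -> : wronsk mu1 mu2 gam = (fun r : R =>
   r ^+ d * (frobdu mu1 gam (r ^+ 2) * ((1 - r ^+ 2) * frobu mu2 gam (r ^+ 2))) -
   r ^+ d * (frobu mu1 gam (r ^+ 2) * ((1 - r ^+ 2) * frobdu mu2 gam (r ^+ 2)))).
  by apply/funext => r; rewrite /wronsk; ring.
have -> : - (frobu mu1 gam 1 * W mu2 gam) =
   1 * (frobdu mu1 gam 1 * 0) - 1 * (frobu mu1 gam 1 * W mu2 gam) by ring.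
by apply: cvgB; apply: cvgM => //; apply: cvgM.
Qed.

End FrobeniusSolution.

(** * Zeros of W *)

Section Zeros.
Variables (R : realType) (d : nat).
Hypothesis d_ge2 : (2 <= d)%N.
Implicit Types (mu gam : R).

Local Notation u := (frobu d).
Local Notation W := (frobW d).

(** Continuity at 0, where u = 1. It supplies the positive part of the overlap integral, and later a
    radius at which the limit eigenfunction does not vanish. *)
Lemma frobu_ge_half mu gam : exists rho : R, 0 < rho < 1 /\
  forall t, 0 <= t <= rho -> 2^-1 <= u mu gam t.
Proof.
have z1 : `|0 : R| < 1 by rewrite normr0.
have := is_derive_continuous (frobu_derive (pbounded_frob d_ge2 mu gam) z1).
move=> /cvgrPdist_lt /(_ 2^-1); rewrite invr_gt0 ltr0n => /(_ isT).
rewrite frobu0 => -[e /= e0 H].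
exists (Num.min (e / 2) 2^-1); split.
  by rewrite lt_min divr_gt0 // invr_gt0 ltr0n /= gt_min invf_lt1 ?ltr1n ?orbT.
move=> t /andP[t0]; rewrite le_min => /andP[t1 _].
have := H t; rewrite /= sub0r normrN ger0_norm // => /(_ _).
have te : t < e by lra.
by move=> /(_ te); rewrite ltr_norml => /andP[_]; lra.
Qed.

(** * Lagrange's identity near a zero of W *)

Section Overlap.
Variables (mu0 gam0 : R).
Hypothesis W0 : W mu0 gam0 = 0.

Let M : R := `|mu0| + `|gam0| + 2.
Let C : R := frob_sup M.
Let lip : R := frob_lip M.

Let M1 : 1 <= M.
Proof. by have := normr_ge0 mu0; have := normr_ge0 gam0; rewrite /M; lra. Qed.

Let C0 : 0 <= C. Proof. exact: frob_sup_ge0. Qed.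

Let lip0 : 0 <= lip.
Proof.
apply: (@frob_lip_ge0 R M mu0 gam0).
by rewrite /M lerDl.
Qed.

Let near_le mu gam : `|mu - mu0| < 1 -> `|gam - gam0| < 1 -> `|mu| + `|gam| <= M.
Proof.
move=> h1 h2; have := ler_normD (mu - mu0) mu0; have := ler_normD (gam - gam0) gam0.
by rewrite !subrK /M; lra.
Qed.

(* -u1(1) W(mu2) = (mu2 - mu1)/2 * I, where I is the weighted integral of
   u1 u2, which stays close to that of u0^2. *)
Lemma frob_overlap : exists kappa delta : R, [/\ 0 < kappa, 0 < delta &
  forall mu1 mu2 gam, `|mu1 - mu0| < delta -> `|mu2 - mu0| < delta ->
    `|gam - gam0| < delta -> W mu1 gam = 0 -> mu1 != mu2 ->
    exists2 I, kappa <= I & - (u mu1 gam 1 * W mu2 gam) = 2^-1 * (mu2 - mu1) * I].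
Proof.
have [rho [/andP[rho0 rho1] Hrho]] := frobu_ge_half mu0 gam0.
have dp : d.-1.+1 = d by rewrite prednK //; case: (d) d_ge2.
have d0 : 0 < d%:R :> R by rewrite ltr0n; case: (d) d_ge2.
(* On [0, rho], u0^2 >= 1/4, so the weighted integral of u0^2 is at least rho^d / (4 d) = 2 kap. One
   kap is left for the error. *)
pose kap := rho ^+ d / (8 * d%:R).
have kap0 : 0 < kap by rewrite (divr_gt0 (exprn_gt0 _ rho0)) // mulr_gt0 // ltr0n.
(* Chosen so that [C * eta <= kap] with [eta = lip * (2 * del)]. The cap 1 keeps all parameters
   within [M], whose summand 2 leaves room for mu and gam to move by 1 each; the added ones keep the
   denominator positive. *)
pose del := Num.min 1 (kap / (2 * ((C + 1) * (lip + 1)))).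
have D0 : 0 < (C + 1) * (lip + 1) by rewrite mulr_gt0 // ltr_wpDl.
have del0 : 0 < del by rewrite lt_min ltr01 divr_gt0 // mulr_gt0 // ltr0n.
exists kap, del; split=> // mu1 mu2 gam d1 d2 dg W1 neq.
have del1 : del <= 1 by rewrite ge_min lexx.
have m0 : `|mu0| + `|gam0| <= M by rewrite /M lerDl.
have m1 : `|mu1| + `|gam| <= M by apply: near_le; apply: lt_le_trans del1.
have m2 : `|mu2| + `|gam| <= M by apply: near_le; apply: lt_le_trans del1.
pose eta := lip * (2 * del).
have eta0 : 0 <= eta by rewrite mulr_ge0 // mulr_ge0 ?ler0n // ltW.
have Ceta : C * eta <= kap.
  have : del <= kap / (2 * ((C + 1) * (lip + 1))) by rewrite ge_min lexx orbT.
  rewrite ler_pdivlMr; last by rewrite mulr_gt0 // ltr0n.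
  apply: le_trans; rewrite /eta.
  have -> : C * (lip * (2 * del)) = del * (2 * (C * lip)) by ring.
  rewrite ler_wpM2l ?(ltW del0) // ler_wpM2l ?ler0n //.
  by rewrite ler_pM // lerDl ler01.
have eta_dist mu t : `|mu - mu0| < del -> `|mu| + `|gam| <= M -> 0 <= t < 1 ->
    `|u mu gam t - u mu0 gam0 t| <= eta * ell t.
  move=> dm mM t01; apply: le_trans (frobu_dist d_ge2 mM m0 t01) _.
  by rewrite ler_wpM2r ?ell_ge0 // ler_wpM2l //; lra.
have prod t : 0 <= t < 1 ->
    `|u mu1 gam t * u mu2 gam t - u mu0 gam0 t ^+ 2| <= 2 * (C * eta * ell t).
  move=> /[dup] t01 /andP[t0 t1].
  have t01' : 0 <= t <= 1 by rewrite t0 ltW.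
  have -> : u mu1 gam t * u mu2 gam t - u mu0 gam0 t ^+ 2 =
     u mu1 gam t * (u mu2 gam t - u mu0 gam0 t) +
     u mu0 gam0 t * (u mu1 gam t - u mu0 gam0 t) by ring.
  apply: le_trans (ler_normD _ _) _; rewrite !normrM mulr2n mulrDl mul1r.
  have b1 := frobu_eig_le d_ge2 m1 M1 W1 t01'.
  have b0 := frobu_eig_le d_ge2 m0 M1 W0 t01'.
  have e1 := eta_dist _ _ d1 m1 t01; have e2 := eta_dist _ _ d2 m2 t01.
  by rewrite -(mulrA C) lerD // ler_pM.
(* With this factor [F] is the integral of s^(d-1) u1 u2 from 0 to r. *)
pose k : R := (2^-1 * (mu2 - mu1))^-1.
have k0 : 2^-1 * (mu2 - mu1) != 0.
  by rewrite mulf_neq0 ?invr_eq0 ?pnatr_eq0 // subr_eq0 eq_sym.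
pose F r := k * wronsk d mu1 mu2 gam r.
(* The correction compensates the possibly negative error in u1 u2: its derivative 2 r C eta ell
   dominates r^(d-1) 2 C eta ell because d >= 2. So S' >= r^(d-1) u0^2, [S] is nondecreasing, and
   the correction itself never exceeds kap. *)
pose S r := F r + C * eta * Ell (r ^+ 2).
pose dS (r : R) := r ^+ d.-1 * (u mu1 gam (r ^+ 2) * u mu2 gam (r ^+ 2))
  + C * eta * (2 * r * ell (r ^+ 2)).
have sq01 (r : R) : 0 <= r < 1 -> 0 <= r ^+ 2 < 1.
  by move=> /andP[r0 r1]; rewrite exprn_ge0 //= exprn_ilt1.
have HS (r : R) : 0 <= r < 1 -> is_derive r 1 S (dS r).
  move=> r01; apply: is_deriveD1.
    have := is_deriveZ1 k (wronsk_derive d_ge2 mu1 mu2 gam r01).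
    by move/is_derive_eq; apply; rewrite /k mulKf.
  by apply: is_deriveZ1; apply: is_derive_comp_sq; apply: Ell_is_derive; exact: sq01.
have dS_ge (r : R) : 0 <= r < 1 -> r ^+ d.-1 * u mu0 gam0 (r ^+ 2) ^+ 2 <= dS r.
  move=> /[dup] r01 /andP[r0 r1]; rewrite /dS.
  have := prod _ (sq01 r r01); rewrite ler_norml => /andP[+ _].
  set p := u mu1 gam _ * _; set q := u mu0 gam0 _ ^+ 2; set l := C * eta * ell _.
  move=> pq.
  have l0 : 0 <= l by rewrite mulr_ge0 ?ell_ge0 ?sq01 // mulr_ge0.
  have -> : C * eta * (2 * r * ell (r ^+ 2)) = r * (2 * l) by rewrite /l; ring.
  have rd : r ^+ d.-1 <= r.
    have -> : d.-1 = d.-2.+1 by case: (d) d_ge2 => [|[]].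
    by rewrite exprS ler_piMr // exprn_ile1 // ltW.
  have h1 : r ^+ d.-1 * (2 * l) <= r * (2 * l) by rewrite ler_wpM2r // mulr_ge0 // ler0n.
  have h2 : r ^+ d.-1 * (q - 2 * l) <= r ^+ d.-1 * p by rewrite ler_wpM2l ?exprn_ge0 //; lra.
  by move: h2; rewrite mulrBr; lra.
have S0 : S 0 = 0.
  have dn : (d == 0)%N = false by case: (d) d_ge2.
  by rewrite /S /F /wronsk !expr0n dn /= ?mulr0n Ell0; ring.
have S_rho : 2 * kap <= S rho.
  have := @derive_le R (fun r => (4 * d%:R)^-1 * r ^+ d) S
     (fun r => (4 * d%:R)^-1 * (d%:R * r ^+ d.-1)) dS 0 rho (ltW rho0).
  rewrite S0 subr0 expr0n (_ : (d == 0)%N = false) /= ?mulr0n ?mulr0 ?subr0; last by case: (d) d_ge2.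
  have -> : 2 * kap = (4 * d%:R)^-1 * rho ^+ d by rewrite /kap; field; rewrite gt_eqF.
  apply.
  - by move=> x _; apply: is_deriveZ1; exact: is_derive_pow.
  - by move=> x /andP[x0 x1]; apply: HS; rewrite x0 (le_lt_trans x1).
  - move=> x /andP[x0 x1].
    have x01 : 0 <= x < 1 by rewrite ltW //= (lt_trans x1).
    apply: le_trans (dS_ge x x01).
    have -> : (4 * d%:R)^-1 * (d%:R * x ^+ d.-1) = x ^+ d.-1 * (2^-1 ^+ 2).
      by field; rewrite gt_eqF.
    rewrite ler_wpM2l ?exprn_ge0 ?(ltW x0) //.
    have := Hrho (x ^+ 2); rewrite exprn_ge0 ?(ltW x0) //= => /(_ _) h.
    rewrite lerXn2r ?nnegrE ?invr_ge0 ?ler0n //.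
      apply: le_trans (h _); rewrite ?invr_ge0 ?ler0n //.
      by rewrite expr2 (le_trans _ (ltW x1)) // ler_piMr // ltW // (lt_trans x1).
    apply: h; rewrite expr2 (le_trans _ (ltW x1)) // ler_piMr ?(ltW x0) //.
    by rewrite ltW // (lt_trans x1).
have S_ge (r : R) : rho <= r < 1 -> 2 * kap <= S r.
  move=> /andP[r0 r1]; apply: le_trans S_rho _.
  have := @derive_le R (fun=> 0) S (fun=> 0) dS rho r r0.
  rewrite subr0 => h; rewrite -subr_ge0; apply: h.
  - move=> x /andP[x0 x1]; apply: HS.
    by rewrite (le_trans (ltW rho0)) //= (le_lt_trans x1).
  - move=> x /andP[x0 x1].
    have x0' : 0 <= x by rewrite ltW // (lt_trans rho0).
    apply: le_trans (dS_ge x _); last by rewrite x0' (lt_trans x1).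
    by rewrite (mulr_ge0 (exprn_ge0 _ x0') (sqr_ge0 _)).
have F_ge (r : R) : rho <= r < 1 -> kap <= F r.
  move=> /[dup] r01 /andP[r0 r1]; have := S_ge r r01; rewrite /S.
  have r2 : 0 <= r ^+ 2 < 1 by apply: sq01; rewrite r1 (le_trans (ltW rho0)).
  have : C * eta * Ell (r ^+ 2) <= C * eta * 1.
    by rewrite (ler_wpM2l (mulr_ge0 C0 eta0)) // Ell_le1.
  by lra.
have cF : F @ 1^'- --> k * (- (u mu1 gam 1 * W mu2 gam)).
  by apply: cvgZr; exact: wronsk_left1.
exists (k * (- (u mu1 gam 1 * W mu2 gam))); last by rewrite /k mulrA mulfV // mul1r.
rewrite -(cvg_lim _ cF) //; apply: limr_ge; first by apply: cvgP cF.
near=> r; apply: F_ge; apply/andP; split.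
  by near: r; apply: nbhs_left_ge.
by near: r; exact: nbhs_left_lt.
Unshelve. all: by end_near. Qed.

End Overlap.

(** Two distinct zeros would have orthogonal eigenfunctions, against the positive overlap near (mu0,
    gam0). *)
Lemma frobW_zero_unique mu0 gam0 : W mu0 gam0 = 0 -> exists2 delta : R, 0 < delta &
  forall mu1 mu2 gam, `|mu1 - mu0| < delta -> `|mu2 - mu0| < delta ->
    `|gam - gam0| < delta -> W mu1 gam = 0 -> W mu2 gam = 0 -> mu1 = mu2.
Proof.
move=> W0; have [kap [del [kap0 del0 H]]] := frob_overlap W0.
exists del => // mu1 mu2 gam h1 h2 hg W1 W2.
apply/eqP/negPn/negP => neq; have [I kI] := H _ _ _ h1 h2 hg W1 neq.
rewrite W2 mulr0 oppr0 => /esym/eqP; apply/negP.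
have I0 : I != 0 by rewrite gt_eqF // (lt_le_trans kap0).
have m0 : mu2 - mu1 != 0 by rewrite subr_eq0 eq_sym.
by rewrite mulf_neq0 // mulf_neq0 // invr_eq0 pnatr_eq0.
Qed.

Lemma frobW_dist M mu gam mu' gam' : `|mu| + `|gam| <= M -> `|mu'| + `|gam'| <= M ->
  `|W mu gam - W mu' gam'| <= frob_lip M * (`|mu - mu'| + `|gam - gam'|).
Proof. exact: frobW_lip. Qed.

Lemma frobW_close mu0 gam0 (e : R) : 0 < e -> exists2 delta : R, 0 < delta &
  forall mu gam, `|mu - mu0| < delta -> `|gam - gam0| < delta ->
    `|W mu gam - W mu0 gam0| < e.
Proof.
move=> e0; pose M := `|mu0| + `|gam0| + 2.
have m0 : `|mu0| + `|gam0| <= M by rewrite /M lerDl.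
have lip0 : 0 <= frob_lip M := frob_lip_ge0 m0.
have l0 : 0 < 2 * (frob_lip M + 1) by rewrite mulr_gt0 ?ltr0n // ltr_wpDl.
exists (Num.min 1 (e / (2 * (frob_lip M + 1)))); first by rewrite lt_min ltr01 divr_gt0.
move=> mu gam; rewrite !lt_min => /andP[h1 h2] /andP[h3 h4].
have mM : `|mu| + `|gam| <= M.
  have := ler_normD (mu - mu0) mu0; have := ler_normD (gam - gam0) gam0.
  by rewrite !subrK /M; lra.
apply: le_lt_trans (frobW_dist mM m0) _.
move: h2 h4; rewrite !ltr_pdivlMr // => h2 h4.
have : 0 <= `|mu - mu0| + `|gam - gam0| by rewrite addr_ge0.
by move: h2 h4; rewrite mulrDl mulrDr; lra.
Qed.

Lemma frobW_continuous gam : continuous (W^~ gam).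
Proof.
move=> mu; apply/cvgrPdist_lt => e e0.
have [del del0 H] := frobW_close mu gam e0.
exists del => // y /= hy; rewrite distrC; apply: H; first by rewrite distrC.
by rewrite subrr normr0.
Qed.

(** The overlap identity with mu1 = mu0 and mu2 = mu0 + h or mu0 - h shows that W(., gam0) has
    opposite signs at these two points. The sign change survives a small change of gam, and the
    intermediate value theorem gives a zero between them. *)
Lemma frobW_zero_exists mu0 gam0 (e : R) : W mu0 gam0 = 0 -> 0 < e ->
  exists2 delta : R, 0 < delta & forall gam, `|gam - gam0| < delta ->
    exists2 mu, `|mu - mu0| < e & W mu gam = 0.
Proof.
move=> W0 e0; have [kap [del [kap0 del0 H]]] := frob_overlap W0.
pose h := Num.min (e / 2) (del / 2).
have h0 : 0 < h by rewrite lt_min !divr_gt0.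
have he : h < e.
  by apply: le_lt_trans (_ : e / 2 < e); [rewrite ge_min lexx|lra].
have hd : h < del.
  by apply: le_lt_trans (_ : del / 2 < del); [rewrite ge_min lexx orbT|lra].
have val mu2 : `|mu2 - mu0| = h -> exists2 I, kap <= I &
    - (u mu0 gam0 1 * W mu2 gam0) = 2^-1 * (mu2 - mu0) * I.
  move=> E; apply: H => //; rewrite ?subrr ?normr0 ?E //.
  by apply/eqP => m; move: E h0; rewrite m subrr normr0 => <-; rewrite ltxx.
have [|I1 kI1 E1] := val (mu0 + h); first by rewrite [mu0 + h]addrC addrK gtr0_norm.
have [|I2 kI2 E2] := val (mu0 - h); first by rewrite [mu0 - h]addrC addrK normrN gtr0_norm.
have I10 : 0 < I1 by apply: lt_le_trans kI1.
have I20 : 0 < I2 by apply: lt_le_trans kI2.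
rewrite (_ : mu0 + h - mu0 = h) in E1; last by ring.
rewrite (_ : mu0 - h - mu0 = - h) in E2; last by ring.
have S : W (mu0 + h) gam0 * W (mu0 - h) gam0 < 0.
  have P1 : 0 < 2^-1 * h * I1 by rewrite !mulr_gt0 ?invr_gt0 ?ltr0n.
  have P2 : 0 < 2^-1 * h * I2 by rewrite !mulr_gt0 ?invr_gt0 ?ltr0n.
  set c := u mu0 gam0 1 in E1 E2.
  have c20 : 0 < c ^+ 2.
    rewrite lt_neqAle sqr_ge0 andbT eq_sym expf_neq0 //.
    by apply/eqP => c0; move: P1; rewrite -E1 c0 mul0r oppr0 ltxx.
  rewrite -(pmulr_rlt0 _ c20).
  have -> : c ^+ 2 * (W (mu0 + h) gam0 * W (mu0 - h) gam0) =
     (- (c * W (mu0 + h) gam0)) * (- (c * W (mu0 - h) gam0)) by ring.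
  rewrite E1 E2.
  have -> : 2^-1 * h * I1 * (2^-1 * - h * I2) = - ((2^-1 * h * I1) * (2^-1 * h * I2)) by ring.
  by rewrite oppr_lt0 mulr_gt0.
have n1 : 0 < `|W (mu0 + h) gam0|.
  by rewrite normr_gt0; apply/eqP => w; move: S; rewrite w mul0r ltxx.
have n2 : 0 < `|W (mu0 - h) gam0|.
  by rewrite normr_gt0; apply/eqP => w; move: S; rewrite w mulr0 ltxx.
have [d1 d10 H1] := frobW_close (mu0 + h) gam0 n1.
have [d2 d20 H2] := frobW_close (mu0 - h) gam0 n2.
exists (Num.min d1 d2); first by rewrite lt_min d10.
move=> gam; rewrite lt_min => /andP[g1 g2].
have {}H1 := H1 (mu0 + h) gam; have {}H2 := H2 (mu0 - h) gam.
move: H1 H2; rewrite !subrr !normr0 => /(_ d10 g1) H1 /(_ d20 g2) H2.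
have L : mu0 - h <= mu0 + h by lra.
have [||c] := @IVT R (W^~ gam) (mu0 - h) (mu0 + h) 0 L.
- by apply: continuous_subspaceT; exact: frobW_continuous.
- move: S H1 H2; move: (W (mu0 + h) gam0) (W (mu0 - h) gam0) => x y.
  move: (W (mu0 + h) gam) (W (mu0 - h) gam) => x' y' S H1 H2.
  rewrite ge_min le_max.
  case: (ltP 0 x) => x0.
    have y0 : y < 0 by rewrite pmulr_rlt0 in S.
    move: H1 H2; rewrite (gtr0_norm x0) (ltr0_norm y0) !ltr_norml.
    move=> /andP[a1 a2] /andP[a3 a4].
    by apply/andP; split; apply/orP; [left|right]; lra.
  have x0' : x < 0.
    by rewrite lt_neqAle x0 andbT; apply/eqP => x00; move: S; rewrite x00 mul0r ltxx.
  have y0 : 0 < y by rewrite nmulr_rlt0 in S.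
  move: H1 H2; rewrite (gtr0_norm y0) (ltr0_norm x0') !ltr_norml.
  move=> /andP[a1 a2] /andP[a3 a4].
  by apply/andP; split; apply/orP; [right|left]; lra.
rewrite in_itv /= => /andP[c1 c2] Wc; exists c => //.
by apply: le_lt_trans he; rewrite ler_norml; apply/andP; split; lra.
Qed.

(** * Continuity of the N-th zero *)

Section ZeroBranch.
Variables (gam0 : R) (gamF : set R) (z : R -> nat -> R).
Hypothesis gam0_in : gamF gam0.
Hypothesis gam_gt0 : forall gam, gamF gam -> 0 < gam.
Hypothesis z_incr : forall gam, gamF gam -> {homo z gam : i j / (i < j)%N >-> i < j}.
Hypothesis zP : forall gam, gamF gam -> forall mu, W mu gam = 0 <-> exists N, mu = z gam N.

Lemma zero_branch_close N (e : R) : 0 < e -> exists2 delta : R, 0 < delta &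
  forall gam, gamF gam -> `|gam - gam0| < delta -> `|z gam N - z gam0 N| < e.
Proof.
have zW gam i : gamF gam -> W (z gam i) gam = 0 by move=> g; apply/(zP g); exists i.
have mono gam i j : gamF gam -> (i <= j)%N -> z gam i <= z gam j.
  move=> g; rewrite leq_eqVlt => /predU1P[->//|ij]; exact: ltW (z_incr g ij).
have incr gam i j : gamF gam -> z gam i < z gam j -> (i < j)%N.
  by move=> g ij; rewrite ltnNge; apply/negP => /(mono _ _ _ g); rewrite leNgt ij.
elim/ltn_ind: N e => N IH e e0.
(* Upper bound: a zero persists near the N-th zero of gam0. For N > 0, halving the gap to the
   preceding zero keeps it above the preceding zero of gam, so its rank is at least N. *)
have [d1 d10 H1] : exists2 delta : R, 0 < delta & forall gam, gamF gam ->
    `|gam - gam0| < delta -> z gam N < z gam0 N + e.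
  case: N IH => [|N] IH.
    have [del del0 H] := frobW_zero_exists (zW _ 0%N gam0_in) e0.
    exists del => // gam g /H [mu muz /(zP g)[i E]].
    apply: le_lt_trans (mono _ _ _ g (leq0n i)) _; rewrite -E.
    by move: muz; rewrite ltr_norml => /andP[_]; lra.
  pose h := (z gam0 N.+1 - z gam0 N) / 2.
  have h0 : 0 < h by rewrite divr_gt0 ?ltr0n // subr_gt0 (z_incr gam0_in).
  have eh0 : 0 < Num.min e h by rewrite lt_min e0.
  have [del del0 H] := frobW_zero_exists (zW _ N.+1 gam0_in) eh0.
  have [del' del0' H'] := IH N (ltnSn N) h h0.
  exists (Num.min del del'); first by rewrite lt_min del0.
  move=> gam g; rewrite lt_min => /andP[/H [mu muz /(zP g)[i E]] g2].
  have := H' gam g g2; rewrite ltr_norml => /andP[_ z1].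
  move: muz; rewrite lt_min !ltr_norml => /andP[/andP[_ m1] /andP[m2 _]].
  have Ni : (N < i)%N by apply: (incr gam) => //; rewrite -E; move: z1 m2; rewrite /h; lra.
  by apply: le_lt_trans (mono _ _ _ g Ni) _; rewrite -E; lra.
(* Lower bound: zeros are positive, so it is enough to keep [z gam N] out of the segment
   [0, z gam0 N - e]. By compactness this is a local question at each point p of it. *)
have [d2 d20 H2] : exists2 delta : R, 0 < delta & forall gam, gamF gam ->
    `|gam - gam0| < delta -> z gam0 N - e < z gam N.
  pose K := `[0, z gam0 N - e]%classic : set R.
  have cK : compact K by exact: segment_compact.
  have := (compact_near_coveringP K).1 cK R (within gamF (nbhs gam0))
    (fun gam p => z gam N <> p) _.
  case=> [p Kp|del /= del0 H].
    have : exists2 delta : R, 0 < delta & forall gam mu, gamF gam ->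
        `|gam - gam0| < delta -> `|mu - p| < delta -> z gam N <> mu.
      (* If W(p, gam0) = 0 then p is a zero of smaller rank i. By induction [z gam i] stays near p,
         and local uniqueness forbids [z gam N] to join it. Otherwise W stays nonzero near p. *)
      have [Wp|Wp] := eqVneq (W p gam0) 0.
        have [i E] := (zP gam0_in p).1 Wp.
        have iN : (i < N)%N.
          apply: (incr gam0) => //; rewrite -E.
          by move: Kp; rewrite /K /= in_itv /= => /andP[_]; lra.
        have [del del0 H] := frobW_zero_unique Wp.
        have [del' del0' H'] := IH i iN del del0.
        exists (Num.min del del'); first by rewrite lt_min del0.
        move=> gam mu g; rewrite !lt_min => /andP[g1 g2] /andP[m1 _] zmu.
        have zz : z gam i = z gam N.
          apply: (H _ _ gam) => //; [by rewrite E; apply: H'|by rewrite zmu|exact: zW|exact: zW].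
        by have := z_incr g iN; rewrite zz ltxx.
      have n0 : 0 < `|W p gam0| by rewrite normr_gt0.
      have [del del0 H] := frobW_close p gam0 n0.
      exists del => // gam mu g hg hmu zmu; have := H mu gam hmu hg.
      by rewrite -zmu zW // sub0r normrN ltxx.
    move=> [del del0 H].
    exists ([set y | `|y - p| < del], [set g | gamF g /\ `|g - gam0| < del]).
      split; first by exists del => // y /=; rewrite distrC.
      by exists del => // y /= hy g; split=> //; rewrite distrC.
    by case=> mu gam /= [hmu [g hg]]; exact: H.
  exists del => // gam g hg; rewrite ltNge; apply/negP => zl.
  apply: (H gam _ g (z gam N)) => //; first by rewrite /= distrC.
  rewrite /K /= in_itv /= zl andbT ltW // ltNge; apply/negP => zneg.
  by have := frobW_gt0 d_ge2 zneg (gam_gt0 g); rewrite zW // ltxx.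
exists (Num.min d1 d2); first by rewrite lt_min d10.
move=> gam g; rewrite lt_min => /andP[g1 g2].
by have := H1 gam g g1; have := H2 gam g g2; rewrite ltr_norml => h1 h2; apply/andP; split; lra.
Qed.
End ZeroBranch.

(** * Solutions smooth on [0, 1] are multiples of u *)

Section Eigenfunction.
Variables (mu gam : R) (P P1 P2 : R -> R).
Hypothesis dP : forall t : R, is_derive t 1 P (P1 t).
Hypothesis dP1 : forall t : R, is_derive t 1 P1 (P2 t).
Hypothesis odeP : forall t : R, 0 < t < 1 -> sl_ode d mu gam t (P t) (P1 t) (P2 t).
Hypothesis Pnz : exists2 t, 0 <= t <= 1 & P t != 0.

Lemma eigen_sub t : 0 <= t < 1 ->
  P t = P 0 * u mu gam t /\ (0 < t -> P1 t = P 0 * frobdu d mu gam t).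
Proof.
move=> t01.
have p := pbounded_frob d_ge2 mu gam.
have nt s : 0 <= s < 1 -> `|s| < 1 :> R by move=> /andP[s0 s1]; rewrite ger0_norm.
have [||||E1 E2] := @sl_unique R d d_ge2 mu gam (fun s => P s - P 0 * u mu gam s)
  (fun s => P1 s - P 0 * frobdu d mu gam s)
  (fun s => P2 s - P 0 * frobddu d mu gam s) _ _ _ _ t t01.
- by move=> s s01; apply: is_deriveB1 => //; apply: is_deriveZ1; exact: frobu_derive p (nt s s01).
- by move=> s s01; apply: is_deriveB1 => //; apply: is_deriveZ1; exact: frobdu_derive p (nt s s01).
- move=> s s01; have := odeP s01.
  have := frobu_ode d_ge2 p (nt s _); rewrite ltW ?(andP s01).1 //= => /(_ (andP s01).2).
  rewrite /sl_ode; move: (u _ _ _) (frobdu _ _ _ _) (frobddu _ _ _ _) => v0 v1 v2 h1 h2.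
  rewrite (mulrBr mu) -h2 (_ : mu * (P 0 * v0) = P 0 * (mu * v0)); last by ring.
  by rewrite -h1; ring.
- by rewrite frobu0 mulr1 subrr.
split; first by apply/eqP; rewrite -subr_eq0 E1.
by move=> t0; apply/eqP; rewrite -subr_eq0 E2.
Qed.

Lemma eigen_neq0 : P 0 != 0.
Proof.
apply/eqP => P00; case: Pnz => t /andP[t0 t1] /eqP; apply.
have z s : 0 <= s < 1 -> P s = 0 by move=> /eigen_sub [-> _]; rewrite P00 mul0r.
move: t1; rewrite le_eqVlt => /predU1P[->|t1]; last by apply: z; rewrite t0.
have c : P @ 1^'- --> P 1.
  by apply: cvg_at_left_filter; exact: is_derive_continuous (dP 1).
have c0 : P @ 1^'- --> (0 : R).
  apply: cvg_near_cst; near=> s; apply: z; apply/andP; split.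
    by near: s; exact: nbhs_left_ge.
  by near: s; exact: nbhs_left_lt.
by rewrite -(cvg_lim _ c) // (cvg_lim _ c0).
Unshelve. all: by end_near. Qed.

(** On (0, 1), P' = P(0) u' with P(0) nonzero. Continuity of P' at 1 sends (1 - t) P' to 0, whereas
    (1 - t) u' tends to W. *)
Lemma eigen_frobW0 : W mu gam = 0.
Proof.
have c := @frobdu_left1 R d d_ge2 mu gam.
have c0 : (fun t : R => (1 - t) * ((P 0)^-1 * P1 t)) @ 1^'- --> (0 : R).
  suff : (fun t : R => (1 - t) * ((P 0)^-1 * P1 t)) @ 1^'- --> (1 - 1) * ((P 0)^-1 * P1 1).
    by rewrite subrr mul0r.
  apply: cvgM.
    apply: cvgB; first exact: cvg_cst.
    by apply: cvg_at_left_filter; exact: cvg_id.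
  by apply: cvgZr; apply: cvg_at_left_filter; exact: is_derive_continuous (dP1 1).
rewrite -(cvg_lim _ c) // -(cvg_lim _ c0) //; congr (lim _).
apply/seteqP; split; apply: near_eq_cvg; near=> t.
all: have t0 : 0 < t by near: t; exact: nbhs_left_gt.
all: have t1 : t < 1 by near: t; exact: nbhs_left_lt.
all: have [_ /(_ t0) ->] : P t = P 0 * u mu gam t /\ (0 < t -> P1 t = P 0 * frobdu d mu gam t)
  by apply: eigen_sub; rewrite ltW.
all: by rewrite mulKf // eigen_neq0.
Unshelve. all: by end_near. Qed.

Lemma eigen_eq (t : R) : 0 <= t <= 1 -> P t = P 0 * u mu gam t.
Proof.
move=> /andP[t0]; rewrite le_eqVlt => /predU1P[->|t1]; last first.
  by have [] := @eigen_sub t; rewrite ?t0.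
have o2 : `|1 : R| < 2 by rewrite normr1 ltr1n.
have c1 : P @ 1^'- --> P 1.
  by apply: cvg_at_left_filter; exact: is_derive_continuous (dP 1).
have c2 : (fun t => P 0 * u mu gam t) @ 1^'- --> P 0 * u mu gam 1.
  apply: cvgZr; apply: cvg_at_left_filter.
  exact: is_derive_continuous (frobu_derive (pentire_frob d_ge2 eigen_frobW0 (r := 2)) o2).
rewrite -(cvg_lim _ c1) // -(cvg_lim _ c2) //; congr (lim _).
apply/seteqP; split; apply: near_eq_cvg; near=> s.
all: have s0 : 0 <= s by near: s; exact: nbhs_left_ge.
all: have s1 : s < 1 by near: s; exact: nbhs_left_lt.
all: by have [] := @eigen_sub s; rewrite ?s0.
Unshelve. all: by end_near. Qed.

End Eigenfunction.
End Zeros.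

(** * Clifford calculus *)

Section CliffordCalculus.
Variables (R : realType) (m : nat).
Local Notation Rm := 'rV[R]_m.
Local Notation Cl := (cliff R m).
Implicit Types (x y v : Rm) (j : 'I_m).

(** [dirac_op] sees directional derivatives only, but the chain rule through |x|^2 and Euler's
    identity need the full differential, so both are kept together. *)
Definition has_diff (f : Rm -> R) x (l : Rm -> R) :=
  differentiable f x /\ forall v, 'D_v f x = l v.

Lemma has_diff_eq f x l l' : has_diff f x l -> l =1 l' -> has_diff f x l'.
Proof. by move=> [fx fl] ll; split=> // v; rewrite fl ll. Qed.

Lemma has_diff_cst (a : R) x : has_diff (fun=> a) x (fun=> 0).
Proof.
split; first exact: differentiable_cst.
by move=> v; have := is_derive_cst a x v; case.
Qed.

Lemma has_diffD f g x l k : has_diff f x l -> has_diff g x k ->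
  has_diff (fun y => f y + g y) x (fun v => l v + k v).
Proof.
move=> [fx fl] [gx gk]; split; first exact: differentiableD.
by move=> v; rewrite -fl -gk; apply: deriveD; exact: diff_derivable.
Qed.

Lemma has_diffM f g x l k : has_diff f x l -> has_diff g x k ->
  has_diff (fun y => f y * g y) x (fun v => f x * k v + g x * l v).
Proof.
move=> [fx fl] [gx gk]; split; first exact: differentiableM.
by move=> v; rewrite -fl -gk; apply: deriveM; exact: diff_derivable.
Qed.

Lemma has_diffZ (a : R) f x l : has_diff f x l ->
  has_diff (fun y => a * f y) x (fun v => a * l v).
Proof.
move=> H; apply: has_diff_eq (has_diffM (has_diff_cst a x) H) _ => v /=.
by rewrite mulr0 addr0.
Qed.

Lemma has_diff_sum (I : Type) (s : seq I) (P : pred I) (f : I -> Rm -> R) x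
    (l : I -> Rm -> R) : (forall i, P i -> has_diff (f i) x (l i)) ->
  has_diff (fun y => \sum_(i <- s | P i) f i y) x
    (fun v => \sum_(i <- s | P i) l i v).
Proof.
move=> H; elim: s => [|i s IH].
  have -> : (fun y => \sum_(i <- [::] | P i) f i y) = fun=> 0.
    by apply/funext => y; rewrite big_nil.
  by apply: has_diff_eq (has_diff_cst 0 x) _ => v; rewrite big_nil.
have -> : (fun y => \sum_(j <- i :: s | P j) f j y) =
   (fun y => (if P i then f i y else 0) + \sum_(j <- s | P j) f j y).
  by apply/funext => y; rewrite big_cons; case: (P i); rewrite ?add0r.
apply: has_diff_eq (_ : has_diff _ _ (fun v => (if P i then l i v else 0) + \sum_(j <- s | P j) l j v)) _.
  apply: (@has_diffD _ _ _ (fun v => if P i then l i v else 0)) => //.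
  by case Pi: (P i); [exact: H|exact: has_diff_cst].
by move=> v; rewrite big_cons; case: (P i); rewrite ?add0r.
Qed.

Lemma has_diff_coord j x : has_diff (fun y => y 0 j) x (fun v => v 0 j).
Proof.
split; first exact: differentiable_coord.
move=> v; apply: cvg_lim => //; apply: cvg_near_cst.
near=> h => /=; rewrite !mxE addrK /GRing.scale /= mulKf //.
by near: h; exact: nbhs_dnbhs_neq.
Unshelve. all: by end_near. Qed.

Lemma has_diff_comp (P : R -> R) (f : Rm -> R) x l (p : R) : is_derive (f x) 1 P p ->
  has_diff f x l -> has_diff (fun y => P (f y)) x (fun v => p * l v).
Proof.
move=> HP [fx fl].
have dP : differentiable P (f x) by apply/derivable1_diffP; case: HP.
have dPf : differentiable (P \o f) x by exact: differentiable_comp.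
split=> // v; rewrite -fl.
rewrite (_ : (fun y => P (f y)) = P \o f) // deriveE // diff_comp //= [in RHS]deriveE //.
have -> : 'd f x v = ('d f x v) *: (1 : R^o) by rewrite /GRing.scale /= mulr1.
have E : 'd P (f x) 1 = p by rewrite -deriveE //; case: HP.
by rewrite linearZ /= E /GRing.scale /= mulr1 mulrC.
Qed.

Definition chas_diff (f : Rm -> Cl) x (L : Rm -> Cl) :=
  forall A, has_diff (fun y => f y A) x (fun v => L v A).

Lemma chas_diff_partial f x L j : chas_diff f x L -> cl_partial j f x = L (delta_mx 0 j).
Proof. by move=> H; apply/ffunP => A; rewrite ffunE (H A).2. Qed.

Lemma chas_diff_dirac f x L : chas_diff f x L ->
  dirac_op f x = \sum_j cl_gen R j * L (delta_mx 0 j).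
Proof.
by move=> H; apply: eq_bigr => j _; rewrite (chas_diff_partial _ H).
Qed.

Lemma chas_diff_eq f x L L' : chas_diff f x L -> L =1 L' -> chas_diff f x L'.
Proof. by move=> H LL A; apply: has_diff_eq (H A) _ => v; rewrite LL. Qed.

Lemma chas_diff_scale (h : Rm -> R) f x l L : has_diff h x l -> chas_diff f x L ->
  chas_diff (fun y => h y *: f y) x (fun v => l v *: f x + h x *: L v).
Proof.
move=> hl fL A.
have -> : (fun y => (h y *: f y) A) = (fun y => h y * f y A).
  by apply/funext => y; rewrite cl_scaleE.
apply: has_diff_eq (has_diffM hl (fL A)) _ => v.
by rewrite ffunE !cl_scaleE addrC mulrC.
Qed.

Lemma chas_diff_mull (a : Cl) f x L : chas_diff f x L ->
  chas_diff (fun y => a * f y) x (fun v => a * L v).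
Proof.
move=> fL A.
have -> : (fun y => (a * f y) A) =
   (fun y => \sum_B cl_sign R B (symdiff B A) * a B * f y (symdiff B A)).
  by apply/funext => y; rewrite [LHS]cl_mulE.
apply: has_diff_eq (has_diff_sum _ _) _.
  by move=> B _; apply: has_diffZ; exact: fL.
by move=> v /=; rewrite [RHS]cl_mulE.
Qed.

Lemma chas_diff_sum (f : 'I_m -> Rm -> Cl) x (L : 'I_m -> Rm -> Cl) :
  (forall i, chas_diff (f i) x (L i)) ->
  chas_diff (fun y => \sum_i f i y) x (fun v => \sum_i L i v).
Proof.
move=> H A.
have -> : (fun y => (\sum_i f i y) A) = (fun y => \sum_i f i y A).
  by apply/funext => y; rewrite sum_ffunE.
apply: has_diff_eq (has_diff_sum _ _) _; first by move=> i _; exact: H.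
by move=> v /=; rewrite sum_ffunE.
Qed.

Lemma cl_vec_mul x (a : Cl) : cl_vec x * a = \sum_j x 0 j *: (cl_gen R j * a).
Proof. by rewrite mulr_suml; apply: eq_bigr => j _; rewrite -scalerAl. Qed.

Lemma chas_diff_vec f x L : chas_diff f x L ->
  chas_diff (fun y => cl_vec y * f y) x (fun v => cl_vec v * f x + cl_vec x * L v).
Proof.
move=> fL.
have -> : (fun y => cl_vec y * f y) = (fun y => \sum_j y 0 j *: (cl_gen R j * f y)).
  by apply/funext => y; exact: cl_vec_mul.
apply: chas_diff_eq (chas_diff_sum _) _.
  by move=> j; apply: chas_diff_scale (has_diff_coord j x) (chas_diff_mull _ fL).
by move=> v /=; rewrite big_split /= !cl_vec_mul.
Qed.

Lemma delta_coord i j : (delta_mx 0 j : Rm) 0 i = (i == j)%:R.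
Proof. by rewrite mxE eqxx eq_sym. Qed.

Lemma cl_vec_delta j : cl_vec (delta_mx 0 j : Rm) = cl_gen R j.
Proof.
rewrite /cl_vec (bigD1 j) //= delta_coord eqxx scale1r big1 ?addr0 // => i ij.
by rewrite delta_coord (negPf ij) scale0r.
Qed.

Lemma cl_gen_vec j x :
  cl_gen R j * cl_vec x = - (cl_vec x * cl_gen R j) - (2 * x 0 j)%:A.
Proof.
have E i : cl_gen R j * (x 0 i *: cl_gen R i) + x 0 i *: cl_gen R i * cl_gen R j =
    - (if i == j then (2 * x 0 j)%:A else 0).
  rewrite -scalerAr -scalerAl -scalerDr; case: eqP => [->|/eqP ij].
    by rewrite cl_gen_sqr -opprD scalerN -mulr2n -scaler_nat scalerA mulrC.
  by rewrite (cl_gen_anticomm _ ij) subrr scaler0 oppr0.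
apply/eqP; rewrite -subr_eq0 opprB opprK.
rewrite /cl_vec mulr_sumr mulr_suml addrA addrAC -big_split /=.
under eq_bigr do rewrite E.
by rewrite sumrN -big_mkcond big_pred1_eq addNr.
Qed.

(** Moving one factor through the other by [cl_gen_vec] gives x^2 = -x^2 - 2|x|^2, without splitting
    a double sum. *)
Lemma cl_vec_sqr x : cl_vec x * cl_vec x = - (sqnorm x)%:A.
Proof.
have E : cl_vec x * cl_vec x = - (cl_vec x * cl_vec x) - (2 * sqnorm x)%:A.
  rewrite {1}cl_vec_mul; under eq_bigr do rewrite cl_gen_vec scalerBr scalerN scalerA.
  rewrite big_split /= !sumrN mulr_sumr.
  congr (- _ - _); first by apply: eq_bigr => j _; rewrite -scalerAr.
  rewrite -scaler_suml; congr (_ *: _); rewrite /sqnorm /dotp mulr_sumr.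
  by apply: eq_bigr => j _; ring.
have : 2%:R *: (cl_vec x * cl_vec x) = - (2 * sqnorm x)%:A.
  by rewrite scaler_nat mulr2n {1}E addrAC addNr add0r.
move=> /(congr1 (fun a => 2^-1 *: a)).
by rewrite scalerN !scalerA mulrA mulVf ?pnatr_eq0 // mul1r scale1r.
Qed.

Lemma cl_vec_vec x (a : Cl) : cl_vec x * (cl_vec x * a) = - (sqnorm x *: a).
Proof. by rewrite mulrA cl_vec_sqr mulNr -scalerAl mul1r. Qed.

Lemma sqnorm_ge0 x : 0 <= sqnorm x.
Proof. by apply: sumr_ge0 => j _; rewrite -expr2 sqr_ge0. Qed.

Lemma sqnorm_eq0 x : (sqnorm x == 0) = (x == 0).
Proof.
rewrite /sqnorm /dotp psumr_eq0; last by move=> j _; rewrite -expr2 sqr_ge0.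
apply/allP/eqP => [H|-> j _]; last by rewrite mxE mulr0 eqxx.
apply/rowP => j; rewrite mxE; have := H j (mem_index_enum _).
by rewrite /= -expr2 sqrf_eq0 => /eqP.
Qed.

Lemma sqnormZ (s : R) x : sqnorm (s *: x) = s ^+ 2 * sqnorm x.
Proof.
rewrite /sqnorm /dotp mulr_sumr; apply: eq_bigr => j _; rewrite !mxE; ring.
Qed.

Lemma has_diff_sqnorm x : has_diff (@sqnorm R m) x (fun v => 2 * dotp x v).
Proof.
apply: has_diff_eq (has_diff_sum _ _) _.
  by move=> j _; exact: has_diffM (has_diff_coord j x) (has_diff_coord j x).
move=> v; rewrite mulr_sumr; apply: eq_bigr => j _; ring.
Qed.

Lemma dotp_delta x j : dotp x (delta_mx 0 j) = x 0 j.
Proof.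
rewrite /dotp (bigD1 j) //= delta_coord eqxx mulr1 big1 ?addr0 // => i ij.
by rewrite delta_coord (negPf ij) mulr0.
Qed.

Lemma dirac_radial (P : R -> R) (p : R) f x L : is_derive (sqnorm x) 1 P p ->
  chas_diff f x L -> dirac_op (fun y => P (sqnorm y) *: f y) x =
    (2 * p) *: (cl_vec x * f x) + P (sqnorm x) *: dirac_op f x.
Proof.
move=> HP fL; rewrite (chas_diff_dirac (chas_diff_scale (has_diff_comp HP (has_diff_sqnorm x)) fL)).
rewrite (chas_diff_dirac fL) cl_vec_mul !scaler_sumr -big_split /=.
apply: eq_bigr => j _; rewrite dotp_delta mulrDr -(scalerAr (p * _)) -(scalerAr (P _)); congr (_ + _).
by rewrite [RHS]scalerA; congr (_ *: _); ring.
Qed.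

(** * Homogeneous monogenic polynomials and the radial form of L_c *)

Section Monogenic.
Variables (k : nat) (Y : Rm -> Cl).
Hypothesis YP : monogenic_poly k Y.

Lemma homog_scale (s : R) x : Y (s *: x) = s ^+ k *: Y x.
Proof.
case: YP => -[a Ya] _; rewrite !Ya scaler_sumr; apply: eq_bigr => al /eqP alk.
rewrite scalerA; have -> : s ^+ k = \prod_j s ^+ al j by rewrite prodrXr alk.
rewrite -big_split /=; congr (_ *: _).
by apply: eq_bigr => j _; rewrite mxE exprMn.
Qed.

Lemma homog_chas_diff x : exists L, chas_diff Y x L.
Proof.
case: YP => -[a Ya] _.
exists (fun v => [ffun A => 'D_v (fun y => Y y A) x]) => A.
suff : exists l, has_diff (fun y => Y y A) x l.
  by move=> [l [H _]]; split=> // v; rewrite ffunE.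
have -> : (fun y => Y y A) = (fun y => \sum_(al : {ffun 'I_m -> 'I_k.+1} | (\sum_j al j)%N == k)
      (\prod_j y 0 j ^+ al j) * a al A).
  by apply/funext => y; rewrite Ya sum_ffunE; apply: eq_bigr => al _; rewrite cl_scaleE.
have pw (j : 'I_m) n : exists l, has_diff (fun y => y 0 j ^+ n) x l.
  elim: n => [|n [l IH]]; first by exists (fun=> 0); exact: has_diff_cst.
  by eexists; under eq_fun do rewrite exprS; apply: has_diffM (has_diff_coord j x) IH.
have pr (al : {ffun 'I_m -> 'I_k.+1}) s :
    exists l, has_diff (fun y => \prod_(j <- s) y 0 j ^+ al j) x l.
  elim: s => [|j s [l IH]].
    by exists (fun=> 0); under eq_fun do rewrite big_nil; exact: has_diff_cst.
  have [l' H'] := pw j (al j).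
  by eexists; under eq_fun do rewrite big_cons; apply: has_diffM H' IH.
have /choice[l Hl] : forall al : {ffun 'I_m -> 'I_k.+1}, exists l,
    has_diff (fun y => (\prod_j y 0 j ^+ al j) * a al A) x l.
  move=> al; have [l Hl] := pr al (index_enum _).
  by eexists; exact: has_diffM Hl (has_diff_cst (a al A) x).
by eexists; apply: has_diff_sum => al _; exact: Hl.
Qed.

(** The left side is the derivative of Y in direction x, that is, of s -> Y(s x) = s^k Y(x) at s =
    1. *)
Lemma euler_homog x L : chas_diff Y x L -> \sum_j x 0 j *: L (delta_mx 0 j) = k%:R *: Y x.
Proof.
move=> YL; apply/ffunP => A; rewrite sum_ffunE cl_scaleE.
have [dY LY] := YL A.
have -> : \sum_j (x 0 j *: L (delta_mx 0 j)) A = 'D_x (fun y => Y y A) x.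
  rewrite deriveE //.
  transitivity ('d (fun y => Y y A) x (\sum_j x 0 j *: delta_mx 0 j)); last first.
    by rewrite -row_sum_delta.
  rewrite linear_sum /=; by apply: eq_bigr => j _; rewrite cl_scaleE linearZ /= -deriveE // LY.
have H1 : is_derive (1 : R) 1 (fun s : R => Y (s *: x) A) (k%:R * Y x A).
  have -> : (fun s : R => Y (s *: x) A) = (fun s => s ^+ k * Y x A).
    by apply/funext => s; rewrite homog_scale cl_scaleE.
  have h := @is_deriveM1 _ _ (fun=> Y x A) _ _ _ (is_derive_pow 1 k) (is_derive_cst (Y x A) (1 : R) 1).
  apply: is_derive_eq h _.
  by rewrite !expr1n mulr0 add0r mulr1 mulrC.
case: H1 => _ <-.
rewrite /derive.
suff -> : (fun h : R => h^-1 *: (((fun y => Y y A) \o shift x) (h *: x) - Y x A)) =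
    (fun h : R => h^-1 *: (((fun s : R => Y (s *: x) A) \o shift 1) (h *: 1) - Y (1 *: x) A)).
  by [].
apply/funext => h /=.
congr (_ *: (Y _ A - Y _ A)); last by rewrite scale1r.
by rewrite scalerDl scale1r; congr (_ *: _ + _); exact/esym/mulr1.
Qed.

(** The sum of e_j e_j Y gives -m Y. In the sum of e_j x D_j Y, moving e_j past x leaves -x times
    the Dirac derivative of Y, which is 0, and -2 times the Euler operator, which is -2k Y. *)
Lemma dirac_vec_monogenic x : dirac_op (fun y => cl_vec y * Y y) x =
  - (m%:R + 2 * k%:R) *: Y x.
Proof.
have [L YL] := homog_chas_diff x.
rewrite (chas_diff_dirac (chas_diff_vec YL)).
have dY : \sum_j cl_gen R j * L (delta_mx 0 j) = 0.
  by rewrite -(chas_diff_dirac YL); case: YP.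
under eq_bigr => j _.
  rewrite mulrDr cl_vec_delta mulrA cl_gen_sqr mulN1r mulrA cl_gen_vec mulrBl mulNr.
  rewrite -mulrA -scalerAl mul1r -scalerA.
  over.
rewrite big_split /= big_split /= sumr_const card_ord !sumrN -mulr_sumr dY mulr0.
rewrite oppr0 add0r -scaler_sumr (euler_homog YL) scalerA.
by rewrite mulNrn -scaler_nat -opprD -scalerDl scaleNr.
Qed.

(* The shift 2(m + 2k) absorbs the zeroth order term of the odd case. *)
Definition radial_dim (b : bool) : nat := (m + k.*2 + b.*2)%N.
Definition radial_shift (b : bool) : R := if b then 2 * (m + k.*2)%:R else 0.
Definition radial_base (b : bool) x : Cl := (if b then cl_vec x else 1) * Y x.

Lemma radial_formE b (P : R -> R) x :
  radial_form b P Y x = P (sqnorm x) *: radial_base b x.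
Proof. by rewrite /radial_form /radial_base scalerAr. Qed.

(** The Dirac operator exchanges the two families: P Y goes to 2 P' x Y, and x P Y to -(2 t P' + (m
    + 2k) P) Y. Two applications return to the same family; differentiating the second expression
    yields d = m + 2k + 2 and the extra term 2 (m + 2k) P. *)
Lemma Lc_radial b (c : R) (P P1 P2 : R -> R) x :
  (forall t : R, is_derive t 1 P (P1 t)) -> (forall t : R, is_derive t 1 P1 (P2 t)) ->
  let t := sqnorm x in
  Lc c (radial_form b P Y) x =
    (- 4 * t * (1 - t) * P2 t + (4 * t - 2 * (radial_dim b)%:R * (1 - t)) * P1 t
     + 4 * pi ^+ 2 * c ^+ 2 * t * P t + radial_shift b * P t) *: radial_base b x.
Proof.
move=> dP dP1 t; rewrite /Lc radial_formE scalerA.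
rewrite [in RHS]addrAC scalerDl addrC [in RHS]addrC; congr (_ + _).
have D1 (y : R) : is_derive y 1 (fun s : R => 1 - s) (- 1).
  have h := @is_deriveB1 _ (fun=> 1) id _ _ _ (is_derive_cst (1 : R) y 1) (is_derive_id y 1).
  apply: is_derive_eq h _.
  by rewrite sub0r.
have nat2 : (m + k.*2)%:R = m%:R + 2 * k%:R :> R by rewrite natrD -mul2n natrM.
rewrite /radial_form /radial_base /radial_dim /radial_shift; case: b.
- have -> : (fun y => (1 - sqnorm y) *: dirac_op (fun z => cl_vec z * (P (sqnorm z) *: Y z)) y) =
     (fun y => (fun s => - ((1 - s) * (2 * (s * P1 s) + (m%:R + 2 * k%:R) * P s))) (sqnorm y) *: Y y).
    apply/funext => y; have [L YL] := homog_chas_diff y.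
    under eq_fun do rewrite -scalerAr.
    rewrite (dirac_radial (dP _) (chas_diff_vec YL)) dirac_vec_monogenic.
    rewrite cl_vec_vec scalerN !scalerA -scaleNr -scalerDl scalerA.
    by congr (_ *: _); ring.
  have [L YL] := homog_chas_diff x.
  have H := is_deriveZ1 (-1) (is_deriveM1 (D1 t) (is_deriveD1
     (is_deriveZ1 2 (is_deriveM1 (is_derive_id t 1) (dP1 t)))
     (is_deriveZ1 (m%:R + 2 * k%:R) (dP t)))).
  under eq_fun do rewrite -mulN1r.
  rewrite (dirac_radial H YL).
  have -> : dirac_op Y x = 0 by case: YP => _.
  rewrite scaler0 addr0; congr (_ *: _); rewrite -/t.
  have -> : (m + k.*2 + true.*2)%:R = m%:R + 2 * k%:R + 2 :> R by rewrite natrD nat2.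
  by rewrite nat2; ring.
- have -> : (fun y => (1 - sqnorm y) *: dirac_op (fun z => 1 * (P (sqnorm z) *: Y z)) y) =
     (fun y => (fun s => (1 - s) * (2 * P1 s)) (sqnorm y) *: (cl_vec y * Y y)).
    apply/funext => y; have [L YL] := homog_chas_diff y.
    under eq_fun do rewrite mul1r.
    rewrite (dirac_radial (dP _) YL).
    have -> : dirac_op Y y = 0 by case: YP => _.
    by rewrite scaler0 addr0 scalerA.
  have [L YL] := homog_chas_diff x.
  have H := is_deriveM1 (D1 t) (is_deriveZ1 2 (dP1 t)).
  rewrite (dirac_radial H (chas_diff_vec YL)) dirac_vec_monogenic.
  rewrite mul1r cl_vec_vec scalerN !scalerA -scaleNr -scalerDl.
  by congr (_ *: _); rewrite -/t addn0 nat2; ring.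
Qed.

Lemma radial_base_neq0 b x : Y x != 0 -> x != 0 -> radial_base b x != 0.
Proof.
rewrite /radial_base; case: b => Yx x0; last by rewrite mul1r.
apply/eqP => E; move/eqP: Yx; apply.
have : cl_vec x * (cl_vec x * Y x) = 0 by rewrite E mulr0.
rewrite cl_vec_vec => /eqP.
by rewrite oppr_eq0 scaler_eq0 sqnorm_eq0 (negPf x0) => /eqP.
Qed.

End Monogenic.
End CliffordCalculus.

(** * Integration over the ball *)

Section TupleIntegral.
Variable R : realType.

Section Cube.
Variable r : R.

Fixpoint cube n : set (n.-tuple R) :=
  if n is n'.+1 then
    [set t | `[- r, r]%classic (thead t) /\ cube [tuple of behead t]]
  else setT.

Lemma measurable_cube n : measurable (@cube n).
Proof.
elim: n => [|n IH]; first exact: measurableT.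
apply: measurableI.
  by rewrite -[X in measurable X]setTI; apply: measurable_tnth => //; exact: measurable_itv.
by rewrite -[X in measurable X]setTI; apply: measurable_behead.
Qed.

Lemma cube_lty n : (lebesgue_tuple R n (@cube n) < +oo)%E.
Proof.
elim: n => [|n IH].
  by rewrite /= diracE in_setT ltry.
rewrite [X in (X < _)%E](lebesgue_stepE (lebesgue_tuple R n) (measurable_itv _) (@measurable_cube n)).
rewrite lte_mul_pinfty // ?measure_ge0 //.
by rewrite lebesgue_measure_itv /=; case: ifP => _; rewrite ?ltry // -EFinB ltry.
Qed.

Lemma cons_tuple_sum n (f : R -> R) (x : R) (t : n.-tuple R) :
  \sum_(i < n.+1) f (tnth [tuple of x :: t] i) = f x + \sum_(i < n) f (tnth t i).
Proof. by rewrite big_ord_recl tnth0; congr (_ + _); apply: eq_bigr => i _; rewrite tnthS. Qed.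

Lemma sum_sqr_cube n (t : n.-tuple R) : 0 <= r ->
  \sum_i tnth t i ^+ 2 <= r ^+ 2 -> cube t.
Proof.
move=> r0; elim: n t => [//|n IH] t; case/tupleP: t => x t.
rewrite (cons_tuple_sum (fun y => y ^+ 2)) => H.
have s0 : 0 <= \sum_(i < n) tnth t i ^+ 2 by apply: sumr_ge0 => i _; exact: sqr_ge0.
split.
  rewrite /= theadE in_itv /= -ler_norml -(ger0_norm r0) -ler_sqr ?nnegrE //.
  by rewrite !real_normK ?num_real //; lra.
have -> : [tuple of behead [tuple of x :: t]] = t by exact: val_inj.
by apply: IH; have := sqr_ge0 x; lra.
Qed.

End Cube.

(** With the other coordinates fixed, the first one takes at most two values. The slices to measure
    are thus those in the first coordinate, whence the passage to the product measure taken in the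
    other order. *)
Lemma sphere_null_step n (s : R) :
  lebesgue_tuple R n.+1 [set t | \sum_i tnth t i ^+ 2 = s] = 0%E.
Proof.
set A := [set t | _].
have mA : measurable A.
  rewrite -[X in measurable X]setTI.
  rewrite (_ : A = (fun t : n.+1.-tuple R => \sum_i tnth t i ^+ 2) @^-1` [set s]) //.
  by apply: measurable_sum => // i; apply: measurable_funX; exact: measurable_tnth.
have mB : measurable (@cons_tuple_pair R n @^-1` A).
  by rewrite -[X in measurable X]setTI; exact: measurable_cons_tuple_pair.
transitivity ((lebesgue_measure \x lebesgue_tuple R n)%E (@cons_tuple_pair R n @^-1` A)).
  by [].
rewrite (@product_measure_unique _ _ _ _ R _ _ (lebesgue_measure \x^ lebesgue_tuple R n)%E) //; last first.
  by move=> X Y mX mY; exact: product_measure2E.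
apply: integral0_eq => t _ /=.
apply: countable_lebesgue_measure0; apply: finite_set_countable.
apply: (@sub_finite_set _ _ [set Num.sqrt (s - \sum_i tnth t i ^+ 2);
                                 - Num.sqrt (s - \sum_i tnth t i ^+ 2)]); last exact: finite_set2.
move=> x; rewrite /ysection /= inE /A /preimage /= (cons_tuple_sum (fun y => y ^+ 2)) => E.
have -> : s - \sum_i tnth t i ^+ 2 = x ^+ 2 by rewrite -E addrK.
rewrite sqrtr_sqr; case: (ger0P x) => _; [by left|by right; rewrite opprK].
Qed.

Variable m : nat.
Local Notation T := (m.-tuple R).
Local Notation nu := (lebesgue_tuple R m).
Local Notation Rm := 'rV[R]_m.

Definition row_of (t : T) : Rm := \row_j tnth t j.

Lemma measurable_row j : measurable_fun setT (fun t : T => row_of t 0 j).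
Proof. by under eq_fun do rewrite mxE; exact: measurable_tnth. Qed.

Lemma measurable_dotp d (U : measurableType d) (f g : U -> T) :
  measurable_fun setT f -> measurable_fun setT g ->
  measurable_fun setT (fun z => dotp (row_of (f z)) (row_of (g z))).
Proof.
move=> mf mg; apply: measurable_sum => j.
by apply: measurable_funM; exact: (measurableT_comp (measurable_row j)).
Qed.

Lemma measurable_sqnorm : measurable_fun setT (fun t : T => sqnorm (row_of t)).
Proof. exact: (@measurable_dotp _ _ id id). Qed.

Lemma measurable_cball (r : R) : measurable (row_of @^-1` cball r).
Proof.
rewrite -[X in measurable X]setTI.
rewrite (_ : row_of @^-1` cball r = (fun t : T => sqnorm (row_of t)) @^-1` `]-oo, r ^+ 2]).
  by apply: measurable_sqnorm => //; exact: measurable_itv.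
by apply/seteqP; split => t; rewrite /preimage /cball /= in_itv.
Qed.

Lemma cball_lty (r : R) : 0 <= r -> (nu (row_of @^-1` cball r) < +oo)%E.
Proof.
move=> r0; apply: le_lt_trans (cube_lty r m).
apply: le_measure; rewrite ?inE; [exact: measurable_cball|exact: measurable_cube|].
move=> t; rewrite /preimage /cball /= => H; apply: sum_sqr_cube => //.
by apply: le_trans H; rewrite /sqnorm /dotp; under [leRHS]eq_bigr do rewrite !mxE -expr2.
Qed.

(** Used as a majorant, it records a bound and a bounded support at once. *)
Definition ball_ind (K r : R) (x : Rm) : R := if sqnorm x <= r ^+ 2 then K else 0.

Lemma ball_ind_integrable (K r : R) : 0 <= r ->
  nu.-integrable setT (EFin \o (ball_ind K r \o row_of)).
Proof.
move=> r0.
have -> : EFin \o (ball_ind K r \o row_of) = (EFin \o cst K) \_ (row_of @^-1` cball r).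
  apply/funext => t; rewrite /patch /= /ball_ind; case: ifPn => H.
    by rewrite mem_set.
  by rewrite memNset // /preimage /cball /=; apply/negP.
apply: (integrable_mkcond _ (measurable_cball r)).1.
apply: measurable_bounded_integrable.
- exact: measurable_cball.
- exact: cball_lty.
- exact: measurable_cst.
- by exists `|K|; split=> // y yK t _; exact: ltW.
Qed.

Definition meas (f : Rm -> R) := measurable_fun setT (f \o row_of).

Lemma rint_setT (f : Rm -> R) : rint setT f = Rintegral nu setT (f \o row_of).
Proof. by rewrite /rint preimage_setT. Qed.

Lemma rint_cball (r : R) (f : Rm -> R) :
  rint (cball r) f = rint setT (fun x => if sqnorm x <= r ^+ 2 then f x else 0).
Proof.
rewrite rint_setT /rint Rintegral_mkcond; congr (Rintegral _ _ _).
apply/funext => t; rewrite /patch /=; case: ifP => [|].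
  by rewrite inE /= /cball /= => ->.
by move/negbT; rewrite notin_setE /= /cball /= => /negP/negbTE ->.
Qed.

Lemma meas_integrable f (K r : R) : 0 <= r -> meas f ->
  (forall x, `|f x| <= ball_ind K r x) -> nu.-integrable setT (EFin \o (f \o row_of)).
Proof.
move=> r0 mf fK; apply: le_integrable (ball_ind_integrable K r0) => //.
  exact/measurable_EFinP.
move=> t _; rewrite /= lee_fin; apply: le_trans (fK _) _; exact: ler_norm.
Qed.

Lemma rint_norm_le f (K r : R) : 0 <= r -> meas f ->
  (forall x, `|f x| <= ball_ind K r x) -> `|rint setT f| <= rint setT (ball_ind K r).
Proof.
move=> r0 mf fK; rewrite !rint_setT.
have fi := meas_integrable r0 mf fK.
apply: le_trans (le_normr_Rintegral measurableT fi) _.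
apply: le_Rintegral => //; last by move=> t _; exact: fK.
  have := integrable_abse fi; apply: eq_integrable => // t _.
  exact: ball_ind_integrable.
Qed.

Lemma sphere_null (s : R) : (0 < m)%N ->
  nu.-negligible [set t | sqnorm (row_of t) = s].
Proof.
move=> m0; exists [set t | \sum_i tnth t i ^+ 2 = s]; split; last 1 first.
- move=> t /= <-; rewrite /sqnorm /dotp.
  by apply: eq_bigr => i _; rewrite !mxE.
- rewrite -[X in measurable X]setTI.
  rewrite (_ : [set t | _] = (fun t : T => \sum_i tnth t i ^+ 2) @^-1` [set s]) //.
  apply: measurable_sum => // i; apply: measurable_funX; exact: measurable_tnth.
- by case: m m0 => // n _; exact: sphere_null_step.
Qed.

(** Pointwise convergence is asked off one sphere. In space that is |y| = 1, where the solutions are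
    not controlled; in frequency it is |xi| = c, where the indicators of the moving balls need not
    converge. *)
Lemma rint_dct (f_ : nat -> Rm -> R) f (K r s : R) : (0 < m)%N -> 0 <= r ->
  (forall n, meas (f_ n)) -> meas f ->
  (forall n x, `|f_ n x| <= ball_ind K r x) ->
  (forall x, sqnorm x != s -> f_ ^~ x @ \oo --> f x) ->
  rint setT (f_ n) @[n --> \oo] --> rint setT f.
Proof.
move=> m0 r0 mf_ mf fK cf.
have [||||fi _ C] := @dominated_convergence _ _ _ nu setT measurableT
  (fun n => EFin \o (f_ n \o row_of)) (EFin \o (f \o row_of))
  (EFin \o (ball_ind K r \o row_of)) _ _ _ (ball_ind_integrable K r0) _.
- by move=> n; apply/measurable_EFinP; exact: mf_.
- by apply/measurable_EFinP; exact: mf.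
- apply: negligibleS (sphere_null s m0) => t /=; apply: contra_notP => /eqP ns _.
  by apply: cvg_EFin; [exact: nearW|exact: cf].
- by apply: aeW => t n _ /=; rewrite lee_fin.
under eq_fun do rewrite rint_setT; rewrite rint_setT.
apply: fine_cvg; rewrite fineK //; exact: integrable_fin_num.
Qed.

(** The positive and negative parts are treated apart, each by Tonelli's theorem. *)
Lemma measurable_rint_param (h : Rm -> Rm -> R) :
  measurable_fun setT (fun z : T * T => h (row_of z.1) (row_of z.2)) ->
  meas (fun xi => rint setT (fun x => h xi x)).
Proof.
move=> mh; rewrite /meas.
rewrite (_ : _ \o _ = fine \o (fun t => \int[nu]_y (h (row_of t) (row_of y))%:E)%E); last first.
  by apply/funext => t /=; rewrite rint_setT.
apply: measurableT_comp; first exact: fine_measurable.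
pose H := EFin \o (fun z : T * T => h (row_of z.1) (row_of z.2)).
have mE : measurable_fun setT H by exact/measurable_EFinP.
have X1 := measurable_fun_fubini_tonelli_F (m2 := nu) (H^\+)%E
  (measurable_funepos mE) (fun x => funepos_ge0 H x).
have X2 := measurable_fun_fubini_tonelli_F (m2 := nu) (H^\-)%E
  (measurable_funeneg mE) (fun x => funeneg_ge0 H x).
rewrite (_ : (fun t => _) = (fun t => fubini_F nu H^\+ t - fubini_F nu H^\- t)%E).
  exact: emeasurable_funB.
apply/funext => t; rewrite integralE; congr (_ - _)%E; apply: eq_integral => y _.
  by rewrite !funeposE.
by rewrite !funenegE.
Qed.

End TupleIntegral.

(** * The operator P_c on real coordinate functions *)

Section BandLimiting.
Variables (R : realType) (m : nat).
Hypothesis m_gt0 : (0 < m)%N.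
Local Notation Rm := 'rV[R]_m.
Local Notation Cl := (cliff R m).
Implicit Types (g : Rm -> R) (x xi : Rm) (w : R -> R).

Definition wave w g xi : R := rint setT (fun x => w (- (2 * pi * dotp x xi)) * g x).

(** The real part of P_c g for real g. As lambda and the coordinates of psi are real, the real part
    of the eigenvalue relation determines lambda. *)
Definition band (c : R) g x : R :=
  rint (cball c) (fun xi => wave (@cos R) g xi * cos (2 * pi * dotp xi x) -
                            wave (@sin R) g xi * sin (2 * pi * dotp xi x)).

Lemma Re_Pc (c : R) (f : Rm -> Cl) x A :
  complex.Re (Pc c (fun y => cl_complex (f y)) x A) = band c (fun y => f y A) x.
Proof.
rewrite ffunE /=; congr rint; apply/funext => xi.
rewrite ffunE /=; congr (_ * _ - _ * _).
  by congr rint; apply/funext => y; rewrite ffunE /= mulr0 subr0.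
by congr rint; apply/funext => y; rewrite ffunE /= mulr0 add0r.
Qed.

Lemma measurable_dotp_l d (U : measurableType d) (f : U -> m.-tuple R) x :
  measurable_fun setT f -> measurable_fun setT (fun z => dotp (row_of (f z)) x).
Proof.
move=> mf; apply: measurable_sum => j; apply: measurable_funM; last exact: measurable_cst.
exact: (measurableT_comp (measurable_row j)).
Qed.

Lemma meas_wave w g : continuous w -> meas g -> meas (wave w g).
Proof.
move=> cw mg; apply: measurable_rint_param; apply: measurable_funM.
  apply: measurableT_comp; first exact: continuous_measurable_fun.
  apply: measurableT_comp; first exact: oppr_measurable.
  apply: measurable_funM; first exact: measurable_cst.
  by apply: measurable_dotp; [exact: measurable_snd|exact: measurable_fst].
exact: (measurableT_comp mg measurable_snd).
Qed.

Lemma meas_wave_integrand w g xi : continuous w -> meas g ->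
  meas (fun x => w (- (2 * pi * dotp x xi)) * g x).
Proof.
move=> cw mg; apply: measurable_funM => //.
apply: (@measurableT_comp _ _ _ _ _ _ w); first exact: continuous_measurable_fun.
apply: (@measurableT_comp _ _ _ _ _ _ (@GRing.opp R)); first exact: oppr_measurable.
apply: measurable_funM; first exact: measurable_cst.
exact: (@measurable_dotp_l _ _ id).
Qed.

Lemma wave_integrand_le w g K xi x : (forall t, `|w t| <= 1) ->
  (forall y, `|g y| <= ball_ind K 1 y) ->
  `|w (- (2 * pi * dotp x xi)) * g x| <= ball_ind K 1 x.
Proof.
move=> w1 gK; rewrite normrM; apply: le_trans (gK x).
by rewrite ler_piMl.
Qed.

Lemma wave_le w g K xi : continuous w -> (forall t, `|w t| <= 1) -> meas g ->
  (forall y, `|g y| <= ball_ind K 1 y) ->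
  `|wave w g xi| <= rint setT (@ball_ind R m K 1).
Proof.
move=> cw w1 mg gK; apply: rint_norm_le => //; first exact: meas_wave_integrand.
by move=> x; exact: wave_integrand_le.
Qed.

Lemma wave_cvg w (g_ : nat -> Rm -> R) g K xi : continuous w ->
  (forall t, `|w t| <= 1) -> (forall n, meas (g_ n)) -> meas g ->
  (forall n y, `|g_ n y| <= ball_ind K 1 y) ->
  (forall y, sqnorm y != 1 -> g_ ^~ y @ \oo --> g y) ->
  wave w (g_ n) xi @[n --> \oo] --> wave w g xi.
Proof.
move=> cw w1 mg_ mg gK cg; apply: (@rint_dct _ _ _ _ K 1 1) => //.
- by move=> n; exact: meas_wave_integrand.
- exact: meas_wave_integrand.
- by move=> n x; exact: wave_integrand_le.
- by move=> x x1; apply: cvgZr; exact: cg.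
Qed.

Lemma meas_if_le (f h : Rm -> R) (s : R) : meas f -> meas h ->
  meas (fun x => if h x <= s then f x else 0).
Proof.
move=> mf mh; rewrite /meas.
apply: (@measurable_fun_ifT _ _ _ _ (fun t => f (row_of t)) (cst 0)
  (fun t => h (row_of t) <= s)) => //.
by apply: measurable_fun_ler => //; exact: measurable_cst.
Qed.

Definition band_integrand g x xi : R :=
  wave (@cos R) g xi * cos (2 * pi * dotp xi x) -
  wave (@sin R) g xi * sin (2 * pi * dotp xi x).

Definition band_bound (K : R) : R :=
  rint setT (@ball_ind R m K 1) + rint setT (@ball_ind R m K 1).

Lemma meas_band_integrand g x : meas g -> meas (band_integrand g x).
Proof.
move=> mf.
have mdot : meas (fun xi => 2 * pi * dotp xi x).
  by apply: measurable_funM; [exact: measurable_cst|exact: (@measurable_dotp_l _ _ id)].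
apply: measurable_funB; apply: measurable_funM.
- by apply: meas_wave => //; exact: continuous_cos.
- apply: (@measurableT_comp _ _ _ _ _ _ (@cos R)) => //.
  by apply: continuous_measurable_fun; exact: continuous_cos.
- by apply: meas_wave => //; exact: continuous_sin.
- apply: (@measurableT_comp _ _ _ _ _ _ (@sin R)) => //.
  by apply: continuous_measurable_fun; exact: continuous_sin.
Qed.

Lemma band_integrand_le g K x xi : meas g -> (forall y, `|g y| <= ball_ind K 1 y) ->
  `|band_integrand g x xi| <= band_bound K.
Proof.
move=> mf fK; apply: le_trans (ler_normB _ _) _; rewrite !normrM.
apply: lerD; rewrite -[rint _ _]mulr1; apply: ler_pM => //.
- by apply: wave_le => //; [exact: continuous_cos|exact: cos_max].
- exact: cos_max.
- by apply: wave_le => //; [exact: continuous_sin|exact: sin_max].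
- exact: sin_max.
Qed.

Lemma band_cvg (c_ : nat -> R) (c : R) (g_ : nat -> Rm -> R) g K x : 0 < c ->
  (forall n, 0 < c_ n) -> c_ @ \oo --> c -> 
  (forall n, meas (g_ n)) -> meas g ->
  (forall n y, `|g_ n y| <= ball_ind K 1 y) -> (forall y, `|g y| <= ball_ind K 1 y) ->
  (forall y, sqnorm y != 1 -> g_ ^~ y @ \oo --> g y) ->
  band (c_ n) (g_ n) x @[n --> \oo] --> band c g x.
Proof.
move=> c0 c_0 cc mg_ mg gK_ gK cg.
(* All the frequency balls must lie in one ball, to carry a common majorant. *)
have [r r0 cr] : exists2 r : R, 0 < r & forall n, c_ n <= r.
  have := cvg_seq_bounded (cvgP _ cc); rewrite /bounded_fun => -[B [_ HB]].
  exists (`|B| + 1); first by rewrite ltr_wpDl.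
  move=> n; apply: le_trans (ler_norm _) _; apply: (HB (`|B| + 1)) => //.
  by rewrite ltr_pwDr // ler_norm.
pose h g := band_integrand g x.
have mh f : meas f -> meas (h f) by exact: meas_band_integrand.
have hle f xi : meas f -> (forall y, `|f y| <= ball_ind K 1 y) ->
  `|h f xi| <= band_bound K by exact: band_integrand_le.
have hcvg xi : h (g_ n) xi @[n --> \oo] --> h g xi.
  apply: cvgB; apply: cvgMl.
    by apply: (@wave_cvg _ _ _ K) => //; [exact: continuous_cos|exact: cos_max].
  by apply: (@wave_cvg _ _ _ K) => //; [exact: continuous_sin|exact: sin_max].
have mq : meas (@sqnorm R m) by exact: measurable_sqnorm.
rewrite /band rint_cball; under eq_fun do rewrite rint_cball.
apply: (@rint_dct _ _ _ _ (band_bound K) r (c ^+ 2)) => //; first exact: ltW.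
- by move=> n; apply: meas_if_le => //; exact: mh.
- by apply: meas_if_le => //; exact: mh.
- move=> n xi; rewrite /ball_ind; case: ifP => H1.
    rewrite (le_trans H1); first exact: hle.
    by rewrite ler_sqr ?nnegrE ?(ltW (c_0 n)) ?(ltW r0).
  by rewrite normr0; case: ifP => // _; apply: le_trans (hle g xi mg gK).
(* Off the sphere |xi| = c, membership in the ball of radius [c_ n] is eventually constant. *)
move=> xi; rewrite neq_lt => /orP[lt|gt].
  rewrite (ltW lt).
  have c2 : (fun n => c_ n ^+ 2) @ \oo --> c ^+ 2.
    by under eq_fun do rewrite expr2; rewrite expr2; exact: cvgM.
  apply: cvg_trans (hcvg xi); apply: near_eq_cvg.
  near=> n; rewrite ifT //; apply: ltW.
  by near: n; move/cvgr_gt: c2; apply.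
have c2 : (fun n => c_ n ^+ 2) @ \oo --> c ^+ 2.
  by under eq_fun do rewrite expr2; rewrite expr2; exact: cvgM.
rewrite leNgt gt /=; apply: cvg_near_cst.
near=> n; rewrite ifF //; apply/negbTE; rewrite -ltNge.
by near: n; move/cvgr_lt: c2; apply.
Unshelve. all: by end_near. Qed.

(** This lets the unknown normalising factor of psi cancel from the eigenvalue relation. *)
Lemma band_scale (c : R) g K (a : R) x : meas g ->
  (forall y, `|g y| <= ball_ind K 1 y) -> 0 < c ->
  band c (fun y => a * g y) x = a * band c g x.
Proof.
move=> mg gK c0.
have wZ w xi : continuous w -> (forall t, `|w t| <= 1) ->
    wave w (fun y => a * g y) xi = a * wave w g xi.
  move=> cw w1; rewrite /wave !rint_setT -RintegralZl //.
    by apply: eq_Rintegral => t _ /=; rewrite mulrCA.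
  apply: (@meas_integrable R m (fun y => w (- (2 * pi * dotp y xi)) * g y) K 1) => //.
    exact: meas_wave_integrand.
  by move=> y; exact: wave_integrand_le.
rewrite /band !rint_cball !rint_setT -RintegralZl //.
  apply: eq_Rintegral => t _ /=; case: ifP => _; last by rewrite mulr0.
  rewrite !wZ; [ring|exact: continuous_sin|exact: sin_max|exact: continuous_cos|exact: cos_max].
apply: (@meas_integrable R m (fun xi => if sqnorm xi <= c ^+ 2 then band_integrand g x xi else 0)
  (band_bound K) c); [exact: ltW| |].
  apply: meas_if_le; [exact: meas_band_integrand|exact: measurable_sqnorm].
move=> xi; rewrite /ball_ind; case: ifP => _; last by rewrite normr0.
exact: band_integrand_le.
Qed.

End BandLimiting.

(** * Eigenfunctions and eigenvalues *)

Section Eigenfunctions.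
Variables (R : realType) (m k : nat) (b : bool).
Hypothesis m_ge2 : (2 <= m)%N.
Variable Y : 'rV[R]_m -> cliff R m.
Hypothesis YP : monogenic_poly k Y.
Variable w : 'rV[R]_m.
Hypotheses (w0 : w != 0) (Yw : Y w != 0).

Local Notation d := (radial_dim m k b).
Local Notation shift := (radial_shift R m k b).
Local Notation gam c := (4 * pi ^+ 2 * c ^+ 2 : R).
Local Notation base := (radial_base Y b).

Lemma radial_dim_ge2 : (2 <= d)%N.
Proof. by rewrite /radial_dim -addnA (leq_trans m_ge2) // leq_addr. Qed.

Lemma smooth_derive (P : R -> R) : smooth P ->
  (forall t : R, is_derive t 1 P (derive1 P t)) /\
  (forall t : R, is_derive t 1 (derive1 P) (derive1 (derive1 P) t)).
Proof.
move=> sP; split=> t; rewrite [in X in is_derive _ _ _ X]derive1E; apply/derivableP.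
  exact: (sP 0%N).
exact: (sP 1%N).
Qed.

(** By homogeneity Y does not vanish along the open ray through [w]. Evaluating there reduces
    Clifford-valued identities to scalar ones in t = |x|^2. *)
Lemma exists_sqnorm (t : R) : 0 < t -> exists x : 'rV[R]_m,
  [/\ sqnorm x = t, x != 0 & Y x != 0].
Proof.
move=> t0; have q0 : 0 < sqnorm w.
  by rewrite lt_neqAle sqnorm_ge0 eq_sym sqnorm_eq0 w0.
pose s := Num.sqrt (t / sqnorm w).
have s0 : 0 < s by rewrite sqrtr_gt0 divr_gt0.
exists (s *: w); split.
- by rewrite sqnormZ sqr_sqrtr ?divfK ?gt_eqF // divr_ge0 // ltW.
- by rewrite scaler_eq0 negb_or gt_eqF.
- by rewrite (homog_scale YP) scaler_eq0 negb_or expf_neq0 ?gt_eqF.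
Qed.

Lemma Lc_eigen_ode (c z : R) (P : R -> R) : Lc_eigen b c Y z P ->
  forall t, 0 < t <= 1 ->
    sl_ode d (z - shift) (gam c) t (P t) (derive1 P t) (derive1 (derive1 P) t).
Proof.
move=> [sP _ H] t /andP[t0 t1].
have [dP dP1] := smooth_derive sP.
have [x [xt x0 Yx]] := exists_sqnorm t0.
have := H x; rewrite /cball /= xt expr1n => /(_ t1).
rewrite (Lc_radial YP b c x dP dP1) radial_formE xt scalerA => /eqP.
rewrite -subr_eq0 -scalerBl scaler_eq0 (negPf (radial_base_neq0 b Yx x0)) orbF.
by move=> /eqP E; apply/eqP; rewrite -subr_eq0 -E; apply/eqP; ring.
Qed.

Lemma Lc_eigen_frob (c z : R) (P : R -> R) : Lc_eigen b c Y z P ->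
  [/\ frobW d (z - shift) (gam c) = 0, P 0 != 0 &
    forall t, 0 <= t <= 1 -> P t = P 0 * frobu d (z - shift) (gam c) t].
Proof.
move=> H; have [sP Pnz _] := H; have [dP dP1] := smooth_derive sP.
have ode t : 0 < t < 1 -> sl_ode d (z - shift) (gam c) t (P t) (derive1 P t) (derive1 (derive1 P) t).
  by move=> /andP[t0 t1]; apply: Lc_eigen_ode H _ _; rewrite t0 ltW.
have d2 := radial_dim_ge2.
split; first exact: (eigen_frobW0 d2 dP dP1 ode Pnz).
  exact: (eigen_neq0 d2 dP dP1 ode Pnz).
by move=> t; exact: (eigen_eq d2 dP dP1 ode Pnz).
Qed.

Lemma frob_Lc_eigen (c mu : R) : frobW d mu (gam c) = 0 ->
  Lc_eigen b c Y (mu + shift) (frobu d mu (gam c)).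
Proof.
move=> W0; have d2 := radial_dim_ge2; have E := pentire_frob d2 W0.
split; first exact: psum_smooth.
  by exists 0; rewrite ?lexx ?ler01 // frobu0 oner_neq0.
move=> x _.
have lt (t : R) : `|t| < `|t| + 1 by rewrite ltrDl.
rewrite (Lc_radial YP b c x (fun t => frobu_derive (E (`|t| + 1)) (lt t))
  (fun t => frobdu_derive (E (`|t| + 1)) (lt t))) radial_formE scalerA.
congr (_ *: _); have := frobu_ode d2 (E (`|sqnorm x| + 1)) (lt (sqnorm x)).
by rewrite /sl_ode => ->; ring.
Qed.

Lemma Lc_spectrum_frob (c : R) (chi : nat -> R) :
  (forall z, (exists P, Lc_eigen b c Y z P) <-> exists N, z = chi N) ->
  forall mu, frobW d mu (gam c) = 0 <-> exists N, mu = chi N - shift.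
Proof.
move=> H mu; split=> [W0|[N ->]].
  have [N E] := (H (mu + shift)).1 (ex_intro _ _ (frob_Lc_eigen W0)).
  by exists N; rewrite -E addrK.
have [P /Lc_eigen_frob[]] := (H (chi N)).2 (ex_intro _ N erefl).
by [].
Qed.

(** Normalised by the value 1 of the radial factor at 0, a choice that varies continuously with the
    parameters, unlike the sign of psi. *)
Definition eigen_ext (mu c : R) (x : 'rV[R]_m) : cliff R m :=
  if sqnorm x <= 1 ^+ 2 then frobu d mu (gam c) (sqnorm x) *: base x else 0.

(** A class containing the coordinates and stable under sums and products, hence containing the
    components of Y and of x Y. *)
Definition tame (f : 'rV[R]_m -> R) :=
  meas f /\ exists K, forall x, sqnorm x <= 1 -> `|f x| <= K.

Lemma tame_cst (a : R) : tame (fun=> a).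
Proof. by split; [exact: measurable_cst|exists `|a|]. Qed.

Lemma tame_coord j : tame (fun x => x 0 j).
Proof.
split; first exact: measurable_row.
exists 1 => x x1; rewrite -ler_sqr ?nnegrE // real_normK ?num_real // expr1n.
apply: le_trans x1; rewrite /sqnorm /dotp (bigD1 j) //= -expr2 lerDl.
by apply: sumr_ge0 => i _; rewrite -expr2 sqr_ge0.
Qed.

Lemma tameM f g : tame f -> tame g -> tame (fun x => f x * g x).
Proof.
move=> [mf [K fK]] [mg [L gL]]; split; first exact: measurable_funM.
by exists (K * L) => x x1; rewrite normrM ler_pM ?fK ?gL.
Qed.

Lemma tame_sum (I : Type) (s : seq I) (p : pred I) (f : I -> 'rV[R]_m -> R) :
  (forall i, tame (f i)) -> tame (fun x => \sum_(i <- s | p i) f i x).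
Proof.
move=> H; elim: s => [|i s [ms [K HK]]].
  by under eq_fun do rewrite big_nil; exact: tame_cst.
have [mf [L HL]] := H i; split.
  rewrite /meas (_ : _ \o _ = fun t => (if p i then f i (row_of t) else 0) +
      \sum_(j <- s | p j) f j (row_of t)); last first.
    by apply/funext => t /=; rewrite big_cons; case: (p i); rewrite ?add0r.
  apply: measurable_funD => //; case: (p i) => //; exact: measurable_cst.
exists (`|L| + K) => x x1; rewrite big_cons; case: (p i).
  apply: le_trans (ler_normD _ _) _; rewrite lerD ?HK //.
  by apply: le_trans (HL x x1) _; exact: ler_norm.
by apply: le_trans (HK x x1) _; rewrite lerDr.
Qed.

Lemma tame_prod (I : Type) (s : seq I) (f : I -> 'rV[R]_m -> R) :
  (forall i, tame (f i)) -> tame (fun x => \prod_(i <- s) f i x).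
Proof.
move=> H; elim: s => [|i s IH].
  by under eq_fun do rewrite big_nil; exact: tame_cst.
by under eq_fun do rewrite big_cons; exact: tameM.
Qed.

Lemma tame_base A : tame (fun x => base x A).
Proof.
have tY B : tame (fun x => Y x B).
  have [[a Ya] _] := YP; under eq_fun do rewrite Ya sum_ffunE.
  apply: tame_sum => al; under eq_fun do rewrite cl_scaleE.
  apply: tameM (tame_cst _); apply: tame_prod => j.
  elim: (nat_of_ord (al j)) => [|n IH]; first exact: tame_cst.
  by under eq_fun do rewrite exprS; apply: tameM (tame_coord j) IH.
rewrite /radial_base; case: (b); last by under eq_fun do rewrite mul1r.
under eq_fun do rewrite cl_vec_mul sum_ffunE.
apply: tame_sum => j; under eq_fun do rewrite cl_scaleE.
apply: tameM (tame_coord j) _.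
under eq_fun => x do rewrite [(cl_gen R j * Y x) A]cl_mulE.
by apply: tame_sum => B; apply: tameM (tame_cst _) (tY _).
Qed.

Lemma meas_eigen_ext (mu c : R) A : frobW d mu (gam c) = 0 ->
  meas (fun x => eigen_ext mu c x A).
Proof.
move=> W0; have d2 := radial_dim_ge2; have E := pentire_frob d2 W0.
have -> : (fun x => eigen_ext mu c x A) = (fun x => if sqnorm x <= 1 ^+ 2 then
    frobu d mu (gam c) (sqnorm x) * base x A else 0).
  by apply/funext => x; rewrite /eigen_ext; case: ifP => _; rewrite ?cl_scaleE // ffunE.
apply: meas_if_le; last exact: measurable_sqnorm.
have [mb _] := tame_base A; apply: measurable_funM => //.
apply: (@measurableT_comp _ _ _ _ _ _ (frobu d mu (gam c))); last exact: measurable_sqnorm.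
apply: continuous_measurable_fun => t.
have lt : `|t| < `|t| + 1 by rewrite ltrDl.
exact: is_derive_continuous (frobu_derive (E (`|t| + 1)) lt).
Qed.

Lemma eigen_ext_bound (M : R) A : 1 <= M -> exists K : R, forall mu c x,
  `|mu| + `|gam c| <= M -> frobW d mu (gam c) = 0 ->
  `|eigen_ext mu c x A| <= ball_ind K 1 x.
Proof.
move=> M1; have [_ [K HK]] := tame_base A.
exists (frob_sup M * K) => mu c x muM W0; rewrite /eigen_ext /ball_ind.
case: ifP => x1; last by rewrite ffunE normr0.
rewrite expr1n in x1; rewrite cl_scaleE normrM ler_pM ?HK //.
by apply: (frobu_eig_le radial_dim_ge2) => //; rewrite sqnorm_ge0.
Qed.

(** The unit sphere is left out because the estimate of [frobu_dist] carries the factor -log(1 -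
    |x|^2). *)
Lemma eigen_ext_cvg (mu_ c_ : nat -> R) (mu c M : R) A x :
  (forall n, `|mu_ n| + `|gam (c_ n)| <= M) -> `|mu| + `|gam c| <= M ->
  mu_ @ \oo --> mu -> c_ @ \oo --> c -> sqnorm x != 1 ->
  (fun n => eigen_ext (mu_ n) (c_ n) x A) @ \oo --> eigen_ext mu c x A.
Proof.
move=> M_ muM cmu cc x1; rewrite /eigen_ext expr1n; case: ifP => H; last exact: cvg_cst.
have xlt : 0 <= sqnorm x < 1 by rewrite sqnorm_ge0 lt_neqAle x1.
under eq_fun do rewrite cl_scaleE; rewrite cl_scaleE; apply: cvgMl.
have cg : (fun n => gam (c_ n)) @ \oo --> gam c.
  by apply: cvgZr; under eq_fun do rewrite expr2; rewrite expr2; exact: cvgM.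
pose e n := frob_lip M * (`|mu - mu_ n| + `|gam c - gam (c_ n)|) * ell (sqnorm x).
have ce : e @ \oo --> 0.
  have -> : 0 = frob_lip M * (0 + 0) * ell (sqnorm x) by ring.
  apply: cvgMl; apply: cvgZr; apply: cvgD.
    by rewrite -(@normr0 R R) -(subrr mu); apply: cvg_norm; apply: cvgB => //; exact: cvg_cst.
  by rewrite -(@normr0 R R) -(subrr (gam c)); apply: cvg_norm; apply: cvgB => //; exact: cvg_cst.
apply/cvgrPdist_le => eps eps0; move/cvgr0Pnorm_le: ce => /(_ eps eps0).
apply: filterS => n; apply: le_trans; apply: le_trans (ler_norm _).
exact: (frobu_dist radial_dim_ge2 muM (M_ n) xlt).
Qed.

End Eigenfunctions.

(** * A basis element that does not vanish identically *)

Section Basis.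
Variables (R : realType) (m k : nat).
Hypothesis m_ge2 : (2 <= m)%N.

(** The division is truncated, so positivity means that the denominator is at most the numerator;
    their ratio is a binomial coefficient. *)
Lemma monogenic_dim_gt0 : (0 < monogenic_dim m k)%N.
Proof.
rewrite /monogenic_dim divn_gt0 ?muln_gt0 ?fact_gt0 //.
have -> : (m + k - 2 = (m - 2) + k)%N by rewrite addnBAC.
have := bin_fact (leq_addl (m - 2) k); rewrite addnK => <-.
by rewrite (mulnC k`!) leq_pmull // bin_gt0 leq_addl.
Qed.

(** Otherwise Y vanishes off 0, hence at 0 too by scaling a nonzero vector by 0, and its sphere
    integral would be 0 instead of 1. *)
Lemma basis_nonzero (Y : 'I_(monogenic_dim m k) -> 'rV[R]_m -> cliff R m) i :
  orthonormal_basis Y -> exists2 w, w != 0 & Y i w != 0.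
Proof.
move=> [YP _ Y1]; apply: contrapT => H.
have Y0 x : x != 0 -> Y i x = 0.
  by move=> x0; apply/eqP; apply: contrapT => Yx; apply: H; exists x => //; exact/negP.
have Y00 : Y i 0 = 0.
  pose v : 'rV[R]_m := const_mx 1.
  have v0 : v != 0.
    apply/eqP => /rowP /(_ (Ordinal (leq_trans (ltn0Sn 1) m_ge2))).
    by rewrite !mxE => /eqP; rewrite oner_eq0.
  by rewrite -(scale0r v) (homog_scale (YP i)) Y0 // scaler0.
have Yz x : Y i x = 0 by have [->|/Y0] := eqVneq x 0.
have := Y1 i i; rewrite eqxx => /ffunP/(_ finset.set0).
rewrite !ffunE eqxx => /esym/eqP; apply/negP.
rewrite /sphere_int (_ : (fun w => _) = fun=> 0); last first.
  by apply/funext => x; rewrite Yz mulr0 ffunE.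
by rewrite /rint /Rintegral integral0 mulr0 oner_neq0.
Qed.

End Basis.

(** * Continuity of the eigenvalue of Q P_c *)

Section Continuity.
Variables (R : realType) (m n k : nat).
Hypothesis m_ge2 : (2 <= m)%N.
Variable Y : 'I_(monogenic_dim m k) -> 'rV[R]_m -> cliff R m.
Hypothesis hY : orthonormal_basis Y.
Variable psi : R -> 'I_(monogenic_dim m k) -> 'rV[R]_m -> cliff R m.
Hypothesis hpsi : forall c i, 0 < c -> is_cpswf c Y n i (psi c i).
Variable lambda : R -> R.
Hypothesis hlambda : forall c, 0 < c -> 0 < lambda c /\
  forall i x, Qop (Pc c (fun y => cl_complex (psi c i y))) x =
              (lambda c)%:C%C *: cl_complex (psi c i x).

Local Notation b := (odd n).
Local Notation d := (radial_dim m k b).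
Local Notation shift := (radial_shift R m k b).
Local Notation gam c := (4 * pi ^+ 2 * c ^+ 2 : R).
Local Notation W := (frobW d).

(** Since [lambda] does not depend on i, one index determines it. *)
Let i0 : 'I_(monogenic_dim m k) := Ordinal (monogenic_dim_gt0 k m_ge2).
Let YP : monogenic_poly k (Y i0). Proof. by case: hY. Qed.
Let m_gt0 : (0 < m)%N. Proof. exact: leq_trans m_ge2. Qed.

Let gam_gt0 c : 0 < c -> 0 < gam c.
Proof. by move=> c0; rewrite !mulr_gt0 ?ltr0n ?exprn_gt0 ?pi_gt0. Qed.

Lemma eigenvalue_branch : exists mu : R -> R,
  [/\ forall c, 0 < c -> W (mu c) (gam c) = 0,
      forall c, 0 < c -> exists2 a : R, a != 0 &
        forall x, psi c i0 x = a *: eigen_ext k b (Y i0) (mu c) c x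
    & forall c (e : R), 0 < c -> 0 < e -> exists2 delta : R, 0 < delta &
        forall c', 0 < c' -> `|gam c' - gam c| < delta -> `|mu c' - mu c| < e].
Proof.
have [w w0 Yw] := basis_nonzero m_ge2 i0 hY.
(* An enumeration and a radial profile are chosen for each c, with no regularity in c; the zeros of
   W will tie them together. *)
have /choice[f Hf] : forall c, exists p : (nat -> R) * (R -> R), 0 < c ->
    [/\ Lc_spectrum b c Y p.1, Lc_eigen b c (Y i0) (p.1 n./2) p.2,
      forall x, cball 1 x -> psi c i0 x = radial_form b p.2 (Y i0) x
    & forall x, ~ cball 1 x -> psi c i0 x = 0].
  move=> c; case: (ltP 0 c) => [c0|_]; last by exists (fun=> 0, fun=> 0).
  by have [chi [P [H1 H2 H3 H4 _]]] := hpsi i0 c0; exists (chi, P).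
pose chi c := (f c).1; pose P c := (f c).2.
have spec c : 0 < c -> forall mu, W mu (gam c) = 0 <-> exists N, mu = chi c N - shift.
  move=> c0; have [[_ H] _ _ _] := Hf c c0.
  exact: (Lc_spectrum_frob m_ge2 YP w0 Yw (H i0)).
exists (fun c => chi c n./2 - shift); split.
- by move=> c c0; apply/(spec c c0); exists n./2.
- move=> c c0; have [_ H1 H2 H3] := Hf c c0.
  have [_ P0 PE] := Lc_eigen_frob m_ge2 YP w0 Yw H1.
  exists (P c 0) => // x; rewrite /eigen_ext; case: ifPn => x1.
    rewrite H2 // radial_formE PE ?scalerA //.
    by rewrite sqnorm_ge0 -(expr1n R 2).
  by rewrite H3 ?scaler0 //; apply/negP.
- move=> c e c0 e0.
  (* The inverse of c -> 4 pi^2 c^2 on positive reals, as the zeros are parametrised by gam. *)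
  pose cc (g : R) := Num.sqrt g / (2 * pi).
  have p0 : 0 < 2 * pi :> R by rewrite mulr_gt0 ?ltr0n ?pi_gt0.
  have ccK c' : 0 < c' -> cc (gam c') = c'.
    move=> c'0; rewrite /cc (_ : gam c' = (2 * pi * c') ^+ 2); last by ring.
    by rewrite sqrtr_sqr gtr0_norm ?mulr_gt0 ?pi_gt0 ?ltr0n // mulrAC divff ?mul1r ?gt_eqF.
  have cc0 (g : R) : 0 < g -> 0 < cc g by move=> g0; rewrite divr_gt0 // sqrtr_gt0.
  have gcc (g : R) : 0 < g -> gam (cc g) = g.
    move=> g0; rewrite /cc expr_div_n sqr_sqrtr ?(ltW g0) //.
    have E (p q : R) : p != 0 -> 4 * p ^+ 2 * (q / (2 * p) ^+ 2) = q.
      by move=> p_neq0; field.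
    by apply: E; rewrite gt_eqF ?pi_gt0.
  have [||||del del0 H] := @zero_branch_close R d (radial_dim_ge2 k b m_ge2) (gam c)
    [set g | 0 < g] (fun g N => chi (cc g) N - shift) _ _ _ _ n./2 e e0.
  + exact: gam_gt0.
  + by [].
  + move=> g /= g0 i j ij; rewrite ltrD2r.
    by have [[H _] _ _ _] := Hf _ (cc0 g g0); exact: H.
  + by move=> g /= g0 mu; have := spec _ (cc0 g g0) mu; rewrite (gcc g g0).
  exists del => // c' c'0 hc'.
  by have := H (gam c') (gam_gt0 c'0) hc'; rewrite !ccK.
Qed.

Lemma lambda_cvg (c_ : nat -> R) (c : R) : 0 < c -> (forall j, 0 < c_ j) ->
  c_ @ \oo --> c -> (fun j => lambda (c_ j)) @ \oo --> lambda c.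
Proof.
move=> c0 c_0 cc.
have [mu [muW psiE mu_close]] := eigenvalue_branch.
have d2 := radial_dim_ge2 k b m_ge2.
have [w w0 Yw] := basis_nonzero m_ge2 i0 hY.
have cg : (fun j => gam (c_ j)) @ \oo --> gam c.
  by apply: cvgZr; under eq_fun do rewrite expr2; rewrite expr2; exact: cvgM.
have cmu : (fun j => mu (c_ j)) @ \oo --> mu c.
  apply/cvgrPdist_lt => e e0; have [del del0 H] := mu_close c e c0 e0.
  move/cvgrPdist_lt: cg => /(_ del del0); apply: filterS => j; rewrite distrC => hj.
  by rewrite distrC; apply: H.
have [M M1 [M_ Mc]] : exists2 M : R, 1 <= M &
    (forall j, `|mu (c_ j)| + `|gam (c_ j)| <= M) /\ `|mu c| + `|gam c| <= M.
  have bnd (u : nat -> R) (l : R) : u @ \oo --> l -> exists B : R, forall j, `|u j| <= B.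
    move=> ul; have := cvg_seq_bounded (cvgP _ ul); rewrite /bounded_fun => -[B [_ HB]].
    by exists (B + 1) => j; apply: (HB (B + 1)) => //; rewrite ltrDl.
  have [B1 H1] := bnd _ _ cmu; have [B2 H2] := bnd _ _ cg.
  exists (`|B1| + `|B2| + (`|mu c| + `|gam c|) + 1).
    by rewrite lerDr !addr_ge0.
  split=> [j|].
    apply: le_trans (lerD (H1 j) (H2 j)) _.
    have := ler_norm B1; have := ler_norm B2; have := normr_ge0 (mu c).
    by have := normr_ge0 (gam c); lra.
  have := normr_ge0 B1; have := normr_ge0 B2; lra.
pose U c x := eigen_ext k b (Y i0) (mu c) c x.
(* The evaluation point has |x|^2 = rho, strictly inside the ball, where the radial factor at c is
   at least 1/2; so some coordinate [A] of the limit eigenfunction is nonzero there. *)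
have [rho [/andP[rho0 rho1] Hrho]] := frobu_ge_half d2 (mu c) (gam c).
have [x [xrho x0 Yx]] := exists_sqnorm YP w0 Yw rho0.
have x1 : sqnorm x <= 1 ^+ 2 by rewrite xrho expr1n ltW.
have [A UA] : exists A, U c x A != 0.
  apply: contrapT => H; have : U c x = 0.
    apply/ffunP => A; rewrite ffunE; apply/eqP/negPn/negP => UA.
    by apply: H; exists A.
  rewrite /U /eigen_ext x1 xrho => /eqP; rewrite scaler_eq0.
  rewrite (negPf (radial_base_neq0 b Yx x0)) orbF => /eqP u0.
  have := Hrho rho; rewrite u0 (ltW rho0) lexx => /(_ isT).
  by rewrite leNgt invr_gt0 ltr0n.
have [K HK] := eigen_ext_bound b m_ge2 YP A M1.
(* The eigenvalue relation at x, coordinate [A], real part, after cancelling the factor between psi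
   and [U]. *)
have eqU c' : 0 < c' -> (forall y, `|U c' y A| <= ball_ind K 1 y) ->
    lambda c' * U c' x A = band c' (fun y => U c' y A) x.
  move=> c'0 bU; have [a a0 Ea] := psiE c' c'0.
  have [_ /(_ i0 x)] := hlambda c'0.
  rewrite /Qop mem_set // => /ffunP/(_ A)/(congr1 (@complex.Re R)).
  rewrite Re_Pc !ffunE /= mul0r subr0 Ea.
  rewrite (_ : (fun y => psi c' i0 y A) = (fun y => a * U c' y A)); last first.
    by apply/funext => y; rewrite Ea cl_scaleE.
  have mU : meas (fun y => U c' y A) by exact: meas_eigen_ext (muW c' c'0).
  rewrite (band_scale a x mU bU c'0).
  by rewrite cl_scaleE mulrCA => /(mulfI a0).
have bUj j y : `|U (c_ j) y A| <= ball_ind K 1 y by apply: HK => //; exact: muW.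
have bU y : `|U c y A| <= ball_ind K 1 y by apply: HK => //; exact: muW.
have cU y : sqnorm y != 1 -> (fun j => U (c_ j) y A) @ \oo --> U c y A.
  exact: (@eigen_ext_cvg R m k b m_ge2 (Y i0) (fun j => mu (c_ j)) c_ (mu c) c M A y M_ Mc cmu cc).
have cUx : (fun j => U (c_ j) x A) @ \oo --> U c x A.
  by apply: cU; rewrite xrho lt_eqF.
have cB : (fun j => band (c_ j) (fun y => U (c_ j) y A) x) @ \oo -->
    band c (fun y => U c y A) x.
  apply: (@band_cvg R m m_gt0 c_ c (fun j y => U (c_ j) y A) _ K) => //.
  - by move=> j; exact: meas_eigen_ext (muW _ (c_0 j)).
  - exact: meas_eigen_ext (muW _ c0).
have -> : lambda c = band c (fun y => U c y A) x / U c x A.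
  by rewrite -eqU // mulfK.
apply: cvg_trans (cvgM cB (cvgV UA cUx)); apply: near_eq_cvg.
near=> j; rewrite /= -eqU // mulfK //.
near: j; move/cvgrPdist_lt: cUx => /(_ `|U c x A|); rewrite normr_gt0 => /(_ UA).
apply: filterS => j; apply: contraTneq => ->.
by rewrite subr0 ltxx.
Unshelve. all: by end_near. Qed.

Lemma lambda_continuous (c : R) : 0 < c -> {for c, continuous lambda}.
Proof.
move=> c0; apply: (@cvg_nbhsP R R^o lambda c (lambda c)).2 => u uc.
(* A sequence tending to c > 0 is positive only from some rank on; replacing its other terms by c
   meets the positivity assumption of [lambda_cvg]. *)
pose v j : R := if 0 < u j then u j else c.
have uv : \forall j \near \oo, u j = v j.
  by near=> j; rewrite /v (_ : 0 < u j) //; near: j; exact: cvgr_gt uc 0 c0.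
have v0 j : 0 < v j by rewrite /v; case: ifP.
have vc : v @ \oo --> c by apply: cvg_trans uc; apply: near_eq_cvg; exact: uv.
apply: cvg_trans (lambda_cvg c0 v0 vc).
by apply: near_eq_cvg; apply: filterS uv => j /= ->.
Unshelve. all: by end_near. Qed.

End Continuity.

Theorem theorem6p2 (R : realType) (m : nat) (hm : (2 <= m)%N) (n k : nat)
    (Y : 'I_(monogenic_dim m k) -> 'rV[R]_m -> cliff R m)
    (hY : orthonormal_basis Y)
    (psi : R -> 'I_(monogenic_dim m k) -> 'rV[R]_m -> cliff R m)
    (hpsi : forall c i, 0 < c -> is_cpswf c Y n i (psi c i))
    (lambda : R -> R)
    (hlambda : forall c, 0 < c -> 0 < lambda c /\
       forall i x, Qop (Pc c (fun y => cl_complex (psi c i y))) x =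
                   (lambda c)%:C%C *: cl_complex (psi c i x)) :
  {within `]0, +oo[, continuous lambda}.
Proof.
rewrite continuous_open_subspace; last exact: rray_open.
move=> c; rewrite inE /= in_itv /= andbT => c0.
exact: (lambda_continuous hm hY hpsi hlambda c0).
Qed.
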